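(* Let $\phi:\mathbb D\to\mathbb D$ be analytic and let $(p,q)\in[0,2)\times[0,2)$. Then the composition operator $C_\phi:\mathcal{CA}_p\to\mathcal{CA}_q$, $C_\phi f=f\circ\phi$, is bounded (i.e. it maps $\mathcal{CA}_p$ into $\mathcal{CA}_q$ as a bounded linear operator) if and only if $$\sup_{a\in\mathbb D}\frac{(1-|a|^2)^{1-q}}{(1-|\phi(a)|^2)^{1-p}}\,\|\sigma_{\phi(a)}\circ\phi\circ\sigma_a\|_2^2<\infty .$$
   Context: $\mathbb D$ is the open unit disk and $\mathbb T$ the unit circle in $\mathbb C$; $|d\xi|$ denotes arc-length measure on $\mathbb T$ (total mass $2\pi$). For $b\in\mathbb D$, $\sigma_b(z)=\frac{b-z}{1-\bar b z}$. For $f$ in the Hardy space $\mathcal H^2$ on $\mathbb D$, $f$ also denotes its radial boundary function on $\mathbb T$ (defined a.e.), and $\|f\|_2=\left(\int_{\mathbb T}|f(\xi)|^2|d\xi|\right)^{1/2}$. For $p\in\mathbb R$, the analytic Campanato space $\mathcal{CA}_p$ consists of all $f\in\mathcal H^2$ with $$\|f\|_{\mathcal{CA}_p}=\sup_{I\subseteq\mathbb T}\left(|I|^{-p}\int_I|f(\xi)-f_I|^2|d\xi|\right)^{1/2}<\infty,$$ where the supremum is over all sub-arcs $I\subseteq\mathbb T$, $|I|$ is the arc-length of $I$, and $f_I=|I|^{-1}\int_I f(\xi)|d\xi|$. It is a Banach space under the norm $|f(0)|+\|f\|_{\mathcal{CA}_p}$. *)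

(* Defs.v *)
From HB Require Import structures.
From mathcomp Require Import all_boot all_order all_algebra.
From mathcomp Require Import complex.
From mathcomp Require Import all_classical all_reals all_analysis.

Set Implicit Arguments.
Unset Strict Implicit.
Unset Printing Implicit Defensive.

Import Order.TTheory GRing.Theory Num.Theory.
Import numFieldNormedType.Exports.

Local Open Scope classical_set_scope.
Local Open Scope ring_scope.
Local Open Scope complex_scope.

(* [R[i]] itself carries no topology; seen as a numClosedFieldType it inherits
   the normed-space structure attached to every such field. *)
Definition cplx (R : realType) : numClosedFieldType := R[i].

(* [`|z|] lives in [R[i]]; this is the same modulus as a real number. *)
Definition cabs (R : realType) (z : cplx R) : R := Normc.normc z.

Definition unit_disk (R : realType) : set (cplx R) := [set z | cabs z < 1].

(* Functions on the disk are represented by total functions on [cplx R]; their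
   values outside the disk play no role in what follows. *)
Definition analytic_on_disk (R : realType) (f : cplx R -> cplx R) : Prop :=
  forall z, unit_disk z -> derivable f z 1.

Definition expi (R : realType) (t : R) : cplx R := cos t +i* sin t.

Definition hardy2 (R : realType) (f : cplx R -> cplx R) : Prop :=
  analytic_on_disk f /\
  (ereal_sup [set \int[@lebesgue_measure R]_(t in `[0, 2 * pi]%classic%R)
                    ((cabs (f (r%:C * expi t)) ^+ 2)%R)%:E
             | r in [set r : R | (0 <= r < 1)%R]] < +oo)%E.

(* Where the radial limit does not exist, [lim] takes a default value; for [f]
   in the Hardy space this concerns a null set only. *)
Definition boundary (R : realType) (f : cplx R -> cplx R) (xi : cplx R)
  : cplx R := lim (f (r%:C * xi) @[r --> (1 : R)^'-]).

(* Angles of the arc {e^{it} | alpha <= t <= alpha + l}, which has length [l]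
   when l <= 2 pi; the arc-length measure is then [dt]. *)
Definition circle_arc (R : realType) (alpha l : R) : set R :=
  `[alpha, alpha + l]%classic.

Definition norm2 (R : realType) (f : cplx R -> cplx R) : \bar R :=
  poweR (\int[@lebesgue_measure R]_(t in circle_arc 0 (2 * pi))
           ((cabs (boundary f (expi t)) ^+ 2)%R)%:E)%E 2^-1.

Definition arc_mean (R : realType) (f : cplx R -> cplx R) (alpha l : R)
  : cplx R :=
  (l^-1)%:C *
  (Rintegral (@lebesgue_measure R) (circle_arc alpha l)
     (fun t => complex.Re (boundary f (expi t))) +i*
   Rintegral (@lebesgue_measure R) (circle_arc alpha l)
     (fun t => complex.Im (boundary f (expi t)))).

Definition campanato_seminorm (R : realType) (p : R) (f : cplx R -> cplx R)
  : \bar R :=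
  ereal_sup
    [set poweR ((I.2 `^ (- p))%:E *
                \int[@lebesgue_measure R]_(t in circle_arc I.1 I.2)
                  ((cabs (boundary f (expi t) - arc_mean f I.1 I.2) ^+ 2)%R)%:E)%E
               2^-1
    | I in [set I : R * R | 0 < I.2 <= 2 * pi]].

Definition campanato (R : realType) (p : R) (f : cplx R -> cplx R) : Prop :=
  hardy2 f /\ (campanato_seminorm p f < +oo)%E.

Definition campanato_norm (R : realType) (p : R) (f : cplx R -> cplx R)
  : \bar R := ((cabs (f 0%R))%:E + campanato_seminorm p f)%E.

Definition bounded_campanato_operator (R : realType) (p q : R)
    (T : (cplx R -> cplx R) -> (cplx R -> cplx R)) : Prop :=
  [/\ forall f, campanato p f -> campanato q (T f),
      forall (c : cplx R) f g, campanato p f -> campanato p g ->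
        forall z, unit_disk z ->
          T (fun w => c * f w + g w) z = c * T f z + T g z
    & exists M : R, forall f, campanato p f ->
        (campanato_norm q (T f) <= M%:E * campanato_norm p f)%E].

Definition composition_operator (R : realType) (phi : cplx R -> cplx R)
  : (cplx R -> cplx R) -> (cplx R -> cplx R) := fun f => f \o phi.

Definition sigma (R : realType) (b z : cplx R) : cplx R :=
  (b - z) / (1 - b^* * z).

(* Main.v *)
(* By the Poisson formula, [h \o sigma a - h a] has squared Hardy norm equal to the
   mean of [|h - h a|^2] against the Poisson kernel at [a], which has height
   about [1 / (1 - |a|)] on the arc of length [1 - |a|] facing [a] and decays
   like [4 ^- j] on its [2 ^ j]-fold dilation. Hence [h] has [CA_p] seminorm
   at most a multiple of [S] if and only if
     [||h \o sigma a - h a||^2 <= C * S^2 * (1 - |a|^2) ^ (p - 1)] for all [a].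
   With [b = phi a] and [psi = sigma b \o phi \o sigma a], which fixes [0],
     [f \o phi \o sigma a - f b = (f \o sigma b - f b) \o psi].
   If [g 0 = 0], then [|g w|^2] is at most a harmonic function vanishing at [0]
   plus [20 * ||g||^2 * |w|^2], so [||g \o psi||^2 <= 20 * ||g||^2 * ||psi||^2]:
   the condition suffices. Conversely the functions
   [(1 - |b|^2) ^ ((p - 1) / 2) * (sigma b - b)] are bounded in [CA_p], and
   testing on them gives the condition back.

   Hardy norms are suprema of means over circles. They are related to boundary
   values through Fatou's theorem on radial limits, which follows from the
   Hardy-Littlewood maximal inequality. The Poisson formula itself rests on
   Goursat's theorem, as derivatives are not assumed continuous. *)

(* Exact identities live on circles of radius below [1], whereas the seminorm and [norm2] see
   boundary values, which exist only almost everywhere. Estimates are therefore proved at the radii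
   [dilr n], which increase to [1], and transferred in two ways. Upper bounds pass to the boundary
   by Fatou's lemma without loss. Conversely, the dilates of [h] converge to its boundary values in
   L2 on arcs, which brings bounds back to circles at the cost of a factor [2]. Since every
   comparison is up to constants, such losses are harmless.

   The bound on [g \o psi] must be quadratic in [psi], and a harmonic majorant of [|g|^2] alone does
   not give this. Removing its Taylor polynomial of order [1] at [0] does, and the mean along [psi]
   of what is removed is again known, since it is the real part of an analytic polynomial.

   The range of [p] enters through the exponent [p - 1], which lies in [[-1, 1]], so that comparable
   quantities have comparable powers, and through [2 ^ p < 4], which makes the dyadic sums against
   the Poisson kernel converge. *)
Require Import Defs.
From HB Require Import structures.
From mathcomp Require Import all_boot all_order all_algebra.
From mathcomp Require Import complex ring lra.
From mathcomp Require Import all_classical all_reals all_analysis.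
From mathcomp Require Import measurable_realfun.

Set Implicit Arguments.
Unset Strict Implicit.
Unset Printing Implicit Defensive.

Import Order.TTheory GRing.Theory Num.Theory.
Import numFieldNormedType.Exports.

Local Open Scope classical_set_scope.
Local Open Scope ring_scope.
Local Open Scope complex_scope.

(** * Complex numbers *)

Section ComplexBasics.
Variable R : realType.
Implicit Types (z w : cplx R) (x y : R).

Lemma cReD z w : complex.Re (z + w) = complex.Re z + complex.Re w.
Proof. by case: z; case: w. Qed.
Lemma cImD z w : complex.Im (z + w) = complex.Im z + complex.Im w.
Proof. by case: z; case: w. Qed.
Lemma cReN z : complex.Re (- z) = - complex.Re z.
Proof. by case: z. Qed.
Lemma cImN z : complex.Im (- z) = - complex.Im z.
Proof. by case: z. Qed.
Lemma cReM z w : complex.Re (z * w) =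
  complex.Re z * complex.Re w - complex.Im z * complex.Im w.
Proof. by case: z; case: w. Qed.
Lemma cImM z w : complex.Im (z * w) =
  complex.Re z * complex.Im w + complex.Im z * complex.Re w.
Proof. by case: z => a b; case: w => c d /=; rewrite addrC; congr (_ + _); rewrite mulrC. Qed.

Definition conjz z : cplx R := (z^*)%C.

Lemma Re_conjz z : complex.Re (conjz z) = complex.Re z.
Proof. by case: z. Qed.
Lemma Im_conjz z : complex.Im (conjz z) = - complex.Im z.
Proof. by case: z. Qed.
Lemma conjzD z w : conjz (z + w) = conjz z + conjz w.
Proof. exact: (raddfD (@conjc R)). Qed.
Lemma conjzM z w : conjz (z * w) = conjz z * conjz w.
Proof. exact: (rmorphM (@conjc R)). Qed.
Lemma conjzK z : conjz (conjz z) = z.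
Proof. by case: z => a b; rewrite /conjz /= opprK. Qed.

(* [x%:C] has type [R[i]], which carries no topology; see [cplx]. *)
Definition rc x : cplx R := x%:C.

Lemma rcD x y : rc (x + y) = rc x + rc y.
Proof. exact: (rmorphD (real_complex R)). Qed.
Lemma rcM x y : rc (x * y) = rc x * rc y.
Proof. exact: (rmorphM (real_complex R)). Qed.
Lemma rcN x : rc (- x) = - rc x.
Proof. exact: (rmorphN (real_complex R)). Qed.
Lemma rcV x : rc (x^-1) = (rc x)^-1.
Proof. exact: (fmorphV (real_complex R)). Qed.

Lemma cabs_ge0 z : 0 <= cabs z.
Proof. by case: z => a b; rewrite /cabs /= sqrtr_ge0. Qed.
Lemma cabsM z w : cabs (z * w) = cabs z * cabs w.
Proof. exact: Normc.normcM. Qed.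
Lemma cabsD z w : cabs (z + w) <= cabs z + cabs w.
Proof. exact: le_normcD. Qed.
Lemma cabsN z : cabs (- z) = cabs z.
Proof. exact: normcN. Qed.
Lemma cabs2 z : cabs z ^+ 2 = complex.Re z ^+ 2 + complex.Im z ^+ 2.
Proof. by case: z => a b; rewrite /cabs /= sqr_sqrtr// addr_ge0// sqr_ge0. Qed.
Lemma normC_cabs z : `|z| = rc (cabs z).
Proof. by case: z. Qed.

(** The radii of balls in [cplx R] are positive complex numbers. Positivity there forces the
    imaginary part to vanish, so real radii suffice. *)
Lemma cvg_cabsP {T : Type} (F : set_system T) {FF : Filter F} (f : T -> cplx R) l :
  f @ F --> l <-> forall e : R, 0 < e -> \forall x \near F, cabs (l - f x) < e.
Proof.
split.
  move=> /cvgrPdist_lt h e e0.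
  have := h (rc e); rewrite /rc ltcR => /(_ e0).
  by apply: filterS => x; rewrite normC_cabs ltcR.
move=> h; apply/cvgrPdist_lt => e e0.
have e0' := e0.
move: e0'; rewrite ltcE /= => /andP[/eqP i0 r0].
have ee : e = rc (complex.Re e) by case: e e0 i0 r0 => a b _ /= -> _.
by have := h _ r0; apply: filterS => x; rewrite normC_cabs ee /rc ltcR.
Qed.

End ComplexBasics.

Notation intg a b f :=
  (Rintegral (@lebesgue_measure _) `[a, b]%classic f).

(** * Integrals and means *)

Section RealIntegrals.
Variable R : realType.
Implicit Types (f g u v : R -> R) (a b c x : R).
Let mu := @lebesgue_measure R.

Lemma continuous_itvle_integrable f a b : continuous f ->
  mu.-integrable `[a, b] (EFin \o f).
Proof.
move=> cf; apply: continuous_compact_integrable; first exact: segment_compact.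
exact: continuous_subspaceT.
Qed.

Lemma eq_intg a b f g : (forall x, a <= x <= b -> f x = g x) ->
  intg a b f = intg a b g.
Proof. by move=> fg; apply: eq_Rintegral => x; rewrite inE /= in_itv /=; exact: fg. Qed.

Lemma intgD a b f g : continuous f -> continuous g ->
  intg a b (fun x => f x + g x) = intg a b f + intg a b g.
Proof. by move=> cf cg; rewrite RintegralD//; exact: continuous_itvle_integrable. Qed.

Lemma intgB a b f g : continuous f -> continuous g ->
  intg a b (fun x => f x - g x) = intg a b f - intg a b g.
Proof. by move=> cf cg; rewrite RintegralB//; exact: continuous_itvle_integrable. Qed.

Lemma intgZ a b c f : continuous f ->
  intg a b (fun x => c * f x) = c * intg a b f.
Proof. by move=> cf; rewrite RintegralZl//; exact: continuous_itvle_integrable. Qed.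

Lemma intg_cst a b c : a <= b -> intg a b (fun=> c) = c * (b - a).
Proof.
move=> ab; rewrite Rintegral_cst//= lebesgue_measure_itv /= lte_fin.
by case: ltgtP ab => //= -> _; rewrite subrr.
Qed.

Lemma le_intg a b f g : continuous f -> continuous g ->
  (forall x, a <= x <= b -> f x <= g x) -> intg a b f <= intg a b g.
Proof.
move=> cf cg fg; apply: le_Rintegral => //; try exact: continuous_itvle_integrable.
Qed.

Lemma intg_ge0 a b f : (forall x, a <= x <= b -> 0 <= f x) -> 0 <= intg a b f.
Proof. by move=> f0; apply: Rintegral_ge0 => x /=; rewrite in_itv /=; exact: f0. Qed.

Lemma ler_norm_intg a b f : continuous f ->
  `|intg a b f| <= intg a b (fun x => `|f x|).
Proof. by move=> cf; apply: le_normr_Rintegral => //; exact: continuous_itvle_integrable. Qed.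

Lemma intg_cat a b c f : continuous f -> a <= b -> b <= c ->
  intg a c f = intg a b f + intg b c f.
Proof.
move=> cf ab bc.
have := @Rintegral_itvB R f (BLeft a) (BRight c) b
  (continuous_itvle_integrable _ _ cf).
rewrite !bnd_simp => /(_ ab bc) h.
rewrite -[LHS](subrK (intg a b f)) h addrC; congr (_ + _).
rewrite Rintegral_itv_obnd_cbnd//.
apply: integrableS (continuous_itvle_integrable b c cf) => //.
by apply: subset_itvr; rewrite bnd_simp.
Qed.

Lemma intg_shift a b c f : continuous f -> a <= b ->
  intg a b (fun x => f (x + c)) = intg (a + c) (b + c) f.
Proof.
move=> cf ab; rewrite /Rintegral; congr fine; symmetry.
have d1 x : is_derive x 1 (fun y : R => y + c) 1.
  by apply: is_derive_eq; rewrite addr0.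
have e1 : derive1 (fun y : R => y + c) = cst 1.
  by apply/funext => x; rewrite derive1E; have [_ ->] := d1 x.
rewrite (@integration_by_substitution_increasing _ (fun y => y + c))//.
- by rewrite e1; apply: eq_integral => x _ /=; rewrite mulr1.
- by move=> x y _ _; rewrite ltrD2r.
- by rewrite e1 => x _; exact: cst_continuous.
- by rewrite e1; exact: is_cvg_cst.
- by rewrite e1; exact: is_cvg_cst.
- split.
  + by move=> x _; have [] := d1 x.
  + by apply: cvg_at_right_filter; apply: cvgD; [exact: cvg_id|exact: cvg_cst].
  + by apply: cvg_at_left_filter; apply: cvgD; [exact: cvg_id|exact: cvg_cst].
- exact: continuous_subspaceT.
Qed.

(** Fatou's lemma for a bound that holds only eventually, the form in which all upper bounds pass to
    a limit radius. On [D] the limit is the lower limit of the measurable [f_ n]. *)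
Lemma fatou_le (D : set R) (mD : measurable D) (f_ : nat -> R -> R) f (B : \bar R) :
  (forall n, measurable_fun D (f_ n)) ->
  (forall n x, D x -> 0 <= f_ n x) ->
  (forall x, D x -> f_ n x @[n --> \oo] --> f x) ->
  (\forall n \near \oo, (\int[mu]_(x in D) (f_ n x)%:E <= B)%E) ->
  (\int[mu]_(x in D) (f x)%:E <= B)%E.
Proof.
move=> mf f0 ff [N _ hB].
have mf' n : measurable_fun D (EFin \o f_ n) by exact/measurable_EFinP.
have f0' (n : nat) (x : R) : D x -> (0 <= (f_ n x)%:E)%E.
  by move=> Dx; rewrite lee_fin f0.
have -> : (\int[mu]_(x in D) (f x)%:E =
    \int[mu]_(x in D) limn_einf (fun n => (f_ n x)%:E))%E.
  apply: eq_integral => x; rewrite inE => Dx.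
  have h : (f_ n x)%:E @[n --> \oo] --> (f x)%:E.
    by apply: cvg_EFin; [exact: nearW|exact: ff].
  by rewrite (cvg_limn_einf_sup h).1.
apply: (le_trans (fatou mu mD mf' f0')).
rewrite limn_einf_lim; apply: lime_le; first exact: is_cvg_einfs.
apply: nearW => n; apply: ge_ereal_inf.
exists (\int[mu]_(x in D) (f_ (maxn n N) x)%:E)%E.
  by exists (maxn n N) => //=; rewrite leq_maxl.
by apply: hB; rewrite /= leq_maxr.
Qed.

Lemma intgE a b f : continuous f ->
  (intg a b f)%:E = (\int[mu]_(x in `[a, b]) (f x)%:E)%E.
Proof.
move=> cf; rewrite /Rintegral fineK//.
by apply: integrable_fin_num => //; exact: continuous_itvle_integrable.
Qed.

Lemma intg_fatou a b (f_ : nat -> R -> R) f B :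
  (forall n, continuous (f_ n)) -> continuous f ->
  (forall n x, a <= x <= b -> 0 <= f_ n x) ->
  (forall x, a <= x <= b -> f_ n x @[n --> \oo] --> f x) ->
  (\forall n \near \oo, intg a b (f_ n) <= B) ->
  intg a b f <= B.
Proof.
move=> cf_ cf f0 ff hB; rewrite -lee_fin intgE//.
apply: (@fatou_le _ _ f_) => //.
  by move=> n; apply: measurable_funTS; exact: continuous_measurable_fun.
by apply: filterS hB => n; rewrite -lee_fin intgE.
Qed.

Lemma continuous_bigsum (T : topologicalType) (K : numFieldType) n
    (f_ : nat -> T -> K) : (forall i, continuous (f_ i)) ->
  continuous (fun y : T => \sum_(i < n) f_ i y).
Proof.
move=> cf; elim: n => [|n IH] y.
  by under eq_fun do rewrite big_ord0; exact: cvg_cst.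
under eq_fun do rewrite big_ord_recr.
by apply: cvgD; [exact: IH|exact: cf].
Qed.

(** Splitting the integral over [[a, b + c]] at [b] and at [a + c] gives two sums, in which the
    pieces over [[a, b]] and [[a + c, b + c]] agree by periodicity. *)
Lemma intg_period c f a b : continuous f -> 0 <= c ->
  (forall x, f (x + c) = f x) ->
  intg a (a + c) f = intg b (b + c) f.
Proof.
move=> cf c0 pf; wlog ab : a b / a <= b => [H|].
  by have [/H//|/ltW/H->] := leP a b.
have h1 : intg a (b + c) f = intg a b f + intg b (b + c) f.
  by apply: intg_cat => //; rewrite lerDl.
have h2 : intg a (b + c) f = intg a (a + c) f + intg (a + c) (b + c) f.
  by apply: intg_cat => //; rewrite ?lerDl// lerD2r.
have h3 : intg (a + c) (b + c) f = intg a b f.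
  by rewrite -intg_shift//; apply: eq_intg => x _; exact: pf.
by move: h2; rewrite h1 h3 addrC => /addIr.
Qed.

End RealIntegrals.

Section ComplexMeans.
Variable R : realType.
Implicit Types (z w c : cplx R) (u v : R -> R) (f g : R -> cplx R) (r s t x : R).

Section Continuity.
Variable T : topologicalType.
Implicit Types (F G : T -> cplx R).

Lemma continuous_Re F : continuous F -> continuous (fun y => complex.Re (F y)).
Proof.
move=> cF y; apply/cvgrPdist_lt => e e0.
have /cvg_cabsP/(_ _ e0) := cF y; apply: filterS => z; apply: le_lt_trans.
rewrite -cReN -cReD -ler_sqr ?nnegrE ?cabs_ge0// real_normK ?num_real//.
by rewrite cabs2 lerDl sqr_ge0.
Qed.

Lemma continuous_Im F : continuous F -> continuous (fun y => complex.Im (F y)).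
Proof.
move=> cF y; apply/cvgrPdist_lt => e e0.
have /cvg_cabsP/(_ _ e0) := cF y; apply: filterS => z; apply: le_lt_trans.
rewrite -cImN -cImD -ler_sqr ?nnegrE ?cabs_ge0// real_normK ?num_real//.
by rewrite cabs2 lerDr sqr_ge0.
Qed.

Lemma cabs_le_ReIm z : cabs z <= `|complex.Re z| + `|complex.Im z|.
Proof.
rewrite -ler_sqr ?nnegrE ?cabs_ge0 ?addr_ge0// cabs2 sqrrD !real_normK ?num_real//.
by rewrite [leRHS]addrAC lerDl mulrn_wge0// mulr_ge0.
Qed.

Lemma cvg_ReIm (I : Type) (A : set_system I) {FA : Filter A} (h : I -> cplx R) z :
  (complex.Re (h i) @[i --> A] --> complex.Re z) ->
  (complex.Im (h i) @[i --> A] --> complex.Im z) ->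
  h i @[i --> A] --> z.
Proof.
move=> /cvgrPdist_lt hr /cvgrPdist_lt hi; apply/cvg_cabsP => e e0.
have e2 : 0 < e / 2 by rewrite divr_gt0.
have := hr _ e2; have := hi _ e2; apply: filterS2 => i h2 h1.
apply: (le_lt_trans (cabs_le_ReIm _)).
by rewrite !cReD !cImD !cReN !cImN (splitr e) ltrD.
Qed.

Lemma cvg_Re (I : Type) (A : set_system I) {FA : Filter A} (h : I -> cplx R) z :
  h i @[i --> A] --> z -> (complex.Re (h i) @[i --> A] --> complex.Re z).
Proof.
move=> /cvg_cabsP hz; apply/cvgrPdist_lt => e e0.
have := hz _ e0; apply: filterS => i; apply: le_lt_trans.
rewrite -cReN -cReD -ler_sqr ?nnegrE ?cabs_ge0// real_normK ?num_real//.
by rewrite cabs2 lerDl sqr_ge0.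
Qed.

Lemma cvg_Im (I : Type) (A : set_system I) {FA : Filter A} (h : I -> cplx R) z :
  h i @[i --> A] --> z -> (complex.Im (h i) @[i --> A] --> complex.Im z).
Proof.
move=> /cvg_cabsP hz; apply/cvgrPdist_lt => e e0.
have := hz _ e0; apply: filterS => i; apply: le_lt_trans.
rewrite -cImN -cImD -ler_sqr ?nnegrE ?cabs_ge0// real_normK ?num_real//.
by rewrite cabs2 lerDr sqr_ge0.
Qed.

Lemma cvg_cabs2 (I : Type) (A : set_system I) {FA : Filter A} (h : I -> cplx R) z :
  h i @[i --> A] --> z -> cabs (h i) ^+ 2 @[i --> A] --> cabs z ^+ 2.
Proof.
move=> hz; under eq_fun do rewrite cabs2 !expr2; rewrite cabs2 !expr2.
have h1 := @cvg_Re _ _ FA _ _ hz; have h2 := @cvg_Im _ _ FA _ _ hz.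
by apply: cvgD; apply: cvgM; (exact: h1 || exact: h2).
Qed.

Lemma continuous_mk (u v : T -> R) : continuous u -> continuous v ->
  continuous (fun y => (u y +i* v y : cplx R)).
Proof. by move=> cu cv y; apply: cvg_ReIm; [exact: cu|exact: cv]. Qed.

Lemma continuous_cabs2 F : continuous F -> continuous (fun y => cabs (F y) ^+ 2).
Proof. by move=> cF y; apply: cvg_cabs2; exact: cF. Qed.

Lemma continuousDc F G : continuous F -> continuous G ->
  continuous (fun y => F y + G y).
Proof. by move=> cF cG y; apply: cvgD; [exact: cF|exact: cG]. Qed.

Lemma continuousMc F G : continuous F -> continuous G ->
  continuous (fun y => F y * G y).
Proof. by move=> cF cG y; apply: cvgM; [exact: cF|exact: cG]. Qed.

Lemma continuous_conj F : continuous F -> continuous (fun y => conjz (F y)).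
Proof.
move=> cF y; apply: cvg_ReIm; rewrite ?Re_conjz ?Im_conjz.
  by under eq_fun do rewrite Re_conjz; exact: continuous_Re.
by under eq_fun do rewrite Im_conjz; apply: cvgN; exact: continuous_Im.
Qed.

Lemma continuousXc n F : continuous F -> continuous (fun y => F y ^+ n).
Proof.
move=> cF; elim: n => [|n IH] y.
  by under eq_fun do rewrite expr0; exact: cvg_cst.
by under eq_fun do rewrite exprS; apply: continuousMc.
Qed.

End Continuity.

Lemma continuous_expi : continuous (@expi R).
Proof. by apply: continuous_mk; [exact: continuous_cos|exact: continuous_sin]. Qed.

Lemma expiD s t : expi (s + t) = expi s * expi t.
Proof. by rewrite /expi cosD sinD; congr (_ +i* _); rewrite addrC; congr (_ + _); exact: mulrC. Qed.

Lemma cabs_expi t : cabs (expi t) = 1.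
Proof. by rewrite /cabs /= cos2Dsin2 sqrtr1. Qed.

Lemma conj_expi t : conjz (expi t) = expi (- t).
Proof. by rewrite /expi cosN sinN. Qed.

Lemma expi0 : expi (0 : R) = 1.
Proof. by rewrite /expi cos0 sin0. Qed.

Lemma expi_pi : expi (pi : R) = -1.
Proof. by rewrite /expi cospi sinpi; apply/eqP; rewrite eq_complex /= oppr0 !eqxx. Qed.

Lemma expi_period t : expi (t + 2 * pi) = expi t.
Proof. by rewrite mulr_natl mulr2n addrA expiD (expiD t) expi_pi !mulrN1 opprK. Qed.

Lemma expiX t n : expi t ^+ n = expi (n%:R * t).
Proof.
elim: n => [|n IH]; first by rewrite mul0r expi0.
by rewrite exprS IH -expiD -natr1 mulrDl mul1r addrC.
Qed.

Lemma expi_mulJ t : expi t * conjz (expi t) = 1.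
Proof. by rewrite conj_expi -expiD subrr expi0. Qed.

Definition rmean u : R := (2 * pi)^-1 * intg 0 (2 * pi) u.
Definition cmean f : cplx R :=
  rmean (fun t => complex.Re (f t)) +i* rmean (fun t => complex.Im (f t)).

Lemma twopi_gt0 : 0 < 2 * pi :> R.
Proof. by rewrite mulr_gt0// pi_gt0. Qed.

Lemma eq_rmean u v : (forall t, u t = v t) -> rmean u = rmean v.
Proof. by move=> uv; rewrite /rmean; congr (_ * _); apply: eq_intg => t _. Qed.

Lemma rmeanD u v : continuous u -> continuous v ->
  rmean (fun t => u t + v t) = rmean u + rmean v.
Proof. by move=> cu cv; rewrite /rmean intgD// mulrDr. Qed.

Lemma rmeanB u v : continuous u -> continuous v ->
  rmean (fun t => u t - v t) = rmean u - rmean v.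
Proof. by move=> cu cv; rewrite /rmean intgB// mulrBr. Qed.

Lemma rmeanZ x u : continuous u -> rmean (fun t => x * u t) = x * rmean u.
Proof. by move=> cu; rewrite /rmean intgZ// mulrCA. Qed.

Lemma rmean_cst x : rmean (fun=> x) = x.
Proof.
rewrite /rmean intg_cst ?(ltW twopi_gt0)// subr0 mulrCA mulVf ?mulr1//.
by rewrite gt_eqF// twopi_gt0.
Qed.

Lemma ler_rmean u v : continuous u -> continuous v -> (forall t, u t <= v t) ->
  rmean u <= rmean v.
Proof.
move=> cu cv uv; rewrite /rmean ler_wpM2l ?invr_ge0 ?(ltW twopi_gt0)//.
by apply: le_intg.
Qed.

Lemma rmean_ge0 u : (forall t, 0 <= u t) -> 0 <= rmean u.
Proof.
move=> u0; rewrite mulr_ge0 ?invr_ge0 ?(ltW twopi_gt0)//.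
exact: intg_ge0.
Qed.

Lemma ler_norm_rmean u : continuous u -> `|rmean u| <= rmean (fun t => `|u t|).
Proof.
move=> cu; rewrite /rmean normrM ger0_norm ?invr_ge0 ?(ltW twopi_gt0)//.
by rewrite ler_wpM2l ?invr_ge0 ?(ltW twopi_gt0)// ler_norm_intg.
Qed.

Lemma rmean_shift u x : continuous u -> (forall t, u (t + 2 * pi) = u t) ->
  rmean (fun t => u (t + x)) = rmean u.
Proof.
move=> cu pu; rewrite /rmean; congr (_ * _).
rewrite intg_shift ?(ltW twopi_gt0)// add0r (addrC (2 * pi)).
rewrite (@intg_period _ _ _ _ 0)// ?add0r//.
exact: (ltW twopi_gt0).
Qed.

Lemma rmean_fatou (u_ : nat -> R -> R) u B :
  (forall n, continuous (u_ n)) -> continuous u ->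
  (forall n t, 0 <= u_ n t) ->
  (forall t, u_ n t @[n --> \oo] --> u t) ->
  (\forall n \near \oo, rmean (u_ n) <= B) ->
  rmean u <= B.
Proof.
move=> cu_ cu u0 uu hB; rewrite /rmean ler_pdivrMl ?twopi_gt0//.
apply: (@intg_fatou _ _ _ u_) => //.
by apply: filterS hB => n; rewrite /rmean ler_pdivrMl ?twopi_gt0.
Qed.

Lemma cmean_eq f g : (forall t, f t = g t) -> cmean f = cmean g.
Proof. by move=> fg; congr (_ +i* _); apply: eq_rmean => t; rewrite fg. Qed.

Lemma cmeanD f g : continuous f -> continuous g ->
  cmean (fun t => f t + g t) = cmean f + cmean g.
Proof.
move=> cf cg; rewrite /cmean.
under eq_rmean do rewrite cReD; under [X in _ +i* X]eq_rmean do rewrite cImD.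
have hr := rmeanD (continuous_Re cf) (continuous_Re cg).
have hi := rmeanD (continuous_Im cf) (continuous_Im cg).
by rewrite hr hi.
Qed.

Lemma cmeanZ c f : continuous f -> cmean (fun t => c * f t) = c * cmean f.
Proof.
move=> cf; have cR := continuous_Re cf; have cI := continuous_Im cf.
rewrite /cmean; case: c => a b.
under eq_rmean do rewrite cReM /=; under [X in _ +i* X]eq_rmean do rewrite cImM /=.
have cZ x u : continuous u -> continuous (fun t => x * u t).
  by move=> cu t; apply: cvgM; [exact: cvg_cst|exact: cu].
rewrite (rmeanB (cZ a _ cR) (cZ b _ cI)) (rmeanD (cZ a _ cI) (cZ b _ cR)).
by rewrite (rmeanZ a cR) (rmeanZ b cI) (rmeanZ a cI) (rmeanZ b cR).
Qed.

Lemma cmean_cst c : cmean (fun=> c) = c.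
Proof. by rewrite /cmean !rmean_cst; case: c. Qed.

Lemma cmean_sum n (f_ : nat -> R -> cplx R) : (forall i, continuous (f_ i)) ->
  cmean (fun t => \sum_(i < n) f_ i t) = \sum_(i < n) cmean (f_ i).
Proof.
move=> cf; elim: n => [|n IH].
  by rewrite big_ord0; under cmean_eq do rewrite big_ord0; exact: cmean_cst.
rewrite big_ord_recr /= -IH -cmeanD//; last exact: continuous_bigsum.
by apply: cmean_eq => t; rewrite big_ord_recr.
Qed.

Lemma cmean_shift f x : continuous f -> (forall t, f (t + 2 * pi) = f t) ->
  cmean (fun t => f (t + x)) = cmean f.
Proof.
move=> cf pf; rewrite /cmean; congr (_ +i* _).
  apply: (@rmean_shift (fun t => complex.Re (f t))); first exact: continuous_Re.
  by move=> t; rewrite pf.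
apply: (@rmean_shift (fun t => complex.Im (f t))); first exact: continuous_Im.
by move=> t; rewrite pf.
Qed.

Lemma cmean_conj f : continuous f -> cmean (fun t => conjz (f t)) = conjz (cmean f).
Proof.
move=> cf; rewrite /cmean /conjz /=; congr (_ +i* _).
  by apply: eq_rmean => t; rewrite Re_conjz.
rewrite -mulN1r -rmeanZ; last exact: continuous_Im.
by apply: eq_rmean => t; rewrite Im_conjz mulN1r.
Qed.

(** Rotation by [pi / n] changes the sign of the integrand and preserves the mean. *)
Lemma cmean_expiX n : (0 < n)%N -> cmean (fun t => expi t ^+ n) = 0.
Proof.
move=> n0; have cE : continuous (fun t => expi t ^+ n).
  by apply: continuousXc; exact: continuous_expi.
have nz : n%:R != 0 :> R by rewrite pnatr_eq0 -lt0n.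
have h : cmean (fun t => expi (t + pi / n%:R) ^+ n) = cmean (fun t => expi t ^+ n).
  by apply: (@cmean_shift (fun t => expi t ^+ n)) => // t; rewrite expi_period.
have : cmean (fun t => expi t ^+ n) = - cmean (fun t => expi t ^+ n).
  rewrite -{1}h -[RHS]mulN1r -(cmeanZ (-1) cE); apply: cmean_eq => t.
  rewrite expiD exprMn mulrC (expiX (pi / _)); congr (_ * _).
  have e : n%:R * (pi / n%:R) = pi :> R.
    by rewrite mulrC; exact: divfK.
  by rewrite e; exact: expi_pi.
by move/eqP; rewrite -addr_eq0 -mulr2n mulrn_eq0 /= => /eqP.
Qed.

End ComplexMeans.

(** * Goursat's theorem *)

Section Goursat.
Variable R : realType.
Implicit Types (z w c : cplx R) (f g : R -> cplx R).

Definition cintg (a b : R) f : cplx R :=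
  intg a b (fun t => complex.Re (f t)) +i* intg a b (fun t => complex.Im (f t)).

Lemma cintgD a b f g : continuous f -> continuous g ->
  cintg a b (fun t => f t + g t) = cintg a b f + cintg a b g.
Proof.
move=> cf cg; rewrite /cintg.
under eq_intg do rewrite cReD; under [X in _ +i* X]eq_intg do rewrite cImD.
have hr := intgD a b (continuous_Re cf) (continuous_Re cg).
have hi := intgD a b (continuous_Im cf) (continuous_Im cg).
by rewrite hr hi.
Qed.

Lemma eq_cintg a b f g : (forall t, a <= t <= b -> f t = g t) ->
  cintg a b f = cintg a b g.
Proof. by move=> fg; congr (_ +i* _); apply: eq_intg => t tab; rewrite fg. Qed.

Lemma cintg_cst a b c : a <= b -> cintg a b (fun=> c) = c * rc (b - a).
Proof.
move=> ab; rewrite /cintg !intg_cst//; case: c => x y.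
by apply/eqP; rewrite eq_complex /= !mulr0 subr0 add0r !eqxx.
Qed.

Lemma cintg_cat (a b c : R) f : continuous f -> a <= b -> b <= c ->
  cintg a c f = cintg a b f + cintg b c f.
Proof.
move=> cf ab bc; rewrite /cintg.
by rewrite (intg_cat (continuous_Re cf) ab bc) (intg_cat (continuous_Im cf) ab bc).
Qed.

Lemma cintg_split2 (a m b : R) f g h : continuous f -> continuous g ->
  a <= m -> m <= b -> (forall t, h t = f t + g t) ->
  cintg a b h = cintg a m f + cintg m b f + (cintg a m g + cintg m b g).
Proof.
move=> cf cg am mb hE; rewrite -(cintg_cat cf am mb) -(cintg_cat cg am mb).
rewrite -(cintgD a b cf cg); apply: eq_cintg => t _; exact: hE.
Qed.

Lemma cintg_add_cst (a b : R) f h c : continuous f -> a <= b ->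
  (forall t, h t = f t + c) -> cintg a b h = cintg a b f + c * rc (b - a).
Proof.
move=> cf ab hE; rewrite -(cintg_cst c ab) -(@cintgD a b f (fun=> c) cf).
  by apply: eq_cintg => t _; exact: hE.
by move=> t; exact: cvg_cst.
Qed.

Lemma telescope_mid (x m y : cplx R) : x - y = (x - m) + (m - y).
Proof. ring. Qed.

Lemma telescope_midC (x m y : cplx R) : x - y = (m - y) + (x - m).
Proof. ring. Qed.

Lemma cabs_Re z : `|complex.Re z| <= cabs z.
Proof.
rewrite -ler_sqr ?nnegrE ?cabs_ge0// real_normK ?num_real//.
by rewrite cabs2 lerDl sqr_ge0.
Qed.

Lemma cabs_Im z : `|complex.Im z| <= cabs z.
Proof.
rewrite -ler_sqr ?nnegrE ?cabs_ge0// real_normK ?num_real//.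
by rewrite cabs2 lerDr sqr_ge0.
Qed.

Lemma norm_intg_le (u : R -> R) a b M : continuous u -> a <= b ->
  (forall t, a <= t <= b -> `|u t| <= M) -> `|intg a b u| <= M * (b - a).
Proof.
move=> cu ab uM; apply: (le_trans (ler_norm_intg _ _ cu)).
rewrite -intg_cst//; apply: le_intg => //; last by move=> t; exact: cst_continuous.
by move=> t; apply: continuous_comp; [exact: cu|exact: norm_continuous].
Qed.

(** The factor [2] comes from estimating real and imaginary parts separately. *)
Lemma cabs_cintg_le f a b M : continuous f -> a <= b ->
  (forall t, a <= t <= b -> cabs (f t) <= M) ->
  cabs (cintg a b f) <= 2 * M * (b - a).
Proof.
move=> cf ab fM; apply: (le_trans (cabs_le_ReIm _)) => /=.
have -> : 2 * M * (b - a) = M * (b - a) + M * (b - a) by ring.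
rewrite lerD//.
  apply: norm_intg_le => //; first exact: continuous_Re.
  by move=> t tab; apply: le_trans (fM _ tab); exact: cabs_Re.
apply: norm_intg_le => //; first exact: continuous_Im.
by move=> t tab; apply: le_trans (fM _ tab); exact: cabs_Im.
Qed.

Definition cpt (x y : R) : cplx R := x +i* y.
Definition ci : cplx R := cpt 0 1.

Lemma cptE x y : cpt x y = rc x + ci * rc y.
Proof. by apply/eqP; rewrite eq_complex /=; apply/andP; split; apply/eqP; ring. Qed.

Section Rectangle.
Variables (G : R -> R -> cplx R) (L H : R).
Hypotheses (L0 : 0 <= L) (H0 : 0 <= H).
Hypothesis cGx : forall y, continuous (fun x => G x y).
Hypothesis cGy : forall x, continuous (G x).

(** Counterclockwise contour integral along the rectangle with lower left corner [(x, y)] and sides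
    [s * L] and [s * H]; opposite sides share one integral. *)
Definition rectint (x y s : R) : cplx R :=
  cintg x (x + s * L) (fun t => G t y - G t (y + s * H)) +
  ci * cintg y (y + s * H) (fun t => G (x + s * L) t - G x t).

Let cGx2 y y' : continuous (fun x => G x y - G x y').
Proof. by move=> x; apply: cvgB; exact: cGx. Qed.
Let cGy2 x x' : continuous (fun y => G x y - G x' y).
Proof. by move=> y; apply: cvgB; exact: cGy. Qed.

Lemma rectint_split x y s : 0 <= s ->
  rectint x y s = rectint x y (s / 2) + rectint (x + s / 2 * L) y (s / 2) +
    rectint x (y + s / 2 * H) (s / 2) +
    rectint (x + s / 2 * L) (y + s / 2 * H) (s / 2).
Proof.
move=> s0; have s20 : 0 <= s / 2 by rewrite divr_ge0.
have e K : s / 2 * K + s / 2 * K = s * K by rewrite -mulrDl -splitr.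
rewrite /rectint -!addrA !e.
have sL : 0 <= s / 2 * L by rewrite mulr_ge0.
have sH : 0 <= s / 2 * H by rewrite mulr_ge0.
have xm : x <= x + s / 2 * L by rewrite lerDl.
have mx : x + s / 2 * L <= x + s * L by rewrite -(e L) addrA lerDl.
have ym : y <= y + s / 2 * H by rewrite lerDl.
have my : y + s / 2 * H <= y + s * H by rewrite -(e H) addrA lerDl.
have -> := cintg_split2 (@cGx2 y (y + s / 2 * H)) (@cGx2 (y + s / 2 * H) (y + s * H)) xm mx
  (fun t => telescope_mid _ (G t (y + s / 2 * H)) _).
have -> := cintg_split2 (@cGy2 (x + s / 2 * L) x) (@cGy2 (x + s * L) (x + s / 2 * L)) ym my
  (fun t => telescope_midC _ (G (x + s / 2 * L) t) _).
ring.
Qed.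

(** Complex differentiability in real coordinates, as the differential is multiplication by [D]. It
    is relative to [Q] because the function to be integrated is extended beyond its rectangle in a
    merely continuous way. *)
Definition cdiff_in (Q : R -> R -> Prop) (x0 y0 : R) := exists D : cplx R,
  forall e : R, 0 < e -> exists2 d : R, 0 < d &
    forall x y, Q x y -> `|x - x0| < d -> `|y - y0| < d ->
      cabs (G x y - G x0 y0 - D * cpt (x - x0) (y - y0)) <=
      e * (`|x - x0| + `|y - y0|).

(* The constant and linear parts integrate to [0] over the boundary. *)
Lemma rectint_small Q X Y : cdiff_in Q X Y -> forall e : R, 0 < e ->
  exists2 d : R, 0 < d & forall x y s : R, 0 <= s -> s * (L + H) < d ->
   (forall t t', x <= t <= x + s * L -> y <= t' <= y + s * H -> Q t t') ->
   x <= X <= x + s * L -> y <= Y <= y + s * H ->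
   cabs (rectint x y s) <= e * s ^+ 2.
Proof.
move=> [D hD] e e0.
(* The estimate ends with [e' * (4 * (L + H) ^+ 2) * s ^+ 2]; the added [1] keeps the denominator
   positive for a degenerate rectangle. *)
pose e' := e / (4 * (L + H) ^+ 2 + 1).
have den0 : 0 < 4 * (L + H) ^+ 2 + 1.
  by rewrite ltr_wpDl// mulr_ge0// sqr_ge0.
have e'0 : 0 < e' by rewrite divr_gt0.
have [d d0 hd] := hD _ e'0; exists d => // x y s s0 sd hQ hX hY.
have sL : 0 <= s * L by rewrite mulr_ge0.
have sH : 0 <= s * H by rewrite mulr_ge0.
pose E t t' := G t t' - G X Y - D * cpt (t - X) (t' - Y).
have hE t t' : x <= t <= x + s * L -> y <= t' <= y + s * H ->
    cabs (E t t') <= e' * (s * (L + H)).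
  move=> ht ht'.
  have h1 : `|t - X| <= s * L by rewrite ler_norml; apply/andP; split; lra.
  have h2 : `|t' - Y| <= s * H by rewrite ler_norml; apply/andP; split; lra.
  apply: (le_trans (hd _ _ (hQ _ _ ht ht') _ _)).
  - by rewrite (le_lt_trans h1)// (le_lt_trans _ sd)// mulrDr lerDl.
  - by rewrite (le_lt_trans h2)// (le_lt_trans _ sd)// mulrDr lerDr.
  - by rewrite ler_pM2l// mulrDr lerD.
have xx : x <= x <= x + s * L by rewrite lexx lerDl.
have xx' : x <= x + s * L <= x + s * L by rewrite lexx lerDl sL.
have yy : y <= y <= y + s * H by rewrite lexx lerDl.
have yy' : y <= y + s * H <= y + s * H by rewrite lexx lerDl sH.
have cEx y1 y2 : continuous (fun t => E t y1 - E t y2).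
  have -> : (fun t => E t y1 - E t y2) =
      (fun t => (G t y1 - G t y2) - D * ci * rc (y1 - y2)).
    apply/funext => t; rewrite /E !cptE !(rcD, rcN); ring.
  by move=> t; apply: cvgB; [exact: cGx2|exact: cvg_cst].
have cEy x1 x2 : continuous (fun t => E x1 t - E x2 t).
  have -> : (fun t => E x1 t - E x2 t) =
      (fun t => (G x1 t - G x2 t) - D * rc (x1 - x2)).
    apply/funext => t; rewrite /E !cptE !(rcD, rcN); ring.
  by move=> t; apply: cvgB; [exact: cGy2|exact: cvg_cst].
have -> : rectint x y s =
    cintg x (x + s * L) (fun t => E t y - E t (y + s * H)) +
    ci * cintg y (y + s * H) (fun t => E (x + s * L) t - E x t).
  rewrite /rectint.
  have xL : x <= x + s * L by rewrite lerDl.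
  have yH : y <= y + s * H by rewrite lerDl.
  have -> := @cintg_add_cst _ _ _ (fun t => G t y - G t (y + s * H))
    (- (D * ci * rc (s * H))) (cEx y (y + s * H)) xL _; last first.
    by move=> t; rewrite /E !cptE !(rcD, rcN); ring.
  have -> := @cintg_add_cst _ _ _ (fun t => G (x + s * L) t - G x t)
    (D * rc (s * L)) (cEy (x + s * L) x) yH _; last first.
    by move=> t; rewrite /E !cptE !(rcD, rcN); ring.
  by rewrite !(rcD, rcN); ring.
have ci1 : cabs ci = 1 by rewrite /cabs /= expr0n expr1n add0r sqrtr1.
apply: (le_trans (cabsD _ _)); rewrite cabsM ci1 mul1r.
have b1 : cabs (cintg x (x + s * L) (fun t => E t y - E t (y + s * H))) <=
    2 * (2 * (e' * (s * (L + H)))) * (s * L).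
  have e1 : x + s * L - x = s * L by ring.
  rewrite -[X in _ <= _ * X]e1.
  apply: cabs_cintg_le; [exact: cEx|by rewrite lerDl|move=> t tt].
  apply: (le_trans (cabsD _ _)); rewrite cabsN mulr_natl mulr2n.
  by apply: lerD; exact: hE.
have b2 : cabs (cintg y (y + s * H) (fun t => E (x + s * L) t - E x t)) <=
    2 * (2 * (e' * (s * (L + H)))) * (s * H).
  have e1 : y + s * H - y = s * H by ring.
  rewrite -[X in _ <= _ * X]e1.
  apply: cabs_cintg_le; [exact: cEy|by rewrite lerDl|move=> t tt].
  apply: (le_trans (cabsD _ _)); rewrite cabsN mulr_natl mulr2n.
  by apply: lerD; exact: hE.
apply: (le_trans (lerD b1 b2)).
have -> : 2 * (2 * (e' * (s * (L + H)))) * (s * L) +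
  2 * (2 * (e' * (s * (L + H)))) * (s * H) = e' * (4 * (L + H) ^+ 2) * s ^+ 2 by ring.
rewrite ler_wpM2r ?sqr_ge0// /e' -mulrA ler_piMr ?(ltW e0)//.
by rewrite mulrC ler_pdivrMr// mul1r lerDl.
Qed.

(** Repeated bisection: some quarter carries at least a quarter of the integral, so nested
    rectangles of scale [s] keep an integral of modulus at least [A * s ^+ 2]. Differentiability at
    their common point bounds it by [A / 2 * s ^+ 2]. *)
Theorem goursat x0 y0 :
  let Q x y := x0 <= x <= x0 + L /\ y0 <= y <= y0 + H in
  (forall x y, Q x y -> cdiff_in Q x y) -> rectint x0 y0 1 = 0.
Proof.
move=> Q hQ; apply: contrapT => /eqP nz.
pose A := cabs (rectint x0 y0 1).
have A0 : 0 < A.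
  rewrite lt_neqAle cabs_ge0 andbT eq_sym; apply: contra nz => /eqP h.
  by apply/eqP; apply: Normc.eq0_normc.
pose hf (k : nat) : R := 2^-1 ^+ k.
have hf0 k : 0 < hf k by rewrite exprn_gt0// invr_gt0.
have hfS k : hf k / 2 = hf k.+1 by rewrite /hf exprSr.
pose P k (p : R * R) := [/\ x0 <= p.1, p.1 + hf k * L <= x0 + L,
   y0 <= p.2, p.2 + hf k * H <= y0 + H & A * hf k ^+ 2 <= cabs (rectint p.1 p.2 (hf k))].
pose S k (p p' : R * R) := [/\ p.1 <= p'.1, p'.1 + hf k.+1 * L <= p.1 + hf k * L,
  p.2 <= p'.2 & p'.2 + hf k.+1 * H <= p.2 + hf k * H].
(* The implication inside the existential, with a dummy witness where [P] fails, makes the choice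
   function total, so that it can be iterated. *)
have step (kp : nat * (R * R)) : exists p', P kp.1 kp.2 -> P kp.1.+1 p' /\ S kp.1 kp.2 p'.
  case: kp => k [x y] /=.
  have [Pk|nP] := pselect (P k (x, y)); last by exists (0, 0).
  case: Pk; rewrite [(x, y).1]/= [(x, y).2]/= => h1 h2 h3 h4 h5.
  have := rectint_split x y (ltW (hf0 k)); rewrite hfS => hs.
  set s := hf k.+1 in hs.
  have sk : hf k = s + s by rewrite /s -hfS -splitr.
  have sp : 0 < s := hf0 k.+1.
  have sL : 0 <= s * L := mulr_ge0 (ltW sp) L0.
  have sH : 0 <= s * H := mulr_ge0 (ltW sp) H0.
  have h2' : x + (s * L + s * L) <= x0 + L by rewrite -mulrDl -sk.
  have h4' : y + (s * H + s * H) <= y0 + H by rewrite -mulrDl -sk.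
  have SQ : A * hf k ^+ 2 = 4 * (A * s ^+ 2) by rewrite sk; ring.
  have : [\/ A * s ^+ 2 <= cabs (rectint x y s),
     A * s ^+ 2 <= cabs (rectint (x + s * L) y s),
     A * s ^+ 2 <= cabs (rectint x (y + s * H) s) |
     A * s ^+ 2 <= cabs (rectint (x + s * L) (y + s * H) s)].
    have tri : A * hf k ^+ 2 <= cabs (rectint x y s) + cabs (rectint (x + s * L) y s) +
       cabs (rectint x (y + s * H) s) + cabs (rectint (x + s * L) (y + s * H) s).
      apply: (le_trans h5); rewrite hs.
      apply: (le_trans (cabsD _ _)); rewrite lerD2r.
      apply: (le_trans (cabsD _ _)); rewrite lerD2r.
      exact: cabsD.
    have [?|l1] := leP (A * s ^+ 2) (cabs (rectint x y s)); first by constructor 1.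
    have [?|l2] := leP (A * s ^+ 2) (cabs (rectint (x + s * L) y s)); first by constructor 2.
    have [?|l3] := leP (A * s ^+ 2) (cabs (rectint x (y + s * H) s)); first by constructor 3.
    have [?|l4] := leP (A * s ^+ 2) (cabs (rectint (x + s * L) (y + s * H) s)); first by constructor 4.
    by move: tri l1 l2 l3 l4; rewrite SQ; clear; move: (cabs _) (cabs _) (cabs _) (cabs _) (A * _) => a1 a2 a3 a4 a5; lra.
  rewrite /P /S /= -/s sk !mulrDl.
  case=> hh; [exists (x, y)|exists (x + s * L, y)|exists (x, y + s * H)|
    exists (x + s * L, y + s * H)] => _; (split; split=> //=);
    clear -sL sH h1 h2' h3 h4'; lra.
have [st hst] := choice step.
pose F := fix F k := if k is k'.+1 then st (k', F k') else (x0, y0).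
have PF k : P k (F k).
  elim: k => [|k IH] /=; last by have [] := hst (k, F k) IH.
  by rewrite /P /hf !expr0 !mul1r expr1n mulr1; split.
have SF k : S k (F k) (F k.+1) by have [] := hst (k, F k) (PF k).
(* Nested intervals: the supremum of the left ends lies in all of them. *)
have lim (K x1 : R) (u : nat -> R) : 0 <= K ->
   (forall k, u k <= u k.+1) -> (forall k, u k.+1 + hf k.+1 * K <= u k + hf k * K) ->
   exists X, forall k, u k <= X <= u k + hf k * K.
  move=> K0 u1 u2.
  have um : {homo u : n m / (n <= m)%N >-> n <= m} by apply/nondecreasing_seqP.
  have vm : {homo (fun k => u k + hf k * K) : n m / (n <= m)%N >-> m <= n}.
    by apply/nonincreasing_seqP.
  have uv n m : u n <= u m + hf m * K.
    apply: (le_trans (um _ (maxn n m) (leq_maxl _ _))).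
    apply: le_trans (vm _ _ (leq_maxr n m)).
    by rewrite lerDl; exact: mulr_ge0 (ltW (hf0 _)) K0.
  exists (sup (range u)) => k; apply/andP; split.
    apply: ub_le_sup; last by exists k.
    by exists (u 0%N + hf 0%N * K) => _ [n _ <-].
  by apply: ge_sup; [exists (u 0%N); exists 0%N|move=> _ [n _ <-]].
have [X hX] := lim L x0 (fun k => (F k).1) L0 (fun k => let: And4 h _ _ _ := SF k in h)
  (fun k => let: And4 _ h _ _ := SF k in h).
have [Y hY] := lim H y0 (fun k => (F k).2) H0 (fun k => let: And4 _ _ h _ := SF k in h)
  (fun k => let: And4 _ _ _ h := SF k in h).
have QXY : Q X Y.
  by have := hX 0%N; have := hY 0%N; rewrite /= /hf expr0 !mul1r; split.
have [d d0 hd] := rectint_small (hQ _ _ QXY) (divr_gt0 A0 (ltr0n R 2)).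
have [k hk] : exists k, hf k * (L + H) < d.
  have : (hf k * (L + H)) @[k --> \oo] --> 0.
    rewrite -[X in _ --> X](mul0r (L + H)); apply: cvgM; last exact: cvg_cst.
    by apply: cvg_expr; rewrite ger0_norm ?invr_ge0// invf_lt1// ltr1n.
  move=> /cvgrPdist_lt/(_ _ d0)[N _ hN]; exists N.
  have := hN N (leqnn N); rewrite sub0r normrN; apply: le_lt_trans.
  exact: ler_norm.
have := hd (F k).1 (F k).2 (hf k) (ltW (hf0 k)) hk _ (hX k) (hY k).
have [h1 h2 h3 h4 h5] := PF k.
have hl : 0 <= hf k * L := mulr_ge0 (ltW (hf0 k)) L0.
have hh : 0 <= hf k * H := mulr_ge0 (ltW (hf0 k)) H0.
have hQk : forall t t' : R, (F k).1 <= t <= (F k).1 + hf k * L ->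
    (F k).2 <= t' <= (F k).2 + hf k * H -> Q t t'.
  by move=> t t' ht ht'; split; lra.
move=> /(_ hQk)/(le_trans h5).
have s0 : 0 < hf k ^+ 2 by rewrite exprn_gt0.
by rewrite ler_pM2r// -subr_ge0 -[X in _ - X]mulr1 -mulrBr; nra.
Qed.

End Rectangle.
End Goursat.

(** * Circle means of holomorphic functions *)

Section Holomorphic.
Variable R : realType.
Implicit Types (z w c : cplx R) (f g h : cplx R -> cplx R) (r s t : R).

Lemma derivable_continuous f z : derivable f z 1 -> {for z, continuous f}.
Proof. by move=> /derivable1_diffP /differentiable_continuous. Qed.

Lemma derivable_compc f g z :
  derivable f z 1 -> derivable g (f z) 1 -> derivable (fun x => g (f x)) z 1.
Proof.
move=> /derivable1_diffP d1 /derivable1_diffP d2; apply/derivable1_diffP.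
exact: (differentiable_comp d1 d2).
Qed.

Lemma derivableMc f g z :
  derivable f z 1 -> derivable g z 1 -> derivable (fun x => f x * g x) z 1.
Proof. by move=> d1 d2; exact: (derivableM d1 d2). Qed.

Lemma derivableDc f g z :
  derivable f z 1 -> derivable g z 1 -> derivable (fun x => f x + g x) z 1.
Proof. by move=> d1 d2; exact: (derivableD d1 d2). Qed.

Lemma derivableBc f g z :
  derivable f z 1 -> derivable g z 1 -> derivable (fun x => f x - g x) z 1.
Proof. by move=> d1 d2; exact: (derivableB d1 d2). Qed.

Lemma derivableVc f z : f z != 0 -> derivable f z 1 -> derivable (fun x => (f x)^-1) z 1.
Proof. by move=> n0 d1; exact: (derivableV n0 d1). Qed.

Lemma derivableXc z n : derivable (fun x : cplx R => x ^+ n) z 1.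
Proof. exact: exprn_derivable. Qed.

Lemma derivable_cstc z c : derivable (fun=> c) z 1.
Proof. exact: derivable_cst. Qed.

Lemma derivable_idc z : derivable (fun x : cplx R => x) z 1.
Proof. exact: derivable_id. Qed.

Lemma derivable_linearize f z : derivable f z 1 -> exists D : cplx R,
  forall e : R, 0 < e -> exists2 d : R, 0 < d & forall w, cabs (w - z) < d ->
    cabs (f w - f z - D * (w - z)) <= e * cabs (w - z).
Proof.
move=> /cvg_ex[D hD]; exists D => e e0.
have /cvg_cabsP/(_ _ e0) := hD.
move=> /nbhs_ballP[d0 /= d00 hd].
have d0E : d0 = rc (complex.Re d0).
  by move: d00; rewrite ltcE /= => /andP[/eqP + _]; case: (d0) => a b /= ->.
have dp : 0 < complex.Re d0 by move: d00; rewrite ltcE /= => /andP[].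
exists (complex.Re d0) => // w wz.
have [->|nwz] := eqVneq w z.
  by rewrite !subrr mulr0 subrr (_ : cabs 0 = 0) ?mulr0// /cabs Normc.normc0.
have nz : w - z != 0 by rewrite subr_eq0.
have := hd (w - z); rewrite /ball /= sub0r normrN normC_cabs d0E /rc ltcR => /(_ wz nz).
rewrite [(w - z) *: 1 + z](_ : _ = w); last by rewrite /GRing.scale /= mulr1 subrK.
rewrite /GRing.scale /= => lt_e.
have -> : f w - f z - D * (w - z) = - ((D - (w - z)^-1 * (f w - f z)) * (w - z)).
  by rewrite mulrBl mulrAC mulVf// mul1r opprB.
by rewrite cabsN cabsM ler_wpM2r ?cabs_ge0// ltW.
Qed.

Lemma cabs_rc (x : R) : cabs (rc x) = `|x|.
Proof. by rewrite /cabs /= expr0n addr0 sqrtr_sqr. Qed.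

Lemma cabs_ci : cabs (ci R) = 1.
Proof. by rewrite /cabs /= expr0n expr1n add0r sqrtr1. Qed.

Lemma cabs_cpt (x y : R) : cabs (cpt x y) <= `|x| + `|y|.
Proof. exact: cabs_le_ReIm. Qed.

Lemma cdiff_in_comp G Q x0 y0 h : cdiff_in G Q x0 y0 -> derivable h (G x0 y0) 1 ->
  cdiff_in (fun x y => h (G x y)) Q x0 y0.
Proof.
move=> [D hD] /derivable_linearize[E hE]; exists (E * D) => e e0.
pose M := cabs D + 1; have M0 : 0 < M by rewrite ltr_wpDl ?cabs_ge0.
pose N := cabs E + 1; have N0 : 0 < N by rewrite ltr_wpDl ?cabs_ge0.
have [d1 d10 hd1] := hE _ (divr_gt0 (divr_gt0 e0 (ltr0n R 2)) M0).
have [d2 d20 hd2] := hD _ ltr01.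
have [d3 d30 hd3] := hD _ (divr_gt0 (divr_gt0 e0 (ltr0n R 2)) N0).
(* The last term keeps the increment of [G], at most [M] times the sum of the two coordinate
   increments, below [d1]. *)
pose d := Num.min (Num.min d2 d3) (d1 / (2 * M)).
exists d; first by rewrite !lt_min d20 d30 divr_gt0// mulr_gt0.
move=> x y Qxy; rewrite !lt_min => /andP[/andP[x2 x3] x1] /andP[/andP[y2 y3] y1].
set dd := `|x - x0| + `|y - y0|.
have dd0 : 0 <= dd by rewrite addr_ge0.
have b1 : cabs (G x y - G x0 y0) <= M * dd.
  rewrite -[X in cabs X](subrK (D * cpt (x - x0) (y - y0))).
  apply: (le_trans (cabsD _ _)); rewrite /M mulrDl addrC cabsM.
  apply: lerD; first by rewrite ler_wpM2l ?cabs_ge0// cabs_cpt.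
  exact: hd2.
have b2 : cabs (G x y - G x0 y0) < d1.
  apply: (le_lt_trans b1).
  rewrite mulrC -ltr_pdivlMr// (splitr (d1 / M)) /dd.
  by rewrite -mulrA -invfM (mulrC M) ltrD.
have := hd1 _ b2 => b3.
have -> : h (G x y) - h (G x0 y0) - E * D * cpt (x - x0) (y - y0) =
  (h (G x y) - h (G x0 y0) - E * (G x y - G x0 y0)) +
  E * (G x y - G x0 y0 - D * cpt (x - x0) (y - y0)) by ring.
apply: (le_trans (cabsD _ _)); rewrite (splitr e) mulrDl; apply: lerD.
  apply: (le_trans b3).
  apply: (@le_trans _ _ (e / 2 / M * (M * dd))).
    by rewrite ler_wpM2l// ltW// !divr_gt0.
  by rewrite mulrA divfK ?gt_eqF.
rewrite cabsM.
apply: (@le_trans _ _ (N * (e / 2 / N * dd))).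
  apply: ler_pM; rewrite ?cabs_ge0 ?lerDl//.
  exact: hd3.
by rewrite mulrA mulrCA divff ?mulr1// gt_eqF.
Qed.

Lemma real_linearize (u : R -> R) (x du : R) : is_derive x 1 u du ->
  forall e : R, 0 < e -> exists2 d : R, 0 < d & forall k, `|k| < d ->
    `|u (k + x) - u x - du * k| <= e * `|k|.
Proof.
move=> [dx ex] e e0.
have : h^-1 *: (u (h *: 1 + x) - u x) @[h --> 0^'] --> du by rewrite -ex; exact: dx.
move=> /cvgrPdist_lt/(_ _ e0)/nbhs_ballP[d /= d0 hd]; exists d => // k kd.
have [->|k0] := eqVneq k 0.
  by rewrite add0r subrr mulr0 subr0 normr0 mulr0.
have := hd k; rewrite /ball /= sub0r normrN => /(_ kd k0).
rewrite [k *: 1 + x](_ : _ = k + x); last by rewrite /GRing.scale /= mulr1.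
rewrite /GRing.scale /= => lt_e.
have -> : u (k + x) - u x - du * k = - ((du - k^-1 * (u (k + x) - u x)) * k).
  by rewrite mulrBl mulrAC mulVf// mul1r opprB.
by rewrite normrN normrM ler_wpM2r// ltW.
Qed.

Definition cexp (x y : R) : cplx R := rc (expR x) * expi y.

Lemma cexpD x y x' y' : cexp (x + x') (y + y') = cexp x y * cexp x' y'.
Proof. by rewrite /cexp expRD expiD rcM; ring. Qed.

Lemma cabs_cexp x y : cabs (cexp x y) = expR x.
Proof. by rewrite cabsM cabs_expi mulr1 cabs_rc ger0_norm// expR_ge0. Qed.

Lemma cexp_linearize e : 0 < e -> exists2 d : R, 0 < d & forall h k : R, `|h| < d ->
  `|k| < d -> cabs (cexp h k - 1 - cpt h k) <= e * (`|h| + `|k|).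
Proof.
(* The errors add up to [e' * |h| + 8 * e' * |k|], whence [e / 8]. The bound [1] gives
   [expR h <= 3]. *)
move=> e0; pose e' := Num.min (e / 8) 1.
have e'0 : 0 < e' by rewrite lt_min ltr01 divr_gt0.
have e'e : e' <= e / 8 by rewrite ge_min lexx.
have e'1 : e' <= 1 by rewrite ge_min lexx orbT.
clearbody e'.
have [d1 d10 h1] := real_linearize (is_derive_expR 0) e'0.
have [d2 d20 h2] := real_linearize (is_derive_cos 0) e'0.
have [d3 d30 h3] := real_linearize (is_derive_sin 0) e'0.
exists (Num.min (Num.min d1 d2) (Num.min d3 e')); first by rewrite !lt_min d10 d20 d30 e'0.
move=> h k; rewrite !lt_min => /andP[/andP[hd1 _] /andP[_ he]] /andP[/andP[_ kd2] /andP[kd3 _]].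
have := h1 _ hd1; rewrite addr0 expR0 mul1r => b1.
have := h2 _ kd2; rewrite addr0 cos0 sin0 oppr0 mul0r subr0 => b2.
have := h3 _ kd3; rewrite addr0 cos0 sin0 mul1r subr0 => b3.
have -> : cexp h k - 1 - cpt h k = rc (expR h) * cpt (cos k - 1) (sin k - k) +
   (rc (expR h - 1 - h) + ci R * rc ((expR h - 1) * k)).
  have ek : expi k = rc (cos k) + ci R * rc (sin k) by rewrite -cptE.
  have r1 : rc 1 = 1 :> cplx R by [].
  rewrite /cexp ek !cptE; rewrite !rcM !rcD !rcN r1; ring.
have b4 : `|expR h - 1| <= 2 * e'.
  have -> : expR h - 1 = (expR h - 1 - h) + h by ring.
  apply: (le_trans (ler_normD _ _)); rewrite mulr_natl mulr2n; apply: lerD; last exact: ltW.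
  apply: (le_trans b1); rewrite ler_piMr ?(ltW e'0)//.
  by rewrite (le_trans (ltW he)).
have b5 : `|expR h| <= 3.
  have -> : expR h = (expR h - 1) + 1 by ring.
  apply: (le_trans (ler_normD _ _)); rewrite normr1; lra.
apply: (le_trans (cabsD _ _)).
have b6 : cabs (rc (expR h) * cpt (cos k - 1) (sin k - k)) <= 3 * (e' * `|k| + e' * `|k|).
  rewrite cabsM cabs_rc; apply: ler_pM; rewrite ?cabs_ge0//.
  by apply: (le_trans (cabs_cpt _ _)); apply: lerD.
have b7 : cabs (rc (expR h - 1 - h) + ci R * rc ((expR h - 1) * k)) <=
    e' * `|h| + 2 * e' * `|k|.
  apply: (le_trans (cabsD _ _)); rewrite cabs_rc cabsM cabs_ci mul1r cabs_rc normrM.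
  by apply: lerD => //; rewrite ler_wpM2r.
apply: (le_trans (lerD b6 b7)).
have hk : e' * `|h| <= e / 8 * `|h| by rewrite ler_wpM2r.
have kk : e' * `|k| <= e / 8 * `|k| by rewrite ler_wpM2r.
have e1 : 0 <= e * `|h| by rewrite mulr_ge0// ltW.
lra.
Qed.

Lemma cdiff_in_cexp Q x0 y0 : cdiff_in cexp Q x0 y0.
Proof.
exists (cexp x0 y0) => e e0.
have M0 : 0 < expR x0 by exact: expR_gt0.
have [d d0 hd] := cexp_linearize (divr_gt0 e0 M0).
exists d => // x y _ xd yd.
have -> : cexp x y - cexp x0 y0 - cexp x0 y0 * cpt (x - x0) (y - y0) =
   cexp x0 y0 * (cexp (x - x0) (y - y0) - 1 - cpt (x - x0) (y - y0)).
  rewrite !mulrBr -cexpD mulr1; congr (cexp _ _ - _ - _); ring.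
rewrite cabsM cabs_cexp; apply: (@le_trans _ _ (expR x0 * (e / expR x0 * (`|x - x0| + `|y - y0|)))).
  by rewrite ler_pM2l//; exact: hd.
by rewrite mulrA mulrCA divff ?mulr1// gt_eqF.
Qed.

Lemma continuous_cexp_l y : continuous (fun x => cexp x y).
Proof.
apply: continuousMc; last by move=> x; exact: cvg_cst.
have -> : (fun x : R => rc (expR x)) = (fun x => expR x +i* (fun=> 0) x) by [].
by apply: continuous_mk; [exact: continuous_expR|move=> x; exact: cvg_cst].
Qed.

Lemma continuous_cexp_r x : continuous (cexp x).
Proof. by apply: continuousMc; [move=> y; exact: cvg_cst|exact: continuous_expi]. Qed.

Lemma cmean_cintg (f : R -> cplx R) : cmean f = rc (2 * pi)^-1 * cintg 0 (2 * pi) f.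
Proof.
apply/eqP; rewrite eq_complex /=; apply/andP; split; apply/eqP.
  by rewrite mul0r subr0.
by rewrite mul0r addr0.
Qed.

(* Goursat's lemma for [w |-> h (exp w)] on a rectangle of height [2 pi]: the
   horizontal sides cancel by periodicity. *)
Lemma cmean_radius h r1 r2 : (forall z, 0 < cabs z < 1 -> derivable h z 1) ->
  0 < r1 -> r1 <= r2 -> r2 < 1 ->
  cmean (fun t => h (rc r1 * expi t)) = cmean (fun t => h (rc r2 * expi t)).
Proof.
move=> dh r10 r12 r21; have r20 : 0 < r2 by exact: lt_le_trans r12.
pose b := ln r2; pose a := ln r1.
have eb : expR b = r2 by rewrite lnK// posrE.
have ea : expR a = r1 by rewrite lnK// posrE.
have ab : a <= b by rewrite ler_ln// posrE.
(* Truncating at [b] keeps the argument of [h] in the punctured disk for all real [x], so that [G]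
   is continuous everywhere; on the rectangle the truncation is inactive. *)
pose G x y := h (cexp (Num.min x b) y).
have ok x y : 0 < cabs (cexp (Num.min x b) y) < 1.
  rewrite cabs_cexp expR_gt0 /= (le_lt_trans _ r21)// -eb ler_expR.
  by rewrite ge_min lexx orbT.
have cG1 y : continuous (fun x => G x y).
  move=> x; apply: (@continuous_comp _ _ _ (fun x => cexp (Num.min x b) y) h).
    apply: (@continuous_comp _ _ _ (fun x => Num.min x b) (fun x => cexp x y)).
      apply: continuous_min; [exact: cvg_id|exact: cvg_cst].
    exact: continuous_cexp_l.
  exact/derivable_continuous/dh.
have cG2 x : continuous (G x).
  move=> y; apply: (@continuous_comp _ _ _ (cexp (Num.min x b)) h).
    exact: continuous_cexp_r.
  exact/derivable_continuous/dh.
have eab : a + (b - a) = b by rewrite addrC subrK.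
have L0 : 0 <= b - a by rewrite subr_ge0.
have P0 : 0 <= 2 * pi :> R := ltW (twopi_gt0 R).
have := goursat L0 P0 cG1 cG2 (x0 := a) (y0 := 0).
have hd : forall x y, a <= x <= a + (b - a) /\ 0 <= y <= 0 + 2 * pi ->
   cdiff_in G (fun x y => a <= x <= a + (b - a) /\ 0 <= y <= 0 + 2 * pi) x y.
  move=> x y [hx hy].
  have := cdiff_in_comp (@cdiff_in_cexp (fun x y => a <= x <= a + (b - a) /\ 0 <= y <= 0 + 2 * pi) x y).
  move: (hx); rewrite eab => /andP[_ xb].
  have := ok x y; rewrite min_l// => ok' /(_ _ (dh _ ok')).
  case=> D hD; exists D => e e0; have [d d0 hdd] := hD e e0.
  exists d => // x' y' Q' xd yd.
  case: (Q') => /andP[_ xb'] _.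
  by rewrite /G !min_l//; exact: hdd.
move=> /(_ hd); rewrite /rectint !mul1r add0r.
have -> : cintg a (a + (b - a)) (fun t => G t 0 - G t (2 * pi)) = 0.
  rewrite (@eq_cintg _ _ _ _ (fun=> 0)).
    by rewrite cintg_cst ?mul0r// eab.
  by move=> t _; rewrite /G /cexp -(expi_period 0) add0r subrr.
rewrite add0r => /eqP; rewrite mulf_eq0 => /orP[/eqP ci0|/eqP].
  by have := cabs_ci; rewrite ci0 /cabs Normc.normc0 => /esym/eqP; rewrite oner_eq0.
rewrite eab => h0.
rewrite !cmean_cintg; congr (_ * _).
have -> : cintg 0 (2 * pi) (fun t => h (rc r1 * expi t)) = cintg 0 (2 * pi) (G a).
  by apply: eq_cintg => t _; rewrite /G min_l// /cexp ea.
have -> : cintg 0 (2 * pi) (fun t => h (rc r2 * expi t)) = cintg 0 (2 * pi) (G b).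
  by apply: eq_cintg => t _; rewrite /G min_l// /cexp eb.
have cB : continuous (fun t => G b t - G a t) by move=> t; apply: cvgB; [exact: cG2|exact: cG2].
rewrite -[LHS]addr0 -h0 -(cintgD _ _ (cG2 a) cB).
by apply: eq_cintg => t _; rewrite addrC subrK.
Qed.

End Holomorphic.
Arguments derivableXc {R} z n.
Arguments derivable_cstc {R} z c.
Arguments derivable_idc {R} z.

(** * Fourier and Taylor coefficients *)

Section Fourier.
Variable R : realType.
Implicit Types (z w c : cplx R) (f h : cplx R -> cplx R) (g : R -> cplx R) (r s t : R).

Definition circ f r : R -> cplx R := fun t => f (rc r * expi t).

Lemma cabs0 : cabs (0 : cplx R) = 0.
Proof. by rewrite /cabs Normc.normc0. Qed.

Lemma cabs_eq0 z : cabs z = 0 -> z = 0.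
Proof. exact: Normc.eq0_normc. Qed.

Lemma cabs1 : cabs (1 : cplx R) = 1.
Proof. by rewrite -[RHS](cabs_expi 0) expi0. Qed.

Lemma cabsX z n : cabs (z ^+ n) = cabs z ^+ n.
Proof. by elim: n => [|n IH]; rewrite ?cabs1// !exprS cabsM IH. Qed.

Lemma cabs_conj z : cabs (conjz z) = cabs z.
Proof. by case: z => a b; rewrite /cabs /= sqrrN. Qed.

Lemma mul_conjz z : z * conjz z = rc (cabs z ^+ 2).
Proof.
by rewrite cabs2; case: z => a b; apply/eqP; rewrite eq_complex /=;
  apply/andP; split; apply/eqP; ring.
Qed.

Lemma cabs_circ r t : 0 <= r -> cabs (rc r * expi t) = r.
Proof. by move=> r0; rewrite cabsM cabs_expi mulr1 cabs_rc ger0_norm. Qed.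

Lemma continuousZc (T : topologicalType) c (F : T -> cplx R) : continuous F ->
  continuous (fun y => c * F y).
Proof. by move=> cF y; apply: cvgM; [exact: cvg_cst|exact: cF]. Qed.

Arguments continuousZc {T} c {F}.

Lemma continuous_circ_pt r : continuous (fun t => rc r * expi t).
Proof. exact: (continuousZc (rc r) (@continuous_expi R)). Qed.

Lemma continuous_circ_gen f r : (forall t, derivable f (rc r * expi t) 1) ->
  continuous (circ f r).
Proof.
move=> df t; apply: (@continuous_comp _ _ _ (fun t => rc r * expi t) f).
  exact: continuous_circ_pt.
exact: derivable_continuous.
Qed.

Lemma continuous_circ f r : analytic_on_disk f -> 0 <= r < 1 -> continuous (circ f r).
Proof.
move=> af /andP[r0 r1]; apply: continuous_circ_gen => t.
by apply: af; rewrite /unit_disk /mkset cabs_circ.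
Qed.

Lemma circ_period f r t : circ f r (t + 2 * pi) = circ f r t.
Proof. by rewrite /circ expi_period. Qed.

Lemma cabs_cmean_le g K : continuous g -> (forall t, cabs (g t) <= K) ->
  cabs (cmean g) <= 2 * K.
Proof.
move=> cg gK; rewrite cmean_cintg cabsM cabs_rc.
have tp := twopi_gt0 R.
rewrite ger0_norm ?invr_ge0 ?(ltW tp)// ler_pdivrMl//.
have h := cabs_cintg_le cg (ltW tp) (fun t _ => gK t).
by rewrite [leRHS]mulrC -[X in _ <= _ * X]subr0.
Qed.

Lemma continuous_expiX n : continuous (fun t : R => expi t ^+ n).
Proof. by apply: continuousXc; exact: continuous_expi. Qed.

Lemma continuous_cexpiX n : continuous (fun t : R => conjz (expi t) ^+ n).
Proof. by apply: continuousXc; apply: continuous_conj; exact: continuous_expi. Qed.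

Lemma conjzX z n : conjz (z ^+ n) = conjz z ^+ n.
Proof. exact: (rmorphXn (@conjc R)). Qed.

Lemma conjz0 : conjz (0 : cplx R) = 0.
Proof. by rewrite /conjz /= oppr0. Qed.

Lemma cmean_cexpiX n : (0 < n)%N -> cmean (fun t : R => conjz (expi t) ^+ n) = 0.
Proof.
move=> n0; rewrite -conjz0 -(cmean_expiX R n0) -(cmean_conj (@continuous_expiX n)).
by apply: cmean_eq => t; rewrite conjzX.
Qed.

Lemma cmean_ortho n m :
  cmean (fun t : R => expi t ^+ n * conjz (expi t) ^+ m) = (n == m)%:R.
Proof.
have [nm|mn|->] := ltngtP n m.
- rewrite -(subnKC (ltnW nm)) -[RHS](@cmean_cexpiX (m - n)) ?subn_gt0//.
  by apply: cmean_eq => t; rewrite exprD mulrA -exprMn expi_mulJ expr1n mul1r.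
- rewrite -(subnK (ltnW mn)) -[RHS](@cmean_expiX R (n - m)) ?subn_gt0//.
  by apply: cmean_eq => t; rewrite exprD -mulrA -exprMn expi_mulJ expr1n mulr1.
- rewrite -[RHS](@cmean_cst R 1); apply: cmean_eq => t.
  by rewrite -exprMn expi_mulJ expr1n.
Qed.

Lemma rc_rmean (u : R -> R) : rc (rmean u) = cmean (fun t => rc (u t)).
Proof. by rewrite /cmean /= rmean_cst. Qed.

Definition trigpoly (a : nat -> cplx R) N t : cplx R := \sum_(n < N) a n * expi t ^+ n.

Lemma continuous_trigpoly a N : continuous (trigpoly a N).
Proof.
apply: (@continuous_bigsum _ _ N (fun n (t : R) => a n * expi t ^+ n)) => n.
exact: (continuousZc (a n) (@continuous_expiX n)).
Qed.

Lemma cmean_trigpolyM a N g : continuous g ->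
  cmean (fun t => trigpoly a N t * g t) =
  \sum_(n < N) a n * cmean (fun t => expi t ^+ n * g t).
Proof.
move=> cg.
have cn n : continuous (fun t => expi t ^+ n * g t).
  exact: (continuousMc (@continuous_expiX n) cg).
have cn' n : continuous (fun t => a n * (expi t ^+ n * g t)).
  exact: (continuousZc (a n) (cn n)).
under [RHS]eq_bigr do rewrite -(cmeanZ _ (cn _)).
rewrite -(cmean_sum N cn'); apply: cmean_eq => t.
by rewrite /trigpoly mulr_suml; apply: eq_bigr => i _; rewrite mulrA.
Qed.

Lemma rmean_sqr_trigpoly a N :
  rmean (fun t => cabs (trigpoly a N t) ^+ 2) = \sum_(n < N) cabs (a n) ^+ 2.
Proof.
have cJ := continuous_conj (@continuous_trigpoly a N).
apply: (@complexI R).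
rewrite -[LHS]/(rc _) rc_rmean (cmean_eq (fun t => esym (mul_conjz _))).
rewrite (cmean_trigpolyM a N cJ) -[RHS]/(rc _).
have -> : rc (\sum_(n < N) cabs (a n) ^+ 2) = \sum_(n < N) rc (cabs (a n) ^+ 2) :> cplx R.
  exact: (rmorph_sum (real_complex R)).
apply: eq_bigr => n _; rewrite -mul_conjz; congr (_ * _).
have cX := @continuous_cexpiX n.
transitivity (conjz (cmean (fun t => trigpoly a N t * conjz (expi t) ^+ n))).
  rewrite -cmean_conj; last exact: (continuousMc (@continuous_trigpoly a N) cX).
  by apply: cmean_eq => t; rewrite conjzM -conjzX conjzK mulrC.
rewrite (cmean_trigpolyM a N cX); congr conjz.
under eq_bigr do rewrite cmean_ortho.
rewrite (bigD1 n)//= eqxx mulr1 big1 ?addr0// => i ni.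
by rewrite (negbTE (_ : nat_of_ord i != n)) ?mulr0.
Qed.

Definition fcoef g n : cplx R := cmean (fun t => g t * conjz (expi t) ^+ n).

(** With [S] the trigonometric polynomial built from the first [N] coefficients, the mean of
    [|g - S|^2] is the right side minus the left. *)
Lemma bessel g N : continuous g ->
  \sum_(n < N) cabs (fcoef g n) ^+ 2 <= rmean (fun t => cabs (g t) ^+ 2).
Proof.
move=> cg; set a := fcoef g; set S := trigpoly a N.
have cS : continuous S by exact: continuous_trigpoly.
have cJg := continuous_conj cg; have cJS := continuous_conj cS.
pose K := \sum_(n < N) cabs (a n) ^+ 2.
have hK : rc K = \sum_(n < N) a n * conjz (a n).
  rewrite /K; have -> : rc (\sum_(n < N) cabs (a n) ^+ 2) = \sum_(n < N) rc (cabs (a n) ^+ 2) :> cplx R.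
    exact: (rmorph_sum (real_complex R)).
  by apply: eq_bigr => n _; rewrite mul_conjz.
have SJg : cmean (fun t => S t * conjz (g t)) = rc K.
  rewrite (cmean_trigpolyM a N cJg) hK; apply: eq_bigr => n _; congr (_ * _).
  rewrite /a /fcoef -cmean_conj; last first.
    exact: (continuousMc cg (@continuous_cexpiX n)).
  by apply: cmean_eq => t; rewrite conjzM -conjzX conjzK mulrC.
have gJS : cmean (fun t => g t * conjz (S t)) = rc K.
  transitivity (conjz (rc K)); last by rewrite /conjz /= oppr0.
  rewrite -SJg -cmean_conj; last exact: (continuousMc cS cJg).
  by apply: cmean_eq => t; rewrite conjzM conjzK mulrC.
have SJS : cmean (fun t => S t * conjz (S t)) = rc K.
  rewrite (cmean_eq (fun t => mul_conjz _)) -rc_rmean; congr rc.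
  exact: rmean_sqr_trigpoly.
have c2 : continuous (fun t => cabs (g t - S t) ^+ 2).
  by apply: continuous_cabs2 => t; apply: cvgB; [exact: cg|exact: cS].
have : 0 <= rmean (fun t => cabs (g t - S t) ^+ 2).
  by apply: rmean_ge0 => t; rewrite sqr_ge0.
suff -> : rmean (fun t => cabs (g t - S t) ^+ 2) = rmean (fun t => cabs (g t) ^+ 2) - K.
  by rewrite subr_ge0.
apply: (@complexI R); rewrite -[LHS]/(rc _) -[RHS]/(rc _) rcD rcN !rc_rmean.
rewrite (cmean_eq (fun t => esym (mul_conjz _))).
rewrite [in RHS](cmean_eq (fun t => esym (mul_conjz _))).
have cgg : continuous (fun t => g t * conjz (g t)) := continuousMc cg cJg.
have cgS : continuous (fun t => g t * conjz (S t)) := continuousMc cg cJS.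
have cSg : continuous (fun t => S t * conjz (g t)) := continuousMc cS cJg.
have cSS : continuous (fun t => S t * conjz (S t)) := continuousMc cS cJS.
transitivity (cmean (fun t => (g t * conjz (g t) + (-1) * (g t * conjz (S t))) +
    ((-1) * (S t * conjz (g t)) + S t * conjz (S t)))).
  apply: cmean_eq => t; have -> : conjz (g t - S t) = conjz (g t) - conjz (S t).
    by rewrite /conjz raddfB.
  ring.
have h1 := cmeanD cgg (continuousZc (-1) cgS); have h2 := cmeanD (continuousZc (-1) cSg) cSS.
rewrite (cmeanD (continuousDc cgg (continuousZc (-1) cgS)) (continuousDc (continuousZc (-1) cSg) cSS)) h1 h2.
rewrite (cmeanZ (-1) cgS) (cmeanZ (-1) cSg) gJS SJg SJS; ring.
Qed.

Lemma bessel_cvg0 g : continuous g -> cabs (fcoef g n) @[n --> \oo] --> 0.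
Proof.
move=> cg; have : cvgn (series (fun n => cabs (fcoef g n) ^+ 2)).
  apply: nondecreasing_is_cvgn.
    apply/nondecreasing_seqP => n; rewrite seriesSr lerDl sqr_ge0//.
  exists (rmean (fun t => cabs (g t) ^+ 2)) => _ [n _ <-].
  by rewrite /series /= big_mkord; exact: bessel.
move=> /cvg_series_cvg_0 h0.
apply/cvgrPdist_lt => e e0.
have e20 : 0 < e ^+ 2 by rewrite exprn_gt0.
have /cvgrPdist_lt/(_ _ e20) := h0; apply: filterS => n.
rewrite !sub0r !normrN ger0_norm ?sqr_ge0// ger0_norm ?cabs_ge0//.
by rewrite ltr_sqr// nnegrE ?cabs_ge0 ?ltW.
Qed.

End Fourier.
Arguments continuousZc {R T} c {F}.

Section Coefficients.
Variable R : realType.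
Implicit Types (z w c : cplx R) (f h : cplx R -> cplx R) (g : R -> cplx R) (r s t : R).

Lemma cmeanB (g1 g2 : R -> cplx R) : continuous g1 -> continuous g2 ->
  cmean (fun t => g1 t - g2 t) = cmean g1 - cmean g2.
Proof.
move=> c1 c2; rewrite -mulN1r -(cmeanZ (-1) c2) -(cmeanD c1 (continuousZc (-1) c2)).
by apply: cmean_eq => t; rewrite mulN1r.
Qed.

Lemma continuousBc (T : topologicalType) (F G : T -> cplx R) :
  continuous F -> continuous G -> continuous (fun y => F y - G y).
Proof. by move=> cF cG y; apply: cvgB; [exact: cF|exact: cG]. Qed.

Lemma near0_circ f (e : R) : analytic_on_disk f -> 0 < e ->
  exists2 d : R, 0 < d & forall r t, 0 < r < d -> cabs (circ f r t - f 0) <= e.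
Proof.
move=> af e0.
have u0 : unit_disk (0 : cplx R) by rewrite /unit_disk /mkset cabs0 ltr01.
have [D hD] := derivable_linearize (af _ u0).
have [d d0 hd] := hD 1 ltr01.
pose M := cabs D + 1; have M0 : 0 < M by rewrite ltr_wpDl ?cabs_ge0.
exists (Num.min d (e / M)); first by rewrite lt_min d0 divr_gt0.
move=> r t /andP[r0]; rewrite lt_min => /andP[rd re].
have zr : cabs (rc r * expi t) = r by rewrite cabs_circ// ltW.
have := hd (rc r * expi t); rewrite subr0 zr => /(_ rd) h.
rewrite /circ -[X in cabs X](subrK (D * (rc r * expi t))).
apply: (le_trans (cabsD _ _)); rewrite cabsM zr.
apply: (le_trans (lerD h (lexx _))); rewrite -mulrDl addrC -/M.
by rewrite mulrC -ler_pdivlMr// ltW.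
Qed.

Lemma le0_eps (x K : R) : 0 <= x -> 0 < K -> (forall e : R, 0 < e -> x <= K * e) -> x = 0.
Proof.
move=> x0 K0 h; apply/eqP; rewrite eq_le x0 andbT; apply/ler_addgt0Pl => e e0.
by rewrite addr0 (le_trans (h (e / K) _)) ?divr_gt0// mulrC divfK// gt_eqF.
Qed.

(** The mean does not depend on the radius, and on small circles [f] is close to [f 0]. *)
Lemma mean_value f r : analytic_on_disk f -> 0 <= r < 1 -> cmean (circ f r) = f 0.
Proof.
move=> af /andP[]; rewrite le_eqVlt => /predU1P[<- _|r0 r1].
  rewrite -[RHS](@cmean_cst R); apply: cmean_eq => t.
  by rewrite /circ (_ : rc 0 = 0)// mul0r.
apply/eqP; rewrite -subr_eq0; apply/eqP/cabs_eq0.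
apply: (@le0_eps _ 2) => // [|e e0]; first exact: cabs_ge0.
have [d d0 hd] := near0_circ af e0.
pose s := Num.min r (d / 2).
have s0 : 0 < s by rewrite lt_min r0 divr_gt0.
have sr : s <= r by rewrite ge_min lexx.
have sd : s < d by rewrite gt_min (ltr_pdivrMr _ _ (ltr0n R 2)) ltr_pMr// ltr1n orbT.
have s1 : 0 <= s < 1 by rewrite ltW//= (le_lt_trans sr).
have -> : cmean (circ f r) = cmean (circ f s).
  rewrite /circ -(cmean_radius _ s0 sr r1)// => z /andP[_ z1]; exact: af.
rewrite -(@cmean_cst R (f 0)).
have cc : continuous (fun _ : R => f 0) by move=> t; exact: cvg_cst.
rewrite -(cmeanB (continuous_circ af s1) cc); apply: cabs_cmean_le.
  by move=> t; apply: cvgB; [exact: continuous_circ|exact: cc].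
by move=> t; apply: hd; rewrite s0.
Qed.

Lemma analytic_mulX f n : analytic_on_disk f -> analytic_on_disk (fun z => f z * z ^+ n).
Proof. by move=> af z z1; exact: (derivableMc (af _ z1) (derivableXc z n)). Qed.

(** This is the mean value property of [f z * z ^+ n], which vanishes at [0]: on a circle, [f] has
    no negative frequencies. *)
Lemma cmean_posfreq f r n : analytic_on_disk f -> 0 <= r < 1 -> (0 < n)%N ->
  cmean (fun t => circ f r t * expi t ^+ n) = 0.
Proof.
move=> af /andP[]; rewrite le_eqVlt => /predU1P[<- _|r0 r1] n0.
  transitivity (f 0 * cmean (fun t : R => expi t ^+ n)); last by rewrite cmean_expiX// mulr0.
  rewrite -(cmeanZ _ (@continuous_expiX R n)).
  by apply: cmean_eq => t; rewrite /circ (_ : rc 0 = 0)// mul0r.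
have r01 : 0 <= r < 1 by rewrite ltW.
have E : cmean (circ (fun z => f z * z ^+ n) r) =
   rc r ^+ n * cmean (fun t => circ f r t * expi t ^+ n).
  rewrite -cmeanZ; last exact: (continuousMc (continuous_circ af r01) (@continuous_expiX R n)).
  by apply: cmean_eq => t; rewrite /circ exprMn mulrCA.
move: (etrans (esym E) (mean_value (@analytic_mulX f n af) r01)); rewrite expr0n (gtn_eqF n0) mulr0.
move=> /eqP; rewrite mulf_eq0 expf_eq0 n0 /= => /orP[/eqP r00|/eqP//].
by move: (cabs_rc r); rewrite r00 cabs0 ger0_norm ?ltW// => e; rewrite e ltxx in r0.
Qed.

(** Cauchy's integral for the Taylor coefficient at [0]. The radius [1 / 2] is arbitrary, by
    independence of the radius. *)
Definition coef f n : cplx R := cmean (circ (fun z => f z * z^-1 ^+ n) 2^-1).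

Lemma rcX (x : R) n : rc (x ^+ n) = rc x ^+ n.
Proof. exact: (rmorphXn (real_complex R)). Qed.

Lemma rc_eq0 (x : R) : x != 0 -> rc x != 0.
Proof. by move=> x0; apply/eqP => -[] /eqP; rewrite (negbTE x0). Qed.

Lemma expiV t : (expi t)^-1 = conjz (expi t).
Proof.
have n0 : expi t != 0.
  by apply/eqP => e; have := cabs_expi t; rewrite e cabs0 => /esym/eqP; rewrite oner_eq0.
by apply: (mulfI n0); rewrite mulfV// expi_mulJ.
Qed.

Lemma coef0E f : analytic_on_disk f -> coef f 0 = f 0.
Proof.
move=> af; rewrite -(mean_value af (_ : 0 <= 2^-1 < 1)); last lra.
by apply: cmean_eq => t; rewrite /circ expr0 mulr1.
Qed.

Lemma cmean_coef f r n : analytic_on_disk f -> 0 <= r < 1 ->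
  fcoef (circ f r) n = coef f n * rc r ^+ n.
Proof.
move=> af r01; case/andP: (r01); rewrite le_eqVlt => /predU1P[r0 _|r0 r1].
  have [->|n0] := posnP n.
    rewrite expr0 mulr1 coef0E// -(mean_value af r01).
    by apply: cmean_eq => t; rewrite expr0 mulr1.
  rewrite -r0 (_ : rc 0 = 0)// expr0n gtn_eqF// mulr0.
  transitivity (f 0 * cmean (fun t : R => conjz (expi t) ^+ n)); last by rewrite cmean_cexpiX// mulr0.
  rewrite -(cmeanZ _ (@continuous_cexpiX R n)).
  by apply: cmean_eq => t; rewrite /circ (_ : rc 0 = 0)// mul0r.
have rn0 : rc r != 0 by apply: rc_eq0; rewrite gt_eqF.
have dH z : 0 < cabs z < 1 -> derivable (fun z => f z * z^-1 ^+ n) z 1.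
  move=> /andP[z0 z1]; apply: derivableMc; first exact: af.
  have zn0 : z != 0 by apply: contraTneq z0 => ->; rewrite cabs0 ltxx.
  have := derivable_compc (derivableVc zn0 (derivable_idc z)) (derivableXc z^-1 n).
  exact.
have -> : coef f n = cmean (circ (fun z => f z * z^-1 ^+ n) r).
  have [hr|hr] := leP r 2^-1.
    have h21 : 2^-1 < 1 :> R by lra.
    exact: (esym (cmean_radius dH r0 hr h21)).
  have h20 : 0 < 2^-1 :> R by lra.
  exact: (cmean_radius dH h20 (ltW hr) r1).
rewrite mulrC -cmeanZ; last first.
  apply: continuous_circ_gen => t; apply: dH; rewrite cabs_circ ?ltW//; exact/andP.
apply: cmean_eq => t; rewrite /circ invfM expiV exprMn mulrCA; congr (_ * _).
by rewrite mulrA -exprMn mulfV// expr1n mul1r.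
Qed.

Lemma bessel_coef f r N : analytic_on_disk f -> 0 <= r < 1 ->
  \sum_(n < N) cabs (coef f n) ^+ 2 * r ^+ (2 * n) <=
  rmean (fun t => cabs (circ f r t) ^+ 2).
Proof.
move=> af r01; apply: le_trans (bessel N (continuous_circ af r01)).
apply: ler_sum => n _; rewrite cmean_coef// cabsM cabsX cabs_rc exprMn.
have r0 : 0 <= r by case/andP: r01.
by rewrite (ger0_norm r0) -exprM mulnC.
Qed.

Lemma polar z : exists t, z = rc (cabs z) * expi t.
Proof.
have [->|z0] := eqVneq z 0; first by exists 0; rewrite cabs0 (_ : rc 0 = 0)// mul0r.
have r0 : cabs z != 0 by apply: contra_neq z0; exact: cabs_eq0.
have [x [y [zE xy1]]] : exists x y : R, z = rc (cabs z) * cpt x y /\ x ^+ 2 + y ^+ 2 = 1.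
  exists (complex.Re z / cabs z), (complex.Im z / cabs z); split.
    move: r0; move: (cabs z) => m m0; case: z {z0} => a b.
    by apply/eqP; rewrite eq_complex /= !mul0r subr0 addr0 !(mulrC m) !divfK// !eqxx.
  by rewrite !exprMn -mulrDl -cabs2 exprVn divff// expf_neq0.
have x1 : -1 <= x <= 1.
  rewrite -ler_norml -(@ler_pXn2r _ 2) ?nnegrE// expr1n real_normK ?num_real//.
  by rewrite -xy1 lerDl sqr_ge0.
have cx : cos (acos x) = x by apply: acosK; rewrite in_itv.
have sx : sin (acos x) = `|y|.
  by rewrite sin_acos// -xy1 addrAC subrr add0r sqrtr_sqr.
have [y0|y0] := leP 0 y.
  by exists (acos x); rewrite {1}zE /expi cx sx ger0_norm.
by exists (- acos x); rewrite {1}zE /expi cosN sinN cx sx ltr0_norm// opprK.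
Qed.

Lemma cvg_succ (u : nat -> R) (l : R) :
  u n @[n --> \oo] --> l -> u n.+1 @[n --> \oo] --> l.
Proof. by move=> ul; have := cvg_shiftS u (nbhs l) => ->. Qed.

Lemma cvg_pred (u : nat -> R) (l : R) :
  u n.+1 @[n --> \oo] --> l -> u n @[n --> \oo] --> l.
Proof. by have := cvg_shiftS u (nbhs l) => ->. Qed.

(* Chernoff's proof: for [q w = (f w - f z) / (w - z)], which is continuous,
   the partial sums telescope to [f z] up to Fourier coefficients of [q]. *)
Lemma taylor_cvg f z : analytic_on_disk f -> cabs z < 1 ->
  (\sum_(n < N) coef f n * z ^+ n) @[N --> \oo] --> f z.
Proof.
move=> af z1; have [t0 zE] := polar z; set r := cabs z in zE z1.
have r0 : 0 <= r by exact: cabs_ge0.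
have r01 : 0 <= r < 1 by rewrite r0.
have [D hD] := derivable_linearize (af z z1).
pose q w := if w == z then D else (f w - f z) / (w - z).
have fq w : f w = f z + (w - z) * q w.
  rewrite /q; case: eqVneq => [->|wz]; first by rewrite subrr mul0r addr0.
  by rewrite mulrC divfK ?subr_eq0// addrC subrK.
have cq w : cabs w < 1 -> {for w, continuous q}.
  move=> w1; have [->|wz] := eqVneq w z.
    apply/(@cvg_cabsP _ _ (nbhs z) (nbhs_filter z) q) => e e0.
    have [d d0 hd] := hD _ (divr_gt0 e0 (ltr0n R 2)).
    apply/nbhs_ballP; exists (rc d); first by rewrite /= /rc ltcR.
    move=> v; rewrite /ball /= normC_cabs /rc ltcR => vd.
    rewrite /q eqxx; case: eqVneq => [_|vz]; first by rewrite subrr cabs0.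
    have vz0 : v - z != 0 by rewrite subr_eq0.
    have := hd v; rewrite -cabsN opprB => /(_ vd).
    have -> : f v - f z - D * (v - z) = - ((D - (f v - f z) / (v - z)) * (v - z)).
      by rewrite mulrBl divfK// opprB.
    have vp : 0 < cabs (z - v).
      rewrite lt_neqAle cabs_ge0 andbT eq_sym; apply: contra vz => /eqP/cabs_eq0/eqP.
      by rewrite subr_eq0 eq_sym.
    rewrite cabsN cabsM -(cabsN (v - z)) opprB ler_pM2r// => /le_lt_trans; apply.
    by rewrite ltr_pdivrMr// ltr_pMr// ltr1n.
  have : derivable (fun w => (f w - f z) / (w - z)) w 1.
    apply: derivableMc; first exact: (derivableBc (af _ w1) (derivable_cstc _ _)).
    by apply: derivableVc; [rewrite subr_eq0|exact: (derivableBc (derivable_idc _) (derivable_cstc _ _))].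
  move=> /derivable_continuous hc.
  have : {near w, (fun w => (f w - f z) / (w - z)) =1 q}.
    have : \forall v \near w, v != z.
      apply/nbhs_ballP; exists (rc (cabs (w - z))).
        rewrite /= /rc ltcR lt_neqAle cabs_ge0 andbT eq_sym; apply: contra wz => /eqP/cabs_eq0/eqP.
        by rewrite subr_eq0.
      move=> v; rewrite /ball /= normC_cabs /rc ltcR; apply: contraTneq => ->.
      by rewrite ltxx.
    by apply: filterS => v vz; rewrite /q (negbTE vz).
  move=> hn; have qw : (f w - f z) / (w - z) = q w by rewrite /q (negbTE wz).
  have : q v @[v --> w] --> q w by rewrite -qw; exact: cvg_trans (near_eq_cvg hn) hc.
  exact.
have cQ : continuous (circ q r).
  move=> t; apply: (@continuous_comp _ _ _ (fun t => rc r * expi t) q).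
    exact: continuous_circ_pt.
  by apply: cq; rewrite cabs_circ.
(* [qh] and [qm] are the Fourier coefficients of [q] at frequencies [n] and [- n], on the circle
   through [z]. Comparing coefficients in [f w = f z + (w - z) * q w] gives the recurrences
   below. *)
pose qh n := fcoef (circ q r) n.
pose qm n := cmean (fun t => circ q r t * expi t ^+ n).
have qmE n : cabs (qm n) = cabs (fcoef (fun t => conjz (circ q r t)) n).
  rewrite -[RHS]cabs_conj /fcoef -cmean_conj; last first.
    exact: (continuousMc (continuous_conj cQ) (@continuous_cexpiX R n)).
  by congr cabs; apply: cmean_eq => t; rewrite conjzM conjzX !conjzK.
have cqX n : continuous (fun t => circ q r t * expi t ^+ n).
  exact: (continuousMc cQ (@continuous_expiX R n)).
have cqJ n : continuous (fun t => circ q r t * conjz (expi t) ^+ n).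
  exact: (continuousMc cQ (@continuous_cexpiX R n)).
have cB n := continuousZc (rc r) (cqX n).
have cC n := continuousZc z (cqX n).
have cfE t : circ f r t = f z + (rc r * (expi t * circ q r t) - z * circ q r t).
  by rewrite /circ fq; congr (_ + _); ring.
have recm n : (0 < n)%N -> rc r * qm n.+1 = z * qm n.
  move=> n0; have := cmean_posfreq af r01 n0.
  rewrite (cmean_eq (_ : forall t, _ = f z * expi t ^+ n +
     (rc r * (circ q r t * expi t ^+ n.+1) - z * (circ q r t * expi t ^+ n)))); last first.
    by move=> t; rewrite cfE exprS; ring.
  rewrite (cmeanD (continuousZc (f z) (@continuous_expiX R n)) (continuousBc (cB n.+1) (cC n))).
  rewrite (cmeanB (cB n.+1) (cC n)) (cmeanZ (rc r) (cqX n.+1)) (cmeanZ z (cqX n)).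
  rewrite (cmeanZ (f z) (@continuous_expiX R n)).
  by rewrite cmean_expiX// mulr0 add0r => /eqP; rewrite subr_eq0 => /eqP.
have rec0 : rc r * qm 1%N = z * qm 0%N + (coef f 0 - f z).
  rewrite coef0E// -(mean_value af r01).
  rewrite (cmean_eq (_ : forall t, _ = f z +
     (rc r * (circ q r t * expi t ^+ 1) - z * (circ q r t * expi t ^+ 0)))); last first.
    by move=> t; rewrite cfE; ring.
  have cz : continuous (fun _ : R => f z) by move=> t; exact: cvg_cst.
  rewrite (cmeanD cz (continuousBc (cB 1%N) (cC 0%N))) (cmeanB (cB 1%N) (cC 0%N)).
  rewrite (cmeanZ (rc r) (cqX 1%N)) (cmeanZ z (cqX 0%N)) cmean_cst /qm; ring.
have rec n : coef f n.+1 * rc r ^+ n.+1 = rc r * qh n - z * qh n.+1.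
  rewrite -cmean_coef// /fcoef.
  rewrite (cmean_eq (_ : forall t, _ = f z * conjz (expi t) ^+ n.+1 +
     (rc r * (circ q r t * conjz (expi t) ^+ n) - z * (circ q r t * conjz (expi t) ^+ n.+1)))); last first.
    move=> t; have k : conjz (expi t) ^+ n = expi t * conjz (expi t) ^+ n.+1.
      by rewrite exprS mulrA expi_mulJ mul1r.
    by rewrite cfE k; ring.
  have cX := @continuous_cexpiX R n.+1.
  have cB' := continuousZc (rc r) (cqJ n); have cC' := continuousZc z (cqJ n.+1).
  rewrite (cmeanD (continuousZc (f z) cX) (continuousBc cB' cC')) (cmeanB cB' cC').
  rewrite (cmeanZ (rc r) (cqJ n)) (cmeanZ z (cqJ n.+1)) (cmeanZ (f z) cX).
  by rewrite cmean_cexpiX// mulr0 add0r.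
have qhm0 : qm 0%N = qh 0%N by apply: cmean_eq => t; rewrite !expr0.
(* As [cabs z = r], the recurrence preserves this modulus, while Bessel's inequality sends it to
   [0]; so the negative frequencies do not contribute. *)
have cconst n : cabs (qm n.+1) * r = cabs (qm 1%N) * r.
  elim: n => [//|n IH]; rewrite -IH.
  have := congr1 (@cabs R) (recm n.+1 isT).
  by rewrite !cabsM cabs_rc (ger0_norm r0) -/r [LHS]mulrC [RHS]mulrC.
have qm1 : rc r * qm 1%N = 0.
  apply: cabs_eq0; rewrite cabsM cabs_rc ger0_norm// mulrC.
  have h0 : (cabs (qm n.+1) * r) @[n --> \oo] --> 0 * r.
    apply: cvgM; last exact: cvg_cst.
    have hb := bessel_cvg0 (continuous_conj cQ).
    rewrite (_ : (fun n => _) = (fun n => cabs (fcoef (fun t => conjz (circ q r t)) n.+1))).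
      exact: (cvg_succ hb).
    by apply/funext => n; exact: qmE.
  move: h0; under eq_fun do rewrite cconst.
  by move=> /(cvg_lim (@Rhausdorff R)); rewrite lim_cst ?mul0r//; exact: Rhausdorff.
have partial N : \sum_(n < N.+1) coef f n * z ^+ n = f z - z * (expi t0 ^+ N * qh N).
  elim: N => [|N IH].
    rewrite big_ord1 expr0 mulr1 mul1r -qhm0.
    move: rec0; rewrite qm1 => /eqP; rewrite eq_sym addrCA addr_eq0 => /eqP e.
    by rewrite -[LHS](subrK (f z)) -[X in X + _]opprK -[- (_ - _)]opprK; move: e => ->; ring.
  have zn : z ^+ N.+1 = rc r ^+ N.+1 * expi t0 ^+ N.+1 by rewrite [in LHS]zE exprMn.
  have zN : z * (expi t0 ^+ N * qh N) = rc r * expi t0 * (expi t0 ^+ N * qh N).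
    by rewrite -zE.
  by rewrite big_ord_recr /= IH zn [coef f _ * _]mulrA rec exprS zN; ring.
have h0 : cabs (f z - \sum_(n < N) coef f n * z ^+ n) @[N --> \oo] --> 0.
  apply: cvg_pred.
  have -> : (fun n => cabs (f z - \sum_(n0 < n.+1) coef f n0 * z ^+ n0)) =
     (fun n => r * cabs (qh n)).
    apply/funext => n; rewrite partial opprB addrC subrK !cabsM cabsX cabs_expi.
    by rewrite expr1n mul1r.
  rewrite -(mulr0 r); apply: cvgM; first exact: cvg_cst.
  exact: bessel_cvg0.
apply/cvg_cabsP => e e0; move/cvgrPdist_lt: h0 => /(_ _ e0); apply: filterS => N.
by rewrite sub0r normrN ger0_norm// cabs_ge0.
Qed.

End Coefficients.

(** * Poisson kernel *)

Section Poisson.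
Variable R : realType.
Implicit Types (a b z w c : cplx R) (f h : cplx R -> cplx R) (g : R -> cplx R) (r s t : R).

Definition poisson a t : R := (1 - cabs a ^+ 2) / cabs (1 - a * conjz (expi t)) ^+ 2.

(** Taylor polynomial of [(1 + u) / (1 - u)] at [u = a * conjz (expi t)]. The real part of that
    fraction is the Poisson kernel, and [kererr (cabs a) M] bounds the remainder uniformly in
    [t]. *)
Definition kerpoly a M t : cplx R := 1 + 2 * \sum_(k < M) (a * conjz (expi t)) ^+ k.+1.

Definition kererr (x : R) M : R := 2 * x ^+ M.+1 / (1 - x).

Lemma cabsV z : cabs z^-1 = (cabs z)^-1.
Proof. exact: Normc.normcV. Qed.

Lemma cabs_conj_expi t : cabs (conjz (expi t)) = 1.
Proof. by rewrite cabs_conj cabs_expi. Qed.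

Lemma cabs_ker_arg a t : cabs (a * conjz (expi t)) = cabs a.
Proof. by rewrite cabsM cabs_conj_expi mulr1. Qed.

Lemma cabsB_ge z w : cabs z - cabs w <= cabs (z - w).
Proof. by rewrite lerBlDr -{1}(subrK w z); exact: cabsD. Qed.

Lemma ker_den a t : cabs a < 1 -> 1 - cabs a <= cabs (1 - a * conjz (expi t)).
Proof. by move=> a1; rewrite -{1}(cabs1 R) -(cabs_ker_arg a t); exact: cabsB_ge. Qed.

Lemma ker_den_gt0 a t : cabs a < 1 -> 0 < cabs (1 - a * conjz (expi t)).
Proof. by move=> a1; apply: lt_le_trans (ker_den t a1); rewrite subr_gt0. Qed.

Lemma ker_den_neq0 a t : cabs a < 1 -> 1 - a * conjz (expi t) != 0.
Proof. by move=> a1; apply: contraTneq (ker_den_gt0 t a1) => ->; rewrite cabs0 ltxx. Qed.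

Lemma cabs_sqr_lt1 z : cabs z < 1 -> 0 < 1 - cabs z ^+ 2.
Proof. by move=> z1; rewrite subr_gt0 expr_lt1// cabs_ge0. Qed.

Lemma poisson_gt0 a t : cabs a < 1 -> 0 < poisson a t.
Proof. by move=> a1; rewrite divr_gt0 ?cabs_sqr_lt1// exprn_gt0// ker_den_gt0. Qed.

Lemma poisson_le a t : cabs a < 1 -> poisson a t <= (1 + cabs a) / (1 - cabs a).
Proof.
move=> a1; have d0 : 0 < 1 - cabs a by rewrite subr_gt0.
rewrite /poisson ler_pdivrMr ?exprn_gt0 ?ker_den_gt0//.
have -> : 1 - cabs a ^+ 2 = (1 + cabs a) / (1 - cabs a) * (1 - cabs a) ^+ 2.
  by field; rewrite gt_eqF.
apply: ler_wpM2l; first exact: divr_ge0 (addr_ge0 ler01 (cabs_ge0 a)) (ltW d0).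
by rewrite ler_sqr ?nnegrE ?cabs_ge0 ?(ltW d0)// ker_den.
Qed.

Lemma Re_cayley z : z != 1 ->
  complex.Re ((1 + z) / (1 - z)) = (1 - cabs z ^+ 2) / cabs (1 - z) ^+ 2.
Proof.
move=> z1; have nz : 1 - z != 0 by rewrite subr_eq0 eq_sym.
have d0 : cabs (1 - z) ^+ 2 != 0.
  by rewrite expf_neq0//; apply: contra_neq nz; exact: cabs_eq0.
have -> : (1 + z) / (1 - z) = (1 + z) * conjz (1 - z) * rc (cabs (1 - z) ^+ 2)^-1.
  have cn : 1 - conjz z != 0.
    apply: contra_neq nz => /eqP; rewrite subr_eq0 => /eqP e.
    by rewrite -(conjzK z) -e /conjz rmorph1 subrr.
  by rewrite rcV -mul_conjz; field; rewrite nz andbT; exact: cn.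
rewrite cReM /= mulr0 subr0; congr (_ / _).
rewrite cabs2; case: z {z1 nz d0} => x y /=; ring.
Qed.

Lemma kerpoly_cayley a M t : cabs a < 1 ->
  (1 + a * conjz (expi t)) / (1 - a * conjz (expi t)) - kerpoly a M t =
  2 * (a * conjz (expi t)) ^+ M.+1 / (1 - a * conjz (expi t)).
Proof.
move=> a1; have nz := ker_den_neq0 t a1; rewrite /kerpoly.
move: (a * _) nz => u nz.
apply: (mulIf nz); rewrite mulrBl !divfK// mulrDl mul1r.
have -> : \sum_(k < M) u ^+ k.+1 = u * \sum_(k < M) u ^+ k.
  by rewrite mulr_sumr; apply: eq_bigr => i _; rewrite exprS.
have h : (\sum_(k < M) u ^+ k) * (1 - u) = 1 - u ^+ M.
  have := subrX1 u M => e.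
  by rewrite -[LHS]opprK -mulrN opprB mulrC -e opprB.
by rewrite -!mulrA h exprS; ring.
Qed.

Lemma poisson_kerpoly a M t : cabs a < 1 ->
  `|poisson a t - complex.Re (kerpoly a M t)| <= kererr (cabs a) M.
Proof.
move=> a1; have nz := ker_den_neq0 t a1.
have u1 : a * conjz (expi t) != 1 by rewrite -subr_eq0 -opprB oppr_eq0.
rewrite /poisson -(cabs_ker_arg a t) -Re_cayley// -cReN -cReD.
apply: (le_trans (cabs_Re _)); rewrite kerpoly_cayley// !cabsM cabsX cabs_ker_arg.
have -> : cabs (2 : cplx R) = 2.
  by rewrite (_ : 2 = rc 2) ?cabs_rc ?ger0_norm// rcD.
rewrite cabs_conj_expi mulr1 /kererr cabsV ler_wpM2l ?mulr_ge0 ?exprn_ge0 ?cabs_ge0//.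
by rewrite lef_pV2 ?posrE ?ker_den ?ker_den_gt0// subr_gt0.
Qed.

Lemma kererr_cvg0 x : 0 <= x < 1 -> kererr x M @[M --> \oo] --> 0.
Proof.
move=> /andP[x0 x1]; rewrite -(mul0r (1 - x)^-1) -(mulr0 2).
apply: cvgM; last exact: cvg_cst.
apply: cvgM; first exact: cvg_cst.
by apply: cvg_succ; apply: cvg_expr; rewrite ger0_norm.
Qed.

Lemma continuous_kerarg a : continuous (fun t : R => a * conjz (expi t)).
Proof. exact: (continuousZc a (continuous_conj (@continuous_expi R))). Qed.

Lemma continuous_kerpoly a M : continuous (kerpoly a M).
Proof.
have cu k : continuous (fun t : R => (a * conjz (expi t)) ^+ k.+1).
  exact: (continuousXc (n := k.+1) (@continuous_kerarg a)).
have c1 : continuous (fun _ : R => 1 : cplx R) by move=> t; exact: cvg_cst.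
exact: (continuousDc c1 (continuousZc 2 (continuous_bigsum (n := M) cu))).
Qed.

Lemma continuousM_real (u v : R -> R) : continuous u -> continuous v ->
  continuous (fun t => u t * v t).
Proof. by move=> cu cv t; apply: cvgM; [exact: cu|exact: cv]. Qed.

Lemma continuousB_real (u v : R -> R) : continuous u -> continuous v ->
  continuous (fun t => u t - v t).
Proof. by move=> cu cv t; apply: cvgB; [exact: cu|exact: cv]. Qed.

Lemma continuousD_real (u v : R -> R) : continuous u -> continuous v ->
  continuous (fun t => u t + v t).
Proof. by move=> cu cv t; apply: cvgD; [exact: cu|exact: cv]. Qed.

Lemma continuousZ_real (x : R) (u : R -> R) : continuous u ->
  continuous (fun t => x * u t).
Proof. by move=> cu t; apply: cvgM; [exact: cvg_cst|exact: cu]. Qed.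

Lemma continuous_norm_real (u : R -> R) : continuous u -> continuous (fun t => `|u t|).
Proof. by move=> cu t; apply: cvg_norm; exact: cu. Qed.

Lemma continuous_poisson a : cabs a < 1 -> continuous (poisson a).
Proof.
move=> a1; have c1 : continuous (fun _ : R => 1 : cplx R) by move=> t; exact: cvg_cst.
have cd := continuous_cabs2 (continuousBc c1 (@continuous_kerarg a)).
move=> t; apply: cvgM; first exact: cvg_cst.
by apply: cvgV; [rewrite gt_eqF// exprn_gt0// ker_den_gt0|exact: cd].
Qed.

Lemma continuous_rc (u : R -> R) : continuous u -> continuous (fun t => rc (u t)).
Proof. by move=> cu; apply: continuous_mk => // t; exact: cvg_cst. Qed.

(** Bessel's inequality at frequency [0] serves as the Cauchy-Schwarz inequality. *)
Lemma cabs_cmean_sqr g : continuous g ->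
  cabs (cmean g) ^+ 2 <= rmean (fun t => cabs (g t) ^+ 2).
Proof.
move=> cg; have := bessel 1 cg; rewrite big_ord1 /fcoef.
by under cmean_eq do rewrite expr0 mulr1.
Qed.

Lemma rc_Re z : 2 * rc (complex.Re z) = z + conjz z.
Proof.
by rewrite (_ : 2 = rc 1 + rc 1)//; case: z => x y; apply/eqP; rewrite eq_complex /=;
  apply/andP; split; apply/eqP; ring.
Qed.

Lemma continuousMrc g (u : R -> R) : continuous g -> continuous u ->
  continuous (fun t => g t * rc (u t)).
Proof. by move=> cg cu; exact: (continuousMc cg (continuous_rc cu)). Qed.

Lemma cabs_cmean_small g (u : R -> R) e : continuous g -> continuous u ->
  (forall t, `|u t| <= e) -> 0 <= e ->
  cabs (cmean (fun t => g t * rc (u t))) ^+ 2 <= e ^+ 2 * rmean (fun t => cabs (g t) ^+ 2).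
Proof.
move=> cg cu ue e0; apply: (le_trans (cabs_cmean_sqr (continuousMrc cg cu))).
have cg2 := continuous_cabs2 cg.
rewrite -(rmeanZ _ cg2); apply: ler_rmean.
- exact: (continuous_cabs2 (continuousMrc cg cu)).
- exact: (continuousZ_real (x := e ^+ 2) cg2).
move=> t; rewrite cabsM cabs_rc exprMn mulrC ler_wpM2r ?sqr_ge0//.
by rewrite ler_sqr ?nnegrE.
Qed.

Lemma conjz_sum n (F : 'I_n -> cplx R) : conjz (\sum_(i < n) F i) = \sum_(i < n) conjz (F i).
Proof. exact: (raddf_sum (@conjc R)). Qed.

(** Twice the real part is the polynomial plus its conjugate. The conjugate terms pair [f] with
    [expi t ^+ k.+1] and vanish; the others produce the Taylor polynomial of [f] at [rc r * a]. *)
Lemma cmean_kerpoly f r a M : analytic_on_disk f -> 0 <= r < 1 ->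
  cmean (fun t => circ f r t * rc (complex.Re (kerpoly a M t))) =
  \sum_(n < M.+1) coef f n * (rc r * a) ^+ n.
Proof.
move=> af r01; have cf := continuous_circ af r01.
have two0 : (2 : cplx R) != 0 by rewrite pnatr_eq0.
have e t : circ f r t * rc (complex.Re (kerpoly a M t)) = circ f r t +
  \sum_(k < M) (a ^+ k.+1 * (circ f r t * conjz (expi t) ^+ k.+1) +
     conjz a ^+ k.+1 * (circ f r t * expi t ^+ k.+1)).
  apply: (mulfI two0); rewrite mulrCA rc_Re /kerpoly.
  have -> : conjz (1 + 2 * \sum_(k < M) (a * conjz (expi t)) ^+ k.+1) =
     1 + 2 * \sum_(k < M) (conjz a * expi t) ^+ k.+1.
    rewrite conjzD conjzM; congr (_ + _).
      by rewrite /conjz /= oppr0.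
    congr (_ * _); first by rewrite /conjz; exact: conjc_nat.
    rewrite conjz_sum; apply: eq_bigr => i _.
    by rewrite conjzX conjzM conjzK.
  have -> : \sum_(k < M) (a ^+ k.+1 * (circ f r t * conjz (expi t) ^+ k.+1) +
     conjz a ^+ k.+1 * (circ f r t * expi t ^+ k.+1)) =
     circ f r t * \sum_(k < M) (a * conjz (expi t)) ^+ k.+1 +
     circ f r t * \sum_(k < M) (conjz a * expi t) ^+ k.+1.
    by rewrite big_split /= !mulr_sumr; congr (_ + _); apply: eq_bigr => k _;
      rewrite exprMn mulrCA.
  move: (\sum_(k < M) _) (\sum_(k < M) _) (circ f r t) => A B C; ring.
rewrite (cmean_eq e).
have c1 k : continuous (fun t => circ f r t * conjz (expi t) ^+ k.+1).
  exact: (continuousMc cf (@continuous_cexpiX R k.+1)).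
have c2 k : continuous (fun t => circ f r t * expi t ^+ k.+1).
  exact: (continuousMc cf (@continuous_expiX R k.+1)).
have c3 k := continuousDc (continuousZc (a ^+ k.+1) (c1 k)) (continuousZc (conjz a ^+ k.+1) (c2 k)).
rewrite (cmeanD cf (continuous_bigsum (n := M) c3)) (cmean_sum M c3) big_ord_recl.
congr (_ + _); first by rewrite expr0 mulr1 coef0E// mean_value.
apply: eq_bigr => k _.
apply: (etrans (cmeanD (continuousZc (a ^+ k.+1) (c1 k)) (continuousZc (conjz a ^+ k.+1) (c2 k)))).
apply: (etrans (congr2 +%R (cmeanZ (a ^+ k.+1) (c1 k)) (cmeanZ (conjz a ^+ k.+1) (c2 k)))).
have p0 := cmean_posfreq af r01 (ltn0Sn k).
have q0 := cmean_coef k.+1 af r01; rewrite /fcoef in q0.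
apply: (etrans (congr2 (fun x y => a ^+ k.+1 * x + conjz a ^+ k.+1 * y) q0 p0)).
by rewrite lift0 exprMn; ring.
Qed.

(** The Taylor polynomials at [rc r * a] have two limits: the value of [f], and the Poisson mean,
    since the truncated kernels converge uniformly in [t]. *)
Lemma poisson_formula f r a : analytic_on_disk f -> 0 <= r < 1 -> cabs a < 1 ->
  cmean (fun t => circ f r t * rc (poisson a t)) = f (rc r * a).
Proof.
move=> af r01 a1; have cf := continuous_circ af r01.
have cP := continuous_poisson a1.
set K := rmean (fun t => cabs (circ f r t) ^+ 2).
set L := cmean _.
pose S M := \sum_(n < M.+1) coef f n * (rc r * a) ^+ n.
have ra1 : cabs (rc r * a) < 1.
  case/andP: r01 => r0 r1; rewrite cabsM cabs_rc ger0_norm//.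
  by rewrite -[X in _ < X]mulr1 ltr_pM// cabs_ge0.
have a01 : 0 <= cabs a < 1 by rewrite cabs_ge0.
have cS : S M @[M --> \oo] --> f (rc r * a).
  apply/cvg_cabsP => e e0; have /cvg_cabsP/(_ e e0)[N _ hN] := taylor_cvg af ra1.
  by exists N => // M NM; apply: hN; rewrite /= (leq_trans NM).
have cS' : S M @[M --> \oo] --> L.
  apply/cvg_cabsP => e e0.
  have k0 := kererr_cvg0 a01.
  have : kererr (cabs a) M * kererr (cabs a) M * K @[M --> \oo] --> 0 * 0 * K.
    by apply: cvgM; [exact: cvgM|exact: cvg_cst].
  rewrite !mul0r.
  have e20 : 0 < e ^+ 2 by rewrite exprn_gt0.
  move=> /cvgrPdist_lt/(_ _ e20); apply: filterS => M.
  rewrite sub0r normrN -expr2 => lt_e.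
  rewrite -ltr_sqr ?nnegrE ?cabs_ge0 ?ltW//.
  apply: le_lt_trans (le_lt_trans (ler_norm _) lt_e).
  have ck := continuous_Re (@continuous_kerpoly a M).
  rewrite /S -cmean_kerpoly// -cmeanB; [|exact: (continuousMrc cf cP)|exact: (continuousMrc cf ck)].
  have := @cabs_cmean_small (circ f r) (fun t => poisson a t - complex.Re (kerpoly a M t)) (kererr (cabs a) M) cf
    (continuousB_real cP ck) (fun t => poisson_kerpoly M t a1).
  rewrite (cmean_eq (_ : forall t, _ = circ f r t * rc (poisson a t) - circ f r t * rc (complex.Re (kerpoly a M t)))).
    apply; apply: divr_ge0; last by rewrite subr_ge0 ltW.
    by rewrite mulr_ge0// exprn_ge0// cabs_ge0.
  by move=> t; rewrite rcD rcN mulrBr.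
have := cvg_unique (@norm_hausdorff _ _) cS' cS.
exact.
Qed.

End Poisson.

(** * Poisson integrals and harmonic majorants *)

Section HarmonicMajorant.
Variable R : realType.
Implicit Types (a b z w c : cplx R) (f h : cplx R -> cplx R) (g : R -> cplx R) (r s t : R)
  (u v : R -> R).

Lemma ler_rmean_in u v : continuous u -> continuous v ->
  (forall t, 0 <= t <= 2 * pi -> u t <= v t) -> rmean u <= rmean v.
Proof.
move=> cu cv uv; rewrite /rmean ler_wpM2l ?invr_ge0 ?(ltW (twopi_gt0 R))//.
by apply: le_intg.
Qed.

Lemma analytic_cst c : analytic_on_disk (fun _ : cplx R => c).
Proof. by move=> z _; exact: derivable_cstc. Qed.

Lemma rmean_poisson a : cabs a < 1 -> rmean (poisson a) = 1.
Proof.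
move=> a1; apply: (@complexI R); rewrite -[LHS]/(rc _) rc_rmean.
have r01 : 0 <= (0 : R) < 1 by apply/andP; split; [exact: lexx|exact: ltr01].
rewrite -[RHS](poisson_formula (@analytic_cst 1) r01 a1).
by apply: cmean_eq => t; rewrite /circ mul1r.
Qed.

(** [pint] is the Poisson integral of [v] and [polint] its version with the truncated kernel; [mpol]
    is the polynomial in [a] whose real part is [polint]. Through [mpol], facts on analytic
    functions reach [pint] as [M] grows. *)
Definition pint v a : R := rmean (fun t => v t * poisson a t).
Definition polint v M a : R := rmean (fun t => v t * complex.Re (kerpoly a M t)).
Definition mpol v M a : cplx R := rc (rmean v) +
  \sum_(k < M) (2 * fcoef (fun t => rc (v t)) k.+1) * a ^+ k.+1.

Lemma Re_mpol v M a : continuous v -> complex.Re (mpol v M a) = polint v M a.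
Proof.
move=> cv; have cr := continuous_rc cv.
have ck k : continuous (fun t => rc (v t) * conjz (expi t) ^+ k.+1).
  exact: (continuousMc cr (@continuous_cexpiX R k.+1)).
have ck' k := continuousZc (2 * a ^+ k.+1) (ck k).
have -> : mpol v M a = cmean (fun t => rc (v t) * kerpoly a M t).
  transitivity (cmean (fun t => rc (v t) +
      \sum_(k < M) 2 * a ^+ k.+1 * (rc (v t) * conjz (expi t) ^+ k.+1))).
    rewrite (cmeanD cr (continuous_bigsum (n := M) ck')) /mpol rc_rmean; congr (_ + _).
    rewrite (cmean_sum M ck'); apply: eq_bigr => k _.
    by rewrite (cmeanZ (2 * a ^+ k.+1) (ck k)) /fcoef mulrAC.
  apply: cmean_eq => t; rewrite /kerpoly mulrDr mulr1; congr (_ + _).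
  rewrite !mulr_sumr; apply: eq_bigr => k _; rewrite exprMn; ring.
by apply: eq_rmean => t; rewrite cReM /= mul0r subr0.
Qed.

Lemma ler_kererr (x y : R) M : 0 <= x -> x <= y -> y < 1 -> kererr x M <= kererr y M.
Proof.
move=> x0 xy y1; have x1 := le_lt_trans xy y1.
apply: ler_pM.
- by rewrite mulr_ge0// exprn_ge0.
- by rewrite invr_ge0 subr_ge0 ltW.
- by rewrite ler_pM2l// lerXn2r// nnegrE// (le_trans x0).
- by rewrite lef_pV2 ?posrE ?subr_gt0// lerD2l lerN2.
Qed.

Lemma kererr_small (x y C : R) : 0 <= x < 1 -> (forall M, y <= kererr x M * C) -> y <= 0.
Proof.
move=> x01 h; rewrite leNgt; apply/negP => y0.
have : kererr x M * C @[M --> \oo] --> 0 * C.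
  by apply: cvgM; [exact: kererr_cvg0|exact: cvg_cst].
rewrite mul0r => /cvgrPdist_lt/(_ _ y0)[N _ hN].
have := hN N (leqnn N); rewrite sub0r normrN => /(le_lt_trans (ler_norm _)).
by move=> /(le_lt_trans (h N)); rewrite ltxx.
Qed.

Lemma continuous_kerpolyRe v a M : continuous v ->
  continuous (fun t => v t * complex.Re (kerpoly a M t)).
Proof. by move=> cv; exact: (continuousM_real cv (continuous_Re (@continuous_kerpoly R a M))). Qed.

Lemma continuous_vpoisson v a : continuous v -> cabs a < 1 ->
  continuous (fun t => v t * poisson a t).
Proof. by move=> cv a1; exact: (continuousM_real cv (continuous_poisson a1)). Qed.

Lemma pint_polint v M a : continuous v -> cabs a < 1 ->
  `|pint v a - polint v M a| <= kererr (cabs a) M * rmean (fun t => `|v t|).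
Proof.
move=> cv a1.
have cP := continuous_vpoisson cv a1.
have cK := @continuous_kerpolyRe v a M cv.
rewrite -(rmeanB cP cK); apply: (le_trans (ler_norm_rmean (continuousB_real cP cK))).
have cn := continuous_norm_real cv.
rewrite -(rmeanZ (kererr (cabs a) M) cn); apply: ler_rmean.
- exact: (continuous_norm_real (continuousB_real cP cK)).
- exact: (continuousZ_real (x := kererr (cabs a) M) cn).
move=> t; rewrite -mulrBr normrM mulrC ler_wpM2r//.
exact: poisson_kerpoly.
Qed.

Lemma derivable_mpol v M a : derivable (mpol v M) a 1.
Proof.
rewrite /mpol; elim: M => [|M IH].
  rewrite (_ : (fun a => _) = fun=> rc (rmean v)); first exact: derivable_cstc.
  by apply/funext => x; rewrite big_ord0 addr0.
rewrite (_ : (fun a => _) = fun x => (rc (rmean v) +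
    \sum_(k < M) (2 * fcoef (fun t => rc (v t)) k.+1) * x ^+ k.+1) +
    (2 * fcoef (fun t => rc (v t)) M.+1) * x ^+ M.+1).
  exact: (derivableDc IH (derivableMc (derivable_cstc a _) (derivableXc a M.+1))).
by apply/funext => x; rewrite big_ord_recr /= addrA.
Qed.

Lemma continuous_pint_comp v (p : R -> cplx R) : continuous v -> continuous p ->
  (forall t, cabs (p t) < 1) -> continuous (fun t => pint v (p t)).
Proof.
move=> cv cp p1 t; apply/cvgrPdist_lt => e e0.
set K := rmean (fun t => `|v t|).
have K0 : 0 <= K by exact: rmean_ge0.
(* A radius between [cabs (p t)] and [1]: near [t] the values of [p] stay inside it, where one order
   [M] makes the truncation error small uniformly. *)
pose x := (cabs (p t) + 1) / 2.
have ptx : cabs (p t) < x by rewrite /x; have := p1 t; lra.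
have x0 : 0 <= x by apply: le_trans (ltW ptx); exact: cabs_ge0.
have x1 : x < 1 by rewrite /x; have := p1 t; lra.
have x01 : 0 <= x < 1 by rewrite x0.
have e4 : 0 < e / 4 by rewrite divr_gt0.
have [M hM] : exists M, kererr x M * K < e / 4.
  apply: contrapT => /forallNP hM.
  have : e / 4 <= 0.
    by apply: (@kererr_small x _ K) => // M; rewrite leNgt; apply/negP/hM.
  by rewrite leNgt e4.
have cpol : {for t, continuous (fun t => mpol v M (p t))}.
  apply: (@continuous_comp _ _ _ p (mpol v M)); first exact: cp.
  exact/derivable_continuous/derivable_mpol.
have := @cvg_Re R _ _ (nbhs_filter t) _ _ cpol; move=> /cvgrPdist_lt/(_ _ e4) n1.
have d0 : 0 < x - cabs (p t) by rewrite subr_gt0.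
have /cvg_cabsP/(_ _ d0) n2 := cp t.
move: n1 n2; apply: filterS2 => t' h1 h2.
have pt'x : cabs (p t') < x.
  have := cabsB_ge (p t') (p t); rewrite -(cabsN (p t' - p t)) opprB => h3.
  by have := le_lt_trans h3 h2; rewrite ltrD2r.
rewrite !Re_mpol// in h1.
have b1 := pint_polint M cv (p1 t); have b2 := pint_polint M cv (p1 t').
have b3 : kererr (cabs (p t)) M * K <= kererr x M * K.
  by rewrite ler_wpM2r// ler_kererr ?cabs_ge0// ltW.
have b4 : kererr (cabs (p t')) M * K <= kererr x M * K.
  by rewrite ler_wpM2r// ler_kererr ?cabs_ge0// ltW.
move: h1 hM b1 b2 b3 b4; rewrite -/K.
move: (pint v (p t)) (pint v (p t')) (polint v M (p t)) (polint v M (p t')) => A A' B B'.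
move: (kererr x M * K) (kererr _ M * K) (kererr _ M * K) => k1 k2 k3.
rewrite !ltr_norml !ler_norml; clear; lra.
Qed.

Lemma circ_bound f r : analytic_on_disk f -> 0 <= r < 1 -> exists2 t0, 0 <= t0 <= 2 * pi &
  forall t, 0 <= t <= 2 * pi -> cabs (circ f r t) <= cabs (circ f r t0).
Proof.
move=> af r01; have cf := continuous_cabs2 (continuous_circ af r01).
have [t0 ht0 h] := EVT_max (ltW (twopi_gt0 R)) (continuous_subspaceT cf).
exists t0; first by move: ht0; rewrite in_itv.
move=> t tt; have := h t; rewrite in_itv /= => /(_ tt).
by rewrite ler_sqr ?nnegrE ?cabs_ge0.
Qed.

Definition selfmap h := analytic_on_disk h /\ forall z, cabs z < 1 -> cabs (h z) < 1.

(* [pint v] is harmonic, being a locally uniform limit of the real parts of the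
   polynomials [mpol v M]. *)
Lemma pint_harmonic v psi s b : continuous v -> selfmap psi -> 0 <= s < 1 -> cabs b < 1 ->
  rmean (fun t => pint v (circ psi s t) * poisson b t) = pint v (psi (rc s * b)).
Proof.
move=> cv [ap sp] s01 b1; have cp := continuous_circ ap s01.
have s0 : 0 <= s by case/andP: s01.
have p1 t : cabs (circ psi s t) < 1 by apply: sp; rewrite cabs_circ//; case/andP: s01.
have sb1 : cabs (rc s * b) < 1.
  case/andP: s01 => _ s1; rewrite cabsM cabs_rc ger0_norm//.
  by rewrite -[X in _ < X]mulr1 ltr_pM// cabs_ge0.
set w := psi (rc s * b); have w1 : cabs w < 1 by exact: sp.
have [t0 ht0 hb] := circ_bound ap s01.
(* One radius below [1] that contains [w] and the whole image curve, so that the truncation error is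
   uniform along it. *)
pose x := Num.max (cabs w) (cabs (circ psi s t0)).
have x1 : x < 1 by rewrite gt_max w1 p1.
have x0 : 0 <= x by rewrite le_max cabs_ge0.
have x01 : 0 <= x < 1 by rewrite x0.
set K := rmean (fun t => `|v t|).
have K0 : 0 <= K by exact: rmean_ge0.
have cpi := continuous_pint_comp cv cp p1.
have cPb := continuous_poisson b1.
apply/eqP; rewrite -subr_eq0 -normr_le0; apply: (@kererr_small x _ (2 * K)) => // M.
have am : analytic_on_disk (fun z => mpol v M (psi z)).
  by move=> z z1; exact: (derivable_compc (ap z z1) (@derivable_mpol v M (psi z))).
have cm : continuous (fun t => polint v M (circ psi s t)).
  have := continuous_Re (continuous_circ am s01).
  by under eq_fun do rewrite /circ Re_mpol//.
have e1 : rmean (fun t => polint v M (circ psi s t) * poisson b t) = polint v M w.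
  rewrite -(Re_mpol M w cv) /w -(poisson_formula am s01 b1).
  by apply: eq_rmean => t; rewrite cReM /= mulr0 subr0 -Re_mpol.
have b2 : `|rmean (fun t => pint v (circ psi s t) * poisson b t) - polint v M w| <= kererr x M * K.
  have c1 := continuousM_real cpi cPb; have c2 := continuousM_real cm cPb.
  rewrite -e1 -(rmeanB c1 c2).
  apply: (le_trans (ler_norm_rmean (continuousB_real c1 c2))).
  rewrite -[leRHS]mulr1 -(rmean_poisson b1) -(rmeanZ (kererr x M * K) cPb).
  apply: ler_rmean_in.
  - exact: (continuous_norm_real (continuousB_real c1 c2)).
  - exact: (continuousZ_real (x := kererr x M * K) cPb).
  move=> t tt; rewrite -mulrBl normrM (ger0_norm (ltW (poisson_gt0 t b1))).
  rewrite ler_wpM2r ?(ltW (poisson_gt0 _ _))//.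
  apply: (le_trans (pint_polint M cv (p1 t))); rewrite ler_wpM2r//.
  by apply: ler_kererr => //; rewrite ?cabs_ge0// le_max hb ?orbT.
have b3 : `|pint v w - polint v M w| <= kererr x M * K.
  apply: (le_trans (pint_polint M cv w1)); rewrite ler_wpM2r//.
  by apply: ler_kererr => //; rewrite ?cabs_ge0// le_max lexx.
rewrite mulrCA mulr_natl mulr2n.
have -> : rmean (fun t => pint v (circ psi s t) * poisson b t) - pint v w =
  (rmean (fun t => pint v (circ psi s t) * poisson b t) - polint v M w) - (pint v w - polint v M w) by ring.
by apply: (le_trans (ler_normB _ _)); exact: lerD.
Qed.

Lemma pint_mean v psi s : continuous v -> selfmap psi -> 0 <= s < 1 ->
  rmean (fun t => pint v (circ psi s t)) = pint v (psi 0).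
Proof.
move=> cv sp s01; have z1 : cabs (0 : cplx R) < 1 by rewrite cabs0.
rewrite -(mulr0 (rc s)) -(pint_harmonic cv sp s01 z1).
apply: eq_rmean => t; rewrite /poisson mul0r subr0 cabs1 cabs0.
by rewrite expr0n expr1n subr0 divr1 mulr1.
Qed.

(** The expansion of a variance about [c] for the weight [u] of mean [1]. It gives both the
    minimality of centering at the weighted mean and Jensen's inequality. *)
Lemma rmean_cabs_sub g u c : continuous g -> continuous u -> rmean u = 1 ->
  rmean (fun t => cabs (g t - c) ^+ 2 * u t) =
  rmean (fun t => cabs (g t) ^+ 2 * u t) -
    2 * complex.Re (cmean (fun t => g t * rc (u t)) * conjz c) + cabs c ^+ 2.
Proof.
move=> cg cu u1.
have cgu := continuousMrc cg cu.
have c1 := continuousM_real (continuous_cabs2 cg) cu.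
have cR := continuous_Re cgu; have cI := continuous_Im cgu.
pose x := complex.Re c; pose y := complex.Im c.
have e t : cabs (g t - c) ^+ 2 * u t = (cabs (g t) ^+ 2 * u t +
   (- (2 * x)) * complex.Re (g t * rc (u t))) +
   ((- (2 * y)) * complex.Im (g t * rc (u t)) + (cabs c ^+ 2) * u t).
  rewrite !cabs2 !cReD !cImD !cReN !cImN cReM cImM /= -/x -/y; ring.
rewrite (eq_rmean e).
have cx := continuousZ_real (x := - (2 * x)) cR.
have cy := continuousZ_real (x := - (2 * y)) cI.
have cc := continuousZ_real (x := cabs c ^+ 2) cu.
rewrite (rmeanD (continuousD_real c1 cx) (continuousD_real cy cc)).
rewrite (rmeanD c1 cx) (rmeanD cy cc) (rmeanZ (- (2 * x)) cR) (rmeanZ (- (2 * y)) cI).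
rewrite (rmeanZ (cabs c ^+ 2) cu) u1.
rewrite cReM Re_conjz Im_conjz /= -/x -/y; ring.
Qed.

(* Centering at the weighted mean minimizes the weighted square deviation. *)
Lemma rmean_cabs_min f r a c : analytic_on_disk f -> 0 <= r < 1 -> cabs a < 1 ->
  rmean (fun t => cabs (circ f r t - f (rc r * a)) ^+ 2 * poisson a t) <=
  rmean (fun t => cabs (circ f r t - c) ^+ 2 * poisson a t).
Proof.
move=> af r01 a1; have cf := continuous_circ af r01; have cP := continuous_poisson a1.
rewrite !(rmean_cabs_sub _ cf cP (rmean_poisson a1)) (poisson_formula af r01 a1).
rewrite -subr_ge0; set m := f _.
have -> : forall A : R, A - 2 * complex.Re (m * conjz c) + cabs c ^+ 2 -
   (A - 2 * complex.Re (m * conjz m) + cabs m ^+ 2) = cabs (m - c) ^+ 2.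
  move=> A; rewrite !cabs2 !cReM !Re_conjz !Im_conjz cReD cImD cReN cImN; ring.
exact: sqr_ge0.
Qed.

(** The variance about the weighted mean, which is [f (rc r * w)] by the Poisson formula, is
    nonnegative. *)
Lemma jensen f r w : analytic_on_disk f -> 0 <= r < 1 -> cabs w < 1 ->
  cabs (f (rc r * w)) ^+ 2 <= pint (fun t => cabs (circ f r t) ^+ 2) w.
Proof.
move=> af r01 w1; have cf := continuous_circ af r01; have cP := continuous_poisson w1.
have : 0 <= rmean (fun t => cabs (circ f r t - f (rc r * w)) ^+ 2 * poisson w t).
  by apply: rmean_ge0 => t; rewrite mulr_ge0 ?sqr_ge0// ltW// poisson_gt0.
rewrite (rmean_cabs_sub _ cf cP (rmean_poisson w1)) (poisson_formula af r01 w1).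
set m := f _; have -> : complex.Re (m * conjz m) = cabs m ^+ 2.
  by rewrite cabs2 cReM Re_conjz Im_conjz; ring.
by rewrite /pint; lra.
Qed.

End HarmonicMajorant.

(** * Hardy norms and composition *)

Section Mobius.
Variable R : realType.
Implicit Types (a b z w c : cplx R) (f h : cplx R -> cplx R) (r s t : R).

Lemma sigma_den_neq0 b z : cabs b < 1 -> cabs z < 1 -> 1 - conjz b * z != 0.
Proof.
move=> b1 z1; have : cabs (conjz b * z) < 1.
  by rewrite cabsM cabs_conj -[X in _ < X]mulr1 ltr_pM// cabs_ge0.
move=> h; apply: contraTneq h => /eqP; rewrite subr_eq0 => /eqP <-.
by rewrite cabs1 ltxx.
Qed.

Lemma sigma_cabs2 b z : 1 - conjz b * z != 0 ->
  1 - cabs (sigma b z) ^+ 2 =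
  (1 - cabs b ^+ 2) * (1 - cabs z ^+ 2) / cabs (1 - conjz b * z) ^+ 2.
Proof.
move=> nz; have d0 : cabs (1 - conjz b * z) ^+ 2 != 0.
  by rewrite expf_neq0//; apply: contra_neq nz; exact: cabs_eq0.
rewrite /sigma -[(b^* * z)%C]/(conjz b * z) cabsM cabsV exprMn exprVn.
apply: (mulIf d0); rewrite divfK// mulrBl mul1r divfK// !cabs2.
rewrite !(cReD, cImD, cReN, cImN, cReM, cImM, Re_conjz, Im_conjz) /=; ring.
Qed.

Lemma sigma_disk b z : cabs b < 1 -> cabs z < 1 -> cabs (sigma b z) < 1.
Proof.
move=> b1 z1; have nz := sigma_den_neq0 b1 z1.
have : 0 < 1 - cabs (sigma b z) ^+ 2.
  rewrite sigma_cabs2//; apply: divr_gt0; first exact: (mulr_gt0 (cabs_sqr_lt1 b1) (cabs_sqr_lt1 z1)).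
  by rewrite exprn_gt0// lt_neqAle cabs_ge0 andbT eq_sym; apply: contra_neq nz; exact: cabs_eq0.
by rewrite subr_gt0 expr_lt1// cabs_ge0.
Qed.

Lemma sigma_analytic b : cabs b < 1 -> analytic_on_disk (sigma b).
Proof.
move=> b1 z z1; have nz := sigma_den_neq0 b1 z1.
have d1 := derivableBc (derivable_cstc z b) (derivable_idc z).
have d2 := derivableBc (derivable_cstc z 1) (derivableMc (derivable_cstc z (conjz b)) (derivable_idc z)).
have d3 := @derivableVc R (fun z => 1 - conjz b * z) z nz d2.
have -> : sigma b = fun z => (b - z) * (1 - conjz b * z)^-1 by [].
exact: (derivableMc d1 d3).
Qed.

Lemma sigma_selfmap b : cabs b < 1 -> selfmap (sigma b).
Proof. by move=> b1; split=> [|z z1]; [exact: sigma_analytic|exact: sigma_disk]. Qed.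

Lemma sigma_zero b : sigma b 0 = b.
Proof. by rewrite /sigma mulr0 !subr0 divr1. Qed.

Lemma sigma_self b : sigma b b = 0.
Proof. by rewrite /sigma subrr mul0r. Qed.

Lemma sigmaK b z : cabs b < 1 -> cabs z < 1 -> sigma b (sigma b z) = z.
Proof.
move=> b1 z1; have nz := sigma_den_neq0 b1 z1.
have bb := sigma_den_neq0 b1 b1.
have sE w : sigma b w = (b - w) / (1 - conjz b * w) by [].
rewrite !sE.
have e1 : b - (b - z) / (1 - conjz b * z) = z * (1 - conjz b * b) / (1 - conjz b * z).
  by apply: (mulIf nz); rewrite mulrBl !divfK//; ring.
have e2 : 1 - conjz b * ((b - z) / (1 - conjz b * z)) = (1 - conjz b * b) / (1 - conjz b * z).
  by apply: (mulIf nz); rewrite mulrBl mulrA !divfK//; ring.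
by rewrite e1 e2 -(mulrA z) mulfK// mulf_neq0// invr_neq0.
Qed.

Lemma selfmap_comp f h : selfmap f -> selfmap h -> selfmap (fun z => f (h z)).
Proof.
move=> [af df] [ah dh]; split=> [z z1|z z1]; last by apply: df; exact: dh.
exact: (derivable_compc (ah z z1) (af _ (dh _ z1))).
Qed.

Lemma analytic_comp f h : analytic_on_disk f -> selfmap h ->
  analytic_on_disk (fun z => f (h z)).
Proof. by move=> af [ah dh] z z1; exact: (derivable_compc (ah z z1) (af _ (dh _ z1))). Qed.

Lemma analytic_subc f c : analytic_on_disk f -> analytic_on_disk (fun z => f z - c).
Proof. by move=> af z z1; exact: (derivableBc (af z z1) (derivable_cstc z c)). Qed.

End Mobius.
Arguments analytic_subc {R f} c _.

Section HardyEstimates.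
Variable R : realType.
Implicit Types (a b z w c : cplx R) (f g h psi : cplx R -> cplx R) (r s t B : R).

(** Normalised means are used, so that constants and Poisson kernels have the expected mass; the
    factor [2 * pi] reappears only in comparisons with [norm2] and arc integrals. *)
Definition hardy_le h B := forall r, 0 <= r < 1 ->
  rmean (fun t => cabs (circ h r t) ^+ 2) <= B.

Lemma eq_circ_disk f g r t : (forall z, cabs z < 1 -> f z = g z) -> 0 <= r < 1 ->
  circ f r t = circ g r t.
Proof. by move=> fg /andP[r0 r1]; apply: fg; rewrite cabs_circ. Qed.

Lemma eq_hardy_le f g B : (forall z, cabs z < 1 -> f z = g z) ->
  hardy_le f B -> hardy_le g B.
Proof.
move=> fg hf r r01; have <- : rmean (fun t => cabs (circ f r t) ^+ 2) = rmean (fun t => cabs (circ g r t) ^+ 2).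
  by apply: eq_rmean => t; rewrite (eq_circ_disk t fg r01).
exact: hf.
Qed.

(** Radii [1 / 2], [2 / 3], ... increasing to [1]: a sequence, as Fatou's lemma demands, and never
    [0], so that one can divide by them. *)
Definition dilr n : R := 1 - n.+2%:R^-1.

Lemma dilr_itv n : 0 <= dilr n < 1.
Proof.
rewrite /dilr subr_ge0 invf_le1 ?ltr0n// ler1n /= ltrBlDr ltrDl invr_gt0 ltr0n//.
Qed.

Lemma dilr_cvg : dilr n @[n --> \oo] --> (1 : R).
Proof.
rewrite -[X in _ --> X]subr0; apply: cvgB; first exact: cvg_cst.
have := @cvg_harmonic R => /cvg_succ; exact.
Qed.

Lemma rc_dilr_cvg : rc (dilr n) @[n --> \oo] --> (1 : cplx R).
Proof.
by apply: cvg_ReIm => /=; [exact: dilr_cvg|exact: cvg_cst].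
Qed.

Lemma dilate_cvg f w : analytic_on_disk f -> cabs w < 1 ->
  f (rc (dilr n) * w) @[n --> \oo] --> f w.
Proof.
move=> af w1; have := derivable_continuous (af w w1).
apply: (@cvg_comp _ _ _ (fun n => rc (dilr n) * w) f).
by rewrite -{2}(mul1r w); apply: cvgM; [exact: rc_dilr_cvg|exact: cvg_cst].
Qed.

Lemma cabs_mulrc r w : 0 <= r -> cabs (rc r * w) = r * cabs w.
Proof. by move=> r0; rewrite cabsM cabs_rc ger0_norm. Qed.

Lemma cabs_mulrc_lt1 r w : 0 <= r < 1 -> cabs w <= 1 -> cabs (rc r * w) < 1.
Proof.
move=> /andP[r0 r1] w1; rewrite cabs_mulrc//; apply: le_lt_trans r1.
by rewrite ler_piMr.
Qed.

(** On the circle of radius [dilr n], the Poisson integral of [|h - h (rc (dilr n) * a)|^2] is a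
    harmonic majorant. Composed with [sigma a] it has mean its value at [sigma a 0 = a], the
    quantity bounded in the hypothesis. *)
Lemma mobius_hardy_le h a (B : R) : analytic_on_disk h -> cabs a < 1 ->
  (\forall n \near \oo, rmean (fun t =>
     cabs (circ h (dilr n) t - h (rc (dilr n) * a)) ^+ 2 * poisson a t) <= B) ->
  hardy_le (fun z => h (sigma a z) - h a) B.
Proof.
move=> ah a1 hB s s01.
have ss := sigma_selfmap a1.
have ak : analytic_on_disk (fun z => h (sigma a z) - h a).
  exact: (analytic_subc _ (analytic_comp ah ss)).
pose u n t := cabs (h (rc (dilr n) * sigma a (rc s * expi t)) - h (rc (dilr n) * a)) ^+ 2.
have pt1 t : cabs (sigma a (rc s * expi t)) < 1.
  by apply: sigma_disk => //; rewrite cabs_circ//; case/andP: s01.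
have ahn n : analytic_on_disk (fun z => h (rc (dilr n) * z) - h (rc (dilr n) * a)).
  move=> z z1; apply: derivableBc; last exact: derivable_cstc.
  apply: (derivable_compc (derivableMc (derivable_cstc z _) (derivable_idc z))).
  by apply: ah; apply: cabs_mulrc_lt1; [exact: dilr_itv|exact: ltW].
have cu n : continuous (u n).
  exact: (continuous_cabs2 (continuous_circ (analytic_comp (ahn n) ss) s01)).
apply: (@rmean_fatou _ u) => //.
- exact: (continuous_cabs2 (continuous_circ ak s01)).
- by move=> n t; exact: sqr_ge0.
- move=> t; apply: cvg_cabs2; apply: cvgB; exact: dilate_cvg.
apply: filterS hB => n; apply: le_trans.
have rn := dilr_itv n.
pose k := fun z => h z - h (rc (dilr n) * a).
have akk : analytic_on_disk k by exact: analytic_subc.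
pose v t := cabs (circ k (dilr n) t) ^+ 2.
have cv : continuous v by exact: (continuous_cabs2 (continuous_circ akk rn)).
apply: (@le_trans _ _ (rmean (fun t => pint v (circ (sigma a) s t)))).
  apply: ler_rmean => //.
    by apply: continuous_pint_comp => //; exact: (continuous_circ (sigma_analytic a1) s01).
  by move=> t; exact: (jensen akk rn (pt1 t)).
by rewrite (pint_mean cv ss s01) sigma_zero.
Qed.

(* The left side is at most the value at [sigma a (rc r * a)] of a harmonic majorant of
   [|h \o sigma a - h a|^2], whence the Harnack factor. *)
Lemma hardy_le_mobius h a (B r : R) : analytic_on_disk h -> cabs a < 1 -> 0 <= r < 1 ->
  hardy_le (fun z => h (sigma a z) - h a) B ->
  rmean (fun t => cabs (circ h r t - h a) ^+ 2 * poisson a t) <=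
  (1 + cabs (sigma a (rc r * a))) / (1 - cabs (sigma a (rc r * a))) * B.
Proof.
move=> ah a1 r01 hB; set w := sigma a (rc r * a).
have ss := sigma_selfmap a1.
pose k := fun z => h (sigma a z) - h a.
have ak : analytic_on_disk k by exact: (analytic_subc _ (analytic_comp ah ss)).
have r0 : 0 <= r by case/andP: r01.
have cP := continuous_poisson a1.
have pt1 t : cabs (sigma a (rc r * expi t)) < 1.
  by apply: sigma_disk => //; rewrite cabs_circ//; case/andP: r01.
have w1 : cabs w < 1 by apply: sigma_disk => //; apply: cabs_mulrc_lt1 => //; exact: ltW.
pose u n t := cabs (k (rc (dilr n) * sigma a (rc r * expi t))) ^+ 2 * poisson a t.
have akn n : analytic_on_disk (fun z => k (rc (dilr n) * z)).
  move=> z z1.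
  apply: (derivable_compc (derivableMc (derivable_cstc z _) (derivable_idc z))).
  by apply: ak; apply: cabs_mulrc_lt1; [exact: dilr_itv|exact: ltW].
have cu n : continuous (fun t => cabs (k (rc (dilr n) * sigma a (rc r * expi t))) ^+ 2).
  exact: (continuous_cabs2 (continuous_circ (analytic_comp (akn n) ss) r01)).
apply: (@rmean_fatou _ u).
- by move=> n; exact: (continuousM_real (cu n) cP).
- exact: (continuousM_real (continuous_cabs2 (continuous_circ (analytic_subc (h a) ah) r01)) cP).
- by move=> n t; rewrite mulr_ge0 ?sqr_ge0// ltW// poisson_gt0.
- move=> t; apply: cvgM; last exact: cvg_cst.
  have := @cvg_cabs2 R _ _ _ _ _ (dilate_cvg ak (pt1 t)).
  have rt1 : cabs (rc r * expi t) < 1 by rewrite cabs_circ//; case/andP: r01.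
  have -> : k (sigma a (rc r * expi t)) = circ h r t - h a by rewrite /k sigmaK.
  exact.
apply: nearW => n; have rn := dilr_itv n.
pose v t := cabs (circ k (dilr n) t) ^+ 2.
have cv : continuous v by exact: (continuous_cabs2 (continuous_circ ak rn)).
have cpi : continuous (fun t => pint v (circ (sigma a) r t)).
  by apply: continuous_pint_comp => //; exact: (continuous_circ (sigma_analytic a1) r01).
apply: (@le_trans _ _ (rmean (fun t => pint v (circ (sigma a) r t) * poisson a t))).
  apply: ler_rmean.
  - exact: (continuousM_real (cu n) cP).
  - exact: (continuousM_real cpi cP).
  - move=> t; rewrite ler_wpM2r ?(ltW (poisson_gt0 _ _))//.
    exact: (jensen ak rn (pt1 t)).
rewrite (pint_harmonic cv ss r01 a1) -/w.
set C := _ / _; have C0 : 0 <= C.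
  by rewrite divr_ge0 ?subr_ge0 ?(ltW w1)// addr_ge0 ?cabs_ge0.
apply: (@le_trans _ _ (C * rmean v)); last by rewrite ler_wpM2l//; exact: hB.
rewrite -(rmeanZ C cv); apply: ler_rmean.
- exact: (continuousM_real cv (continuous_poisson w1)).
- exact: (continuousZ_real (x := C) cv).
- by move=> t; rewrite mulrC ler_wpM2r ?sqr_ge0// poisson_le.
Qed.

Definition sqcirc g r t : R := cabs (circ g r t) ^+ 2.

Lemma Re_ker1 w t : complex.Re (kerpoly w 1 t) = 1 + 2 * complex.Re (w * conjz (expi t)).
Proof.
have two : (2 : cplx R) = rc 2 by rewrite rcD.
by rewrite /kerpoly big_ord1 expr1 two cReD cReM [complex.Im (rc 2)]/= mul0r subr0.
Qed.

(* Subtracting from the harmonic majorant [pint v] its Taylor polynomial of order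
   [1] at [0] leaves a harmonic function vanishing at [0] that still dominates
   [|g|^2 - 20 m |w|^2]. *)
Lemma quadratic_majorant g r w : analytic_on_disk g -> g 0 = 0 -> 0 <= r < 1 -> cabs w < 1 ->
  cabs (g (rc r * w)) ^+ 2 <= pint (sqcirc g r) w - polint (sqcirc g r) 1 w +
    20 * rmean (sqcirc g r) * cabs w ^+ 2.
Proof.
move=> ag g0 r01 w1; set v := sqcirc g r; have cg := continuous_circ ag r01.
have cv : continuous v by exact: (continuous_cabs2 cg).
have v0 t : 0 <= v t by exact: sqr_ge0.
have m0 : 0 <= rmean v by exact: rmean_ge0.
have vn : rmean (fun t => `|v t|) = rmean v by apply: eq_rmean => t; rewrite ger0_norm.
have cw := cabs_ge0 w.
(* Far from [0] the removed polynomial is at most [(1 + 2 * cabs w)] times the mean, which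
   [20 * cabs w ^+ 2] absorbs. *)
have [wge|wlt] := leP 2^-1 (cabs w).
  have h1 := jensen ag r01 w1.
  have h2 : polint v 1 w <= (1 + 2 * cabs w) * rmean v.
    rewrite -(rmeanZ (1 + 2 * cabs w) cv); apply: ler_rmean.
    - exact: continuous_kerpolyRe.
    - exact: (continuousZ_real (x := 1 + 2 * cabs w) cv).
    move=> t; rewrite Re_ker1 mulrC ler_wpM2r// lerD2l ler_pM2l//.
    apply: le_trans (ler_norm _) _; apply: (le_trans (cabs_Re _)).
    by rewrite cabs_ker_arg.
  apply: (le_trans h1); rewrite -/v -addrA lerDl addrC subr_ge0.
  apply: (le_trans h2); rewrite mulrAC ler_wpM2r//.
  nra.
have h1 := pint_polint 1 cv w1.
have e1 : kererr (cabs w) 1 <= 4 * cabs w ^+ 2.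
  rewrite /kererr ler_pdivrMr ?subr_gt0//; nra.
have e0 : kererr (cabs w) 0 <= 4 * cabs w.
  rewrite /kererr expr1 ler_pdivrMr ?subr_gt0//; nra.
have h2 : - (4 * cabs w ^+ 2 * rmean v) <= pint v w - polint v 1 w.
  move: h1; rewrite vn ler_norml => /andP[+ _]; apply: le_trans.
  by rewrite lerN2 ler_wpM2r.
(* Since [g 0 = 0], the kernel may be replaced by [poisson w t - 1], which is at most [4 * cabs w].
   With the [4] of [h2] this makes [20 = 16 + 4]. *)
have h3 : cabs (g (rc r * w)) ^+ 2 <= 16 * cabs w ^+ 2 * rmean v.
  have cP := continuous_poisson w1.
  have c1 : continuous (fun _ : R => 1 : R) by move=> t; exact: cvg_cst.
  have -> : g (rc r * w) = cmean (fun t => circ g r t * rc (poisson w t - 1)).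
    rewrite -(poisson_formula ag r01 w1) -[LHS]subr0 -g0 -(mean_value ag r01).
    rewrite -(cmeanB (continuousMrc cg cP) cg); apply: cmean_eq => t.
    by rewrite rcD rcN mulrDr mulrN mulr1.
  have := @cabs_cmean_small R _ (fun t => poisson w t - 1) (4 * cabs w) cg (continuousB_real cP c1).
  rewrite -/v (_ : (4 * cabs w) ^+ 2 = 16 * cabs w ^+ 2); last by ring.
  apply; last by rewrite mulr_ge0.
  move=> t; have := poisson_kerpoly 0 t w1; rewrite /kerpoly big_ord0 mulr0 addr0 /=.
  by move=> /le_trans; apply.
move: h2 h3; move: (pint v w - polint v 1 w) => L; nra.
Qed.

(** The majorant requires continuous data on a circle, so it is applied to the dilates of [g], and
    Fatou's lemma recovers [g]. Both harmonic parts have along [psi] the mean of [v], their value at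
    [psi 0 = 0], and cancel. *)
Lemma hardy_le_comp g psi B B' : analytic_on_disk g -> g 0 = 0 ->
  selfmap psi -> psi 0 = 0 -> hardy_le g B -> hardy_le psi B' ->
  hardy_le (fun z => g (psi z)) (20 * B * B').
Proof.
move=> ag g0 sp p0 gB pB' s s01; have ap := sp.1.
have pt1 t : cabs (circ psi s t) < 1 by apply: sp.2; rewrite cabs_circ//; case/andP: s01.
have cp := continuous_circ ap s01.
pose u n t := cabs (g (rc (dilr n) * circ psi s t)) ^+ 2.
have agn n : analytic_on_disk (fun z => g (rc (dilr n) * z)).
  move=> z z1.
  apply: (derivable_compc (derivableMc (derivable_cstc z _) (derivable_idc z))).
  by apply: ag; apply: cabs_mulrc_lt1; [exact: dilr_itv|exact: ltW].
have cu n : continuous (u n).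
  exact: (continuous_cabs2 (continuous_circ (analytic_comp (agn n) sp) s01)).
apply: (@rmean_fatou _ u) => //.
- exact: (continuous_cabs2 (continuous_circ (analytic_comp ag sp) s01)).
- by move=> n t; exact: sqr_ge0.
- by move=> t; apply: cvg_cabs2; exact: dilate_cvg.
apply: nearW => n; have rn := dilr_itv n.
pose v := sqcirc g (dilr n).
have cv : continuous v by exact: (continuous_cabs2 (continuous_circ ag rn)).
have cpi : continuous (fun t => pint v (circ psi s t)) by exact: continuous_pint_comp.
have am : analytic_on_disk (fun z => mpol v 1 (psi z)).
  by move=> z z1; exact: (derivable_compc (ap z z1) (@derivable_mpol R v 1 (psi z))).
have cm : continuous (fun t => polint v 1 (circ psi s t)).
  have := continuous_Re (continuous_circ am s01).
  by under eq_fun do rewrite /circ Re_mpol//.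
have cp2 := continuous_cabs2 cp.
have cZ := continuousZ_real (x := 20 * rmean v) cp2.
have m0 : 0 <= rmean v by apply: rmean_ge0 => t; exact: sqr_ge0.
apply: (@le_trans _ _ (rmean (fun t => (pint v (circ psi s t) - polint v 1 (circ psi s t)) +
   20 * rmean v * cabs (circ psi s t) ^+ 2))).
  apply: ler_rmean => //.
    exact: (continuousD_real (continuousB_real cpi cm) cZ).
  by move=> t; exact: (quadratic_majorant ag g0 rn (pt1 t)).
rewrite (rmeanD (continuousB_real cpi cm) cZ) (rmeanB cpi cm) (rmeanZ (20 * rmean v) cp2).
have z1 : cabs (0 : cplx R) < 1 by rewrite cabs0.
have e1 : rmean (fun t => polint v 1 (circ psi s t)) = rmean v.
  transitivity (complex.Re (cmean (circ (fun z => mpol v 1 (psi z)) s))).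
    by apply: eq_rmean => t; rewrite /circ Re_mpol.
  by rewrite (mean_value am s01) p0 /mpol big_ord1 expr1 mulr0 addr0.
have e2 : rmean (fun t => pint v (circ psi s t)) = rmean v.
  rewrite (pint_mean cv sp s01) p0; apply: eq_rmean => t.
  by rewrite /poisson mul0r subr0 cabs1 cabs0 expr0n expr1n subr0 divr1 mulr1.
rewrite e1 e2 subrr add0r; apply: ler_pM.
- exact: (mulr_ge0 (ler0n R 20) m0).
- by apply: rmean_ge0 => t; exact: sqr_ge0.
- by rewrite ler_pM2l//; exact: gB.
- exact: pB'.
Qed.

End HardyEstimates.

(** * Elementary bounds on sine, cosine and the Poisson kernel *)

Section TrigBounds.
Variable R : realType.
Implicit Types (x s t : R).

Lemma ge0_of_derive (f df : R -> R) x : (forall y : R, is_derive y 1 f (df y)) ->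
  f 0 = 0 -> (forall y, 0 <= y -> 0 <= df y) -> 0 <= x -> 0 <= f x.
Proof.
move=> fd f0 df0 x0.
have cf : {within `[0, x], continuous f}.
  apply: continuous_subspaceT => y; apply: differentiable_continuous.
  by apply/derivable1_diffP; case: (fd y).
have [c hc] := @MVT_segment R f df 0 x x0 (fun y _ => fd y) cf.
rewrite f0 !subr0 => ->; rewrite mulr_ge0//; apply: df0.
by move: hc; rewrite in_itv /= => /andP[].
Qed.

Lemma sin_le_id x : 0 <= x -> sin x <= x.
Proof.
move=> x0; rewrite -subr_ge0.
apply: (@ge0_of_derive (fun y => y - sin y) (fun y => 1 - cos y)) => //.
by rewrite sin0 subr0.
Qed.

Lemma cos_ge_quad x : 0 <= x -> 1 - x ^+ 2 / 2 <= cos x.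
Proof.
move=> x0; rewrite -subr_ge0.
apply: (@ge0_of_derive (fun y => cos y - (1 - y ^+ 2 / 2)) (fun y => y - sin y)) => //.
- move=> y; apply: is_derive_eq.
  by rewrite /GRing.scale /= ; field.
- by rewrite cos0 expr0n mul0r subr0 subrr.
- by move=> y y0; rewrite subr_ge0 sin_le_id.
Qed.

Lemma sin_ge_cubic x : 0 <= x -> x - x ^+ 3 / 6 <= sin x.
Proof.
move=> x0; rewrite -subr_ge0.
apply: (@ge0_of_derive (fun y => sin y - (y - y ^+ 3 / 6)) (fun y => cos y - (1 - y ^+ 2 / 2))) => //.
- move=> y; apply: is_derive_eq.
  by rewrite /GRing.scale /= ; field.
- by rewrite sin0 expr0n mul0r subr0 subrr.
- by move=> y y0; rewrite subr_ge0 cos_ge_quad.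
Qed.

Lemma pi_lt4 : pi < 4 :> R.
Proof. by have /andP[_] := @pihalf_02 R; rewrite ltr_pdivrMr// -natrM. Qed.

Lemma one_sub_cos_le x : 1 - cos x <= x ^+ 2 / 2.
Proof.
wlog x0 : x / 0 <= x => [H|].
  by have [/H//|/ltW] := leP 0 x; rewrite -oppr_ge0 => /H; rewrite cosN sqrrN.
by have := cos_ge_quad x0; lra.
Qed.

(** With [y = x / 2] one has [1 - cos x = 2 * sin y ^+ 2], and the cubic bound gives
    [sin y >= y / 3] for [0 <= y <= 2]. *)
Lemma one_sub_cos_ge x : `|x| <= pi -> x ^+ 2 / 18 <= 1 - cos x.
Proof.
wlog x0 : x / 0 <= x => [H|].
  by have [/H//|/ltW] := leP 0 x; rewrite -oppr_ge0 => /H; rewrite normrN cosN sqrrN.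
rewrite ger0_norm// => xpi.
pose y := x / 2; have y0 : 0 <= y by rewrite divr_ge0.
have y2 : y <= 2 by rewrite /y; have := pi_lt4; lra.
have h := sin_ge_cubic y0.
have h2 : y / 3 <= sin y.
  apply: le_trans h; rewrite -subr_ge0.
  have -> : y - y ^+ 3 / 6 - y / 3 = y * (4 - y ^+ 2) / 6 by field.
  by rewrite divr_ge0// mulr_ge0//; nra.
have -> : 1 - cos x = 2 * sin y ^+ 2.
  have -> : x = y + y by rewrite /y; field.
  by rewrite cosD -!expr2; have := cos2Dsin2 y; lra.
have -> : x = 2 * y by rewrite /y; field.
nra.
Qed.

End TrigBounds.

Section KernelBounds.
Variable R : realType.
Implicit Types (x s t d : R) (a : cplx R).

Lemma poisson_polar r x t : 0 <= r ->
  poisson (rc r * expi x) t = (1 - r ^+ 2) / ((1 - r) ^+ 2 + 2 * r * (1 - cos (x - t))).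
Proof.
move=> r0; rewrite /poisson cabs_circ// conj_expi -mulrA -expiD; congr (_ / _).
rewrite cabs2 cReD cImD cReN cImN cReM cImM /=.
have := cos2Dsin2 (x - t); move: (cos _) (sin _) => C S h.
transitivity (1 - 2 * r * C + r ^+ 2 * (C ^+ 2 + S ^+ 2)); first by ring.
by rewrite h; ring.
Qed.

Lemma poisson_ge_center r x t : 0 <= r < 1 ->
  (1 - r) / ((1 - r) ^+ 2 + (t - x) ^+ 2) <= poisson (rc r * expi x) t.
Proof.
move=> /andP[r0 r1]; rewrite poisson_polar//.
have d0 : 0 < 1 - r by rewrite subr_gt0.
have c0 : 0 <= 1 - cos (x - t) by rewrite subr_ge0 cos_le1.
have c1 := one_sub_cos_le (x - t).
have p0 : 0 < (1 - r) ^+ 2 + 2 * r * (1 - cos (x - t)).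
  by rewrite ltr_wpDr ?exprn_gt0// !mulr_ge0.
apply: ler_pM.
- exact: ltW.
- by rewrite invr_ge0 addr_ge0 ?sqr_ge0.
- nra.
- rewrite lef_pV2 ?posrE//; last by rewrite ltr_wpDr ?exprn_gt0 ?sqr_ge0.
  rewrite lerD2l (_ : (t - x) ^+ 2 = (x - t) ^+ 2); last by ring.
  nra.
Qed.

Lemma poisson_le_center r x t : 0 <= r < 1 -> `|t - x| <= pi ->
  poisson (rc r * expi x) t <= 130 * ((1 - r) / ((1 - r) ^+ 2 + (t - x) ^+ 2)).
Proof.
move=> /andP[r0 r1] tx; rewrite poisson_polar//.
have d0 : 0 < 1 - r by rewrite subr_gt0.
have c1 : (x - t) ^+ 2 / 18 <= 1 - cos (x - t).
  by apply: one_sub_cos_ge; rewrite -opprB normrN.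
have c0 : 0 <= 1 - cos (x - t) by rewrite subr_ge0 cos_le1.
have p0 : 0 < (1 - r) ^+ 2 + 2 * r * (1 - cos (x - t)).
  by rewrite ltr_wpDr ?exprn_gt0// !mulr_ge0.
have q0 : 0 < (1 - r) ^+ 2 + (t - x) ^+ 2 by rewrite ltr_wpDr ?exprn_gt0 ?sqr_ge0.
have sx : (t - x) ^+ 2 = (x - t) ^+ 2 by ring.
have s16 : (x - t) ^+ 2 <= 16.
  have := le_trans tx (ltW (pi_lt4 R)); rewrite -opprB normrN => h.
  rewrite -real_normK ?num_real// (_ : 16 = 4 ^+ 2); last by ring.
  by rewrite ler_sqr ?nnegrE.
(* If [r >= 1 / 2] the cosine bound controls [(x - t) ^+ 2] with factor [18]. Otherwise
   [(1 - r) ^+ 2 > 1 / 4], so [16 <= 64 * (1 - r) ^+ 2]. *)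
have key : (1 - r) ^+ 2 + (t - x) ^+ 2 <= 65 * ((1 - r) ^+ 2 + 2 * r * (1 - cos (x - t))).
  rewrite sx; move: (x - t) c1 c0 s16 => y c1 c0 s16.
  have [rl|rl] := leP 2^-1 r; nra.
rewrite mulrA ler_pdivrMr// mulrAC ler_pdivlMr//.
move: key; set P := (1 - r) ^+ 2 + 2 * r * _; set Q := _ + (t - x) ^+ 2 => key.
have h2 : 1 - r ^+ 2 <= 2 * (1 - r) by nra.
have h3 : 0 <= 1 - r ^+ 2 by nra.
apply: (le_trans (ler_pM h3 (ltW q0) h2 key)).
by rewrite le_eqVlt; apply/orP; left; apply/eqP; ring.
Qed.

(** Chosen so that [K] doublings give half-length exactly [pi], that is, the full circle. *)
Definition dyadic K : R := pi / 2 ^+ K.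

Lemma dyadic_gt0 K : 0 < dyadic K.
Proof. by rewrite divr_gt0 ?pi_gt0// exprn_gt0. Qed.

Lemma dyadicS K : 2 * dyadic K.+1 = dyadic K.
Proof. by rewrite /dyadic exprS invfM mulrCA mulVKf. Qed.

Lemma dyadic0 : dyadic 0 = pi.
Proof. by rewrite /dyadic expr0 divr1. Qed.

Lemma ex_dyadic d : 0 < d <= 1 -> exists K, dyadic K <= d <= 2 * dyadic K.
Proof.
move=> /andP[d0 d1].
have ex : exists K, dyadic K <= d.
  have : dyadic K @[K --> \oo] --> (0 : R).
    rewrite -(mulr0 pi); apply: cvgM; first exact: cvg_cst.
    under eq_fun do rewrite -exprVn.
    by apply: cvg_expr; rewrite ger0_norm ?invr_ge0// invf_lt1// ltr1n.
  move=> /cvgrPdist_lt/(_ _ d0)[N _ hN]; exists N; apply: ltW.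
  have := hN N (leqnn N); rewrite sub0r normrN; apply: le_lt_trans; exact: ler_norm.
pose K := ex_minn ex; exists K; rewrite /K; case: ex_minnP => -[|m] hm mmin.
  by exfalso; move: hm; rewrite dyadic0 => /le_trans /(_ d1); have := pi_ge2 R; lra.
rewrite hm dyadicS /=; rewrite leNgt; apply/negP => h.
by have := mmin m (ltW h); rewrite ltnn.
Qed.

Lemma poisson_dyadic_center : exists2 C : R, 0 < C & forall r x t K,
  0 <= r < 1 -> `|t - x| <= pi -> dyadic K <= 1 - r <= 2 * dyadic K ->
  poisson (rc r * expi x) t <= C * (dyadic K / (dyadic K ^+ 2 + (t - x) ^+ 2)).
Proof.
exists (2 * 130) => [|r x t K r01 tx /andP[k1 k2]]; first by rewrite mulr_gt0 ?ltr0n.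
apply: (le_trans (poisson_le_center r01 tx)).
have K0 := dyadic_gt0 K; case/andP: r01 => r0 r1.
have q0 : 0 < (1 - r) ^+ 2 + (t - x) ^+ 2 by rewrite ltr_wpDr ?exprn_gt0 ?sqr_ge0// subr_gt0.
have q1 : 0 < dyadic K ^+ 2 + (t - x) ^+ 2 by rewrite ltr_wpDr ?exprn_gt0 ?sqr_ge0.
rewrite [2 * _]mulrC -mulrA [2 * _]mulrA.
apply: ler_wpM2l; first exact: ler0n.
apply: ler_pM => //.
- by rewrite subr_ge0 ltW.
- by rewrite invr_ge0 ltW.
- by rewrite lef_pV2 ?posrE// lerD2r ler_sqr ?nnegrE ?subr_ge0// ltW.
Qed.

(* [I k] is the arc of half-length [2 ^ k * dyadic K] around [x]; on [I k.+1]
   minus [I k] the kernel is at most a multiple of [4 ^ - k / dyadic K]. *)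
Lemma intg_poisson_dyadic : exists2 C : R, 0 < C & forall (v : R -> R) r x K k,
  continuous v -> (forall t, 0 <= v t) ->
  0 <= r < 1 -> dyadic K <= 1 - r <= 2 * dyadic K -> (k <= K)%N ->
  intg (x - 2 ^+ k * dyadic K) (x + 2 ^+ k * dyadic K)
     (fun t => v t * poisson (rc r * expi x) t) <=
  \sum_(j < k.+1) C / 4 ^+ j / dyadic K *
    intg (x - 2 ^+ j * dyadic K) (x + 2 ^+ j * dyadic K) v.
Proof.
have [C0 C00 hC] := poisson_dyadic_center.
(* A point of the ring of index [k.+1] has distance at least [2 ^ k * dyadic K] from [x]; the factor
   [4] turns the resulting [4 ^ - k] into [4 ^ - (k + 1)]. *)
exists (4 * C0) => [|v r x K k cv v0 r01 dK]; first by rewrite mulr_gt0.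
have x1 : cabs (rc r * expi x) < 1 by rewrite cabs_circ//; case/andP: r01.
have cP := continuous_poisson x1.
have cvP := continuousM_real cv cP.
have K0 := dyadic_gt0 K.
have rK k' : (k' <= K)%N -> 2 ^+ k' * dyadic K <= pi.
  move=> k'K; rewrite /dyadic mulrCA ger_pMr ?pi_gt0// ler_pdivrMr ?exprn_gt0// mul1r.
  by rewrite ler_eXn2l// ltr1n.
elim: k => [_|k IH kK].
  rewrite big_ord1 expr0 mul1r divr1 -intgZ//; apply: le_intg => //.
    exact: (continuousZ_real (x := (4 * C0) / dyadic K) cv).
  move=> t /andP[t1 t2]; rewrite mulrC ler_wpM2r//.
  have tx : `|t - x| <= dyadic K by rewrite ler_norml; apply/andP; split; lra.
  have := rK 0%N isT; rewrite expr0 mul1r => dpi.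
  apply: (le_trans (hC _ _ _ _ r01 (le_trans tx dpi) dK)).
  apply: (@le_trans _ _ (C0 * (dyadic K / (dyadic K ^+ 2)))).
    rewrite ler_pM2l// ler_pM2l// lef_pV2 ?posrE ?exprn_gt0//.
      by rewrite lerDl sqr_ge0.
    by rewrite ltr_wpDr ?exprn_gt0 ?sqr_ge0.
  have -> : dyadic K / dyadic K ^+ 2 = (dyadic K)^-1 by field; rewrite gt_eqF.
  by rewrite ler_wpM2r ?invr_ge0 ?(ltW K0)// ler_peMl ?(ltW C00)// ler1n.
have e2 : (2 : R) ^+ k.+1 = 2 * 2 ^+ k by rewrite exprS.
set A := 2 ^+ k * dyadic K; have A0 : 0 < A by rewrite mulr_gt0// exprn_gt0.
have AE : 2 ^+ k.+1 * dyadic K = 2 * A by rewrite e2 /A mulrA.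
rewrite big_ord_recr /=; move: (IH (ltnW kK)); rewrite -/A AE => IH'.
rewrite (@intg_cat _ _ (x - A))//; [|lra|lra].
rewrite (@intg_cat _ (x - A) (x + A))//; [|lra|lra].
set c := (4 * C0) / 4 ^+ k.+1 / dyadic K.
have c0 : 0 <= c.
  by rewrite /c !mulr_ge0 ?invr_ge0 ?exprn_ge0 ?(ltW K0) ?(ltW C00).
have out t : x - 2 * A <= t <= x + 2 * A -> A <= `|t - x| ->
    v t * poisson (rc r * expi x) t <= c * v t.
  move=> /andP[t1 t2] tA; rewrite mulrC ler_wpM2r//.
  have tx : `|t - x| <= 2 * A by rewrite ler_norml; apply/andP; split; lra.
  have tpi : `|t - x| <= pi by apply: (le_trans tx); rewrite -AE; exact: rK.
  apply: (le_trans (hC _ _ _ _ r01 tpi dK)).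
  apply: (@le_trans _ _ (C0 * (dyadic K / A ^+ 2))).
    rewrite ler_pM2l// ler_pM2l// lef_pV2 ?posrE ?exprn_gt0//; last first.
      by rewrite ltr_wpDr ?exprn_gt0 ?sqr_ge0.
    rewrite -[X in _ <= _ + X]real_normK ?num_real//.
    apply: (@le_trans _ _ (`|t - x| ^+ 2)); last by rewrite lerDr sqr_ge0.
    by rewrite ler_sqr ?nnegrE// ltW.
  have e4 : (2 ^+ k) ^+ 2 = 4 ^+ k :> R.
    by rewrite -exprM mulnC exprM; congr (_ ^+ _); ring.
  rewrite /c /A exprMn e4.
  rewrite le_eqVlt; apply/orP; left; apply/eqP.
  have k40 : (4 : R) ^+ k != 0 by rewrite expf_neq0.
  rewrite [4 ^+ k.+1]exprS; move: (4 ^+ k) k40 => q q0.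
  by field; rewrite q0 gt_eqF.
have b1 : intg (x - 2 * A) (x - A) (fun t => v t * poisson (rc r * expi x) t) <=
    c * intg (x - 2 * A) (x - A) v.
  rewrite -intgZ//; apply: le_intg => //; first exact: (continuousZ_real (x := c) cv).
  move=> t /andP[t1 t2]; apply: out; first by apply/andP; split; lra.
  by rewrite ler0_norm; lra.
have b2 : intg (x + A) (x + 2 * A) (fun t => v t * poisson (rc r * expi x) t) <=
    c * intg (x + A) (x + 2 * A) v.
  rewrite -intgZ//; apply: le_intg => //; first exact: (continuousZ_real (x := c) cv).
  move=> t /andP[t1 t2]; apply: out; first by apply/andP; split; lra.
  by rewrite ger0_norm; lra.
have b3 : 0 <= intg (x - A) (x + A) v by exact: intg_ge0.
have -> : intg (x - 2 * A) (x + 2 * A) v = intg (x - 2 * A) (x - A) v +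
    (intg (x - A) (x + A) v + intg (x + A) (x + 2 * A) v).
  rewrite (@intg_cat _ _ (x - A))//; [|lra|lra].
  by rewrite (@intg_cat _ (x - A) (x + A))//; lra.
move: b1 b2 b3 IH'; move: (intg (x - 2 * A) (x - A) v) (intg (x - A) (x + A) v)
  (intg (x + A) (x + 2 * A) v) => i1 i2 i3.
move: (intg _ _ _) (intg _ _ _) (intg _ _ _) (\sum_(i < _) _) => j1 j2 j3 S h1 h2 h3 h4.
have : 0 <= c * i2 by rewrite mulr_ge0.
lra.
Qed.

End KernelBounds.

(** * Approximation by dilates *)

Section Dilation.
Variable R : realType.
Implicit Types (a b z w c : cplx R) (f g h : cplx R -> cplx R) (r s t B e : R).

Lemma coef_sum_le h B N : analytic_on_disk h -> hardy_le h B ->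
  \sum_(n < N) cabs (coef h n) ^+ 2 <= B.
Proof.
move=> ah hB.
pose P (x : R) := \sum_(n < N) cabs (coef h n) ^+ 2 * x ^+ (2 * n).
have cP : continuous P.
  apply: (@continuous_bigsum _ _ N (fun n (x : R) => cabs (coef h n) ^+ 2 * x ^+ (2 * n))) => n.
  by apply: (@continuousZ_real R _ (fun x : R => x ^+ (2 * n))); exact: exprn_continuous.
have P1 : P 1 = \sum_(n < N) cabs (coef h n) ^+ 2.
  by apply: eq_bigr => n _; rewrite expr1n mulr1.
have hc : P (dilr R k) @[k --> \oo] --> P 1.
  exact: (cvg_comp _ _ (@dilr_cvg R) (cP 1)).
rewrite -P1 -(cvg_lim (@Rhausdorff R) hc).
apply: limr_le; first by apply/cvg_ex; exists (P 1).
apply: nearW => k; apply: le_trans (hB _ (dilr_itv R k)).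
exact: (bessel_coef N ah (dilr_itv R k)).
Qed.

Lemma analytic_dilate h r : analytic_on_disk h -> 0 <= r < 1 ->
  analytic_on_disk (fun z => h (rc r * z)).
Proof.
move=> ah r01 z z1.
apply: (derivable_compc (derivableMc (derivable_cstc z _) (derivable_idc z))).
by apply: ah; apply: cabs_mulrc_lt1 => //; exact: ltW.
Qed.

Lemma analytic_sub f g : analytic_on_disk f -> analytic_on_disk g ->
  analytic_on_disk (fun z => f z - g z).
Proof. by move=> af ag z z1; exact: (derivableBc (af z z1) (ag z z1)). Qed.

(** The difference has Taylor coefficients [coef h n * (1 - r ^+ n)]. Parseval's identity for the
    partial sums on a circle, followed by Fatou's lemma, bounds its means. *)
Lemma hardy_le_dilate h r e : analytic_on_disk h -> 0 <= r < 1 ->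
  (\forall N \near \oo, \sum_(n < N) cabs (coef h n) ^+ 2 * (1 - r ^+ n) ^+ 2 <= e) ->
  hardy_le (fun z => h z - h (rc r * z)) e.
Proof.
move=> ah r01 hN s s01; case/andP: (r01) => r0 r1; case/andP: (s01) => s0 s1.
pose a n := coef h n * rc (s ^+ n * (1 - r ^+ n)).
apply: (@rmean_fatou _ (fun N t => cabs (trigpoly a N t) ^+ 2)).
- by move=> N; exact: (continuous_cabs2 (@continuous_trigpoly R a N)).
- exact: (continuous_cabs2 (continuous_circ (analytic_sub ah (analytic_dilate ah r01)) s01)).
- by move=> N t; exact: sqr_ge0.
- move=> t; apply: cvg_cabs2.
  have z1 : cabs (rc s * expi t) < 1 by rewrite cabs_circ.
  have z2 : cabs (rc r * (rc s * expi t)) < 1 by apply: cabs_mulrc_lt1 => //; exact: ltW.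
  have eN N : trigpoly a N t = \sum_(n < N) coef h n * (rc s * expi t) ^+ n -
      \sum_(n < N) coef h n * (rc r * (rc s * expi t)) ^+ n.
    rewrite /trigpoly -sumrN -big_split /=; apply: eq_bigr => n _.
    rewrite /a rcM rcD rcN !rcX !exprMn (_ : rc 1 = 1)//.
    move: (coef h n) (rc s ^+ n) (rc r ^+ n) (expi t ^+ n) => x1 x2 x3 x4; ring.
  rewrite (funext eN).
  exact: (cvgB (taylor_cvg ah z1) (taylor_cvg ah z2)).
- apply: filterS hN => N; apply: le_trans; rewrite rmean_sqr_trigpoly.
  apply: ler_sum => n _; rewrite cabsM cabs_rc exprMn ler_wpM2l ?sqr_ge0//.
  have q0 : 0 <= 1 - r ^+ n by rewrite subr_ge0 exprn_ile1// ltW.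
  have p0 : 0 <= s ^+ n by rewrite exprn_ge0.
  rewrite ger0_norm ?mulr_ge0// ler_sqr ?nnegrE ?mulr_ge0//.
  by rewrite ler_piMl// exprn_ile1// ltW.
Qed.

(** The squared coefficients are summable: beyond some [N0] they contribute at most [e / 2] for
    every radius, and the first [N0] terms form a polynomial in the radius that vanishes at [1]. *)
Lemma dilate_small h B e : analytic_on_disk h -> hardy_le h B -> 0 < e ->
  \forall k \near \oo, hardy_le (fun z => h z - h (rc (dilr R k) * z)) e.
Proof.
move=> ah hB e0.
pose A N := \sum_(0 <= n < N) cabs (coef h n) ^+ 2.
have Am : {homo A : n m / (n <= m)%N >-> n <= m}.
  by apply/nondecreasing_seqP => n; rewrite /A big_nat_recr//= lerDl sqr_ge0.
have Ac : cvgn A.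
  apply: nondecreasing_is_cvgn => //; exists B => _ [n _ <-].
  by rewrite /A big_mkord; exact: coef_sum_le.
have e2 : 0 < e / 2 by rewrite divr_gt0.
have /cvgrPdist_lt/(_ _ e2)[N0 _ hN0] := Ac.
have hA N : (N0 <= N)%N -> A N - A N0 <= e / 2.
  move=> NN; have := hN0 N0 (leqnn N0) => /(le_lt_trans (ler_norm _))/ltW.
  by apply: le_trans; rewrite lerD2r; exact: nondecreasing_cvgn_le.
pose P (x : R) := \sum_(n < N0) cabs (coef h n) ^+ 2 * (1 - x ^+ n) ^+ 2.
have cP : continuous P.
  apply: (@continuous_bigsum _ _ N0 (fun n (x : R) => cabs (coef h n) ^+ 2 * (1 - x ^+ n) ^+ 2)) => n.
  apply: (@continuousZ_real R _ (fun x : R => (1 - x ^+ n) ^+ 2)) => x.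
  apply: (@continuous_comp _ _ _ (fun x : R => 1 - x ^+ n) (fun y : R => y ^+ 2)).
    by apply: cvgB; [exact: cvg_cst|exact: exprn_continuous].
  exact: exprn_continuous.
have P1 : P 1 = 0.
  by rewrite /P big1// => n _; rewrite expr1n subrr expr0n mulr0.
have hc : P (dilr R k) @[k --> \oo] --> P 1.
  exact: (cvg_comp _ _ (@dilr_cvg R) (cP 1)).
rewrite P1 in hc.
have := hc; move=> /cvgrPdist_lt/(_ _ e2); apply: filterS => k.
rewrite sub0r normrN => /(le_lt_trans (ler_norm _))/ltW hP.
apply: hardy_le_dilate => //; first exact: dilr_itv.
exists N0 => // N /= NN; set r := dilr R k in hP *.
have /andP[r0 r1] : 0 <= r < 1 := dilr_itv R k.
rewrite -(big_mkord predT (fun n => cabs (coef h n) ^+ 2 * (1 - r ^+ n) ^+ 2)).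
rewrite (@big_cat_nat _ _ _ N0)//= (splitr e); apply: lerD.
  by rewrite big_mkord.
apply: le_trans (hA _ NN); rewrite /A (@big_cat_nat _ _ _ N0 0 N)//= addrAC subrr add0r.
apply: ler_sum => n _; rewrite ler_piMr ?sqr_ge0//.
have q0 : 0 <= 1 - r ^+ n by rewrite subr_ge0 exprn_ile1// ltW.
by rewrite expr_le1// lerBlDr lerDl exprn_ge0.
Qed.

(** Circle means grow with the radius: the Poisson integral from the circle of radius [dilr n]
    majorises inside and has its mean as value at [0]. Hence circles near the boundary control all
    others. *)
Lemma hardy_le_near h B : analytic_on_disk h ->
  (\forall n \near \oo, rmean (sqcirc h (dilr R n)) <= B) -> hardy_le h B.
Proof.
move=> ah hB s s01; have s0 : 0 <= s by case/andP: s01.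
have is_id : selfmap (fun z : cplx R => z).
  by split=> [z _|z z1]; [exact: (derivable_idc z)|exact: z1].
have pt1 t : cabs (rc s * expi t) < 1 by rewrite cabs_circ//; case/andP: s01.
pose u n t := cabs (h (rc (dilr R n) * (rc s * expi t))) ^+ 2.
have cu n : continuous (u n).
  exact: (continuous_cabs2 (continuous_circ (analytic_dilate ah (dilr_itv R n)) s01)).
apply: (@rmean_fatou _ u) => //.
- exact: (continuous_cabs2 (continuous_circ ah s01)).
- by move=> n t; exact: sqr_ge0.
- by move=> t; apply: cvg_cabs2; exact: dilate_cvg.
apply: filterS hB => n; apply: le_trans; have rn := dilr_itv R n.
have cv : continuous (sqcirc h (dilr R n)) by exact: (continuous_cabs2 (continuous_circ ah rn)).
apply: (@le_trans _ _ (rmean (fun t => pint (sqcirc h (dilr R n)) (circ (fun z => z) s t)))).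
  apply: ler_rmean => //.
    by apply: continuous_pint_comp => //; exact: continuous_circ_pt.
  by move=> t; exact: (jensen ah rn (pt1 t)).
rewrite (pint_mean cv is_id s01) le_eqVlt; apply/orP; left; apply/eqP.
apply: eq_rmean => t.
by rewrite /poisson mul0r subr0 cabs1 cabs0 expr0n expr1n subr0 divr1 mulr1.
Qed.

End Dilation.

(** * Radial limits *)

Section Maximal.
Variable R : realType.
Implicit Types (x s t : R) (u v : R -> R).
Let mu := @lebesgue_measure R.

Lemma rmean_interval u x : continuous u -> (forall t, u (t + 2 * pi) = u t) ->
  rmean u = (2 * pi)^-1 * intg (x - pi) (x + pi) u.
Proof.
move=> cu pu; rewrite /rmean; congr (_ * _).
rewrite -{1}(add0r (2 * pi)) (@intg_period _ (2 * pi) u 0 (x - pi) cu (ltW (twopi_gt0 R)) pu).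
by congr (intg _ _ _); rewrite mulr_natl mulr2n addrA subrK.
Qed.

Lemma poisson_period (a : cplx R) t : poisson a (t + 2 * pi) = poisson a t.
Proof. by rewrite /poisson expi_period. Qed.

Lemma sum_half n : \sum_(j < n) (2^-1 : R) ^+ j <= 2.
Proof.
suff -> : \sum_(j < n) (2^-1 : R) ^+ j = 2 - 2 * 2^-1 ^+ n by rewrite gerBl mulr_ge0// exprn_ge0.
elim: n => [|n IH]; first by rewrite big_ord0 expr0; ring.
by rewrite big_ord_recr /= IH exprS; field.
Qed.

(** Kernel weights [4 ^ - j] against arc lengths of order [2 ^ j] leave a geometric series of sum at
    most [2]. The averages tested have radius at most [pi], one period. *)
Lemma pint_maximal : exists2 C : R, 0 < C & forall v x r M,
  continuous v -> (forall t, 0 <= v t) -> (forall t, v (t + 2 * pi) = v t) ->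
  0 <= r < 1 -> 0 <= M ->
  (forall e, 0 < e -> e <= pi -> intg (x - e) (x + e) v <= 2 * e * M) ->
  pint v (rc r * expi x) <= C * M.
Proof.
have [C C0 hC] := intg_poisson_dyadic R.
have tp := twopi_gt0 R.
exists ((2 * pi)^-1 * (4 * C)) => [|v x r M cv v0 pv r01 M0 hv].
  by rewrite mulr_gt0 ?invr_gt0// mulr_gt0.
have d01 : 0 < 1 - r <= 1.
  by case/andP: r01 => r0 r1; rewrite subr_gt0 r1 gerBl.
have [K hK] := ex_dyadic d01.
have x1 : cabs (rc r * expi x) < 1 by rewrite cabs_circ//; case/andP: r01.
have cvP := continuousM_real cv (continuous_poisson x1).
rewrite /pint (rmean_interval x cvP); last by move=> t; rewrite pv poisson_period.
rewrite -mulrA ler_pM2l ?invr_gt0//.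
have piE : 2 ^+ K * dyadic R K = pi by rewrite /dyadic mulrCA divff ?mulr1// expf_neq0.
have := hC v r x K K cv v0 r01 hK (leqnn K); rewrite piE => /le_trans; apply.
have D0 := dyadic_gt0 R K.
apply: (@le_trans _ _ (\sum_(j < K.+1) (2 * C * M) * 2^-1 ^+ j)).
  apply: ler_sum => j _.
  have e0 : 0 < 2 ^+ j * dyadic R K by rewrite mulr_gt0// exprn_gt0.
  have epi : 2 ^+ j * dyadic R K <= pi.
    by rewrite -piE ler_pM2r// ler_eXn2l ?ltr1n// -ltnS.
  apply: (@le_trans _ _ (C / 4 ^+ j / dyadic R K * (2 * (2 ^+ j * dyadic R K) * M))).
    apply: ler_wpM2l; last exact: hv.
    by rewrite !mulr_ge0 ?invr_ge0 ?exprn_ge0 ?(ltW C0) ?(ltW D0).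
  have e4 : 4 ^+ j = 2 ^+ j * 2 ^+ j :> R by rewrite -exprMn; congr (_ ^+ _); ring.
  rewrite e4 exprVn; have p0 : (2 : R) ^+ j != 0 by rewrite expf_neq0.
  move: (2 ^+ j) p0 => p p0; rewrite le_eqVlt; apply/orP; left; apply/eqP.
  by field; rewrite p0 gt_eqF.
rewrite -mulr_sumr; have hS := sum_half K.+1.
have a0 : 0 <= 2 * C * M by rewrite !mulr_ge0// ltW.
apply: (le_trans (ler_wpM2l a0 hS)).
by rewrite le_eqVlt; apply/orP; left; apply/eqP; ring.
Qed.

Lemma intg_periods v m : continuous v -> (forall t, v (t + 2 * pi) = v t) ->
  intg (- (m%:R * (2 * pi))) (m%:R * (2 * pi)) v = (2 * m)%:R * (2 * pi * rmean v).
Proof.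
move=> cv pv; have tp := twopi_gt0 R.
have one x : intg x (x + 2 * pi) v = 2 * pi * rmean v.
  rewrite (intg_period x 0 cv (ltW tp) pv) add0r /rmean mulrA divff ?mul1r//.
  by rewrite gt_eqF.
elim: m => [|m IH].
  rewrite mul0r oppr0 muln0 mul0r.
  by rewrite set_itv1 Rintegral_set1.
set p := 2 * pi in one tp IH *; have m0 : 0 <= m%:R * p by rewrite mulr_ge0// ltW.
have e1 : m.+1%:R * p = m%:R * p + p by rewrite -natr1 mulrDl mul1r.
rewrite e1 (@intg_cat _ _ (- (m%:R * p)))//; [|lra|lra].
rewrite (@intg_cat _ (- (m%:R * p)) (m%:R * p))//; [|lra|lra].
have := one (- (m%:R * p + p)); rewrite opprD addrNK => ->.
rewrite one IH; move: (rmean v) => x.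
by rewrite mulnS natrD; ring.
Qed.

Section Window.
Variables (v : R -> R) (m : nat).
Hypotheses (cv : continuous v) (v0 : forall t, 0 <= v t)
  (pv : forall t, v (t + 2 * pi) = v t).
Let T : R := m%:R * (2 * pi).
Let W : set R := `[- T, T]%classic.
(** A nonzero periodic function is not integrable on the line, so it is cut off to [m] periods on
    each side of [0] before the maximal inequality is applied. *)
Let f := v \_ W.

Let locf : locally_integrable setT f.
Proof.
apply: open_integrable_locally; first exact: openT.
have h := continuous_itvle_integrable (- T) T cv.
have := (@integrable_mkcond _ _ _ mu `[- T, T]%classic (EFin \o v) (measurable_itv _)).1 h.
by rewrite restrict_EFin.
Qed.

Lemma not_HL_intg x (l : R) : ~~ (l%:E < HL_maximal f x)%E ->
  forall e, 0 < e -> - T <= x - e -> x + e <= T -> intg (x - e) (x + e) v <= 2 * e * l.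
Proof.
rewrite -leNgt => hl e e0 xe1 xe2.
have : (iavg f (ball x e) <= l%:E)%E.
  apply: le_trans hl; apply: le_ereal_sup_tmp; exists (iavg f (ball x e)) => //=.
  by exists e => //; rewrite in_itv /= e0.
rewrite /iavg (lebesgue_measure_ball x (ltW e0)).
have e2 : 0 < e *+ 2 by rewrite mulrn_wgt0.
rewrite [X in (_ * X <= _)%E](_ : _ = (intg (x - e) (x + e) v)%:E); last first.
  have mv : measurable_fun `]x - e, x + e[ (EFin \o v).
    by apply/measurable_EFinP/measurable_funTS; exact: continuous_measurable_fun.
  rewrite intgE// ball_itv (@integral_itv_bndoo _ (x - e) (x + e) (EFin \o v) true false mv).
  apply: eq_integral => y; rewrite inE /= in_itv /= => /andP[y1 y2].
  rewrite /f patchE mem_set ?ger0_norm// /W /= in_itv /=.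
  by rewrite (le_trans xe1 (ltW y1)) (le_trans (ltW y2) xe2).
rewrite inver gt_eqF// -EFinM lee_fin mulrC ler_pdivrMr// => h.
by rewrite (_ : 2 * e * l = l * (e *+ 2))// -mulr_natl; ring.
Qed.

Lemma HL_measure (l : R) : 0 < l ->
  (mu [set x | (l%:E < HL_maximal f x)%E] <= (3 / l * ((2 * m)%:R * (2 * pi * rmean v)))%:E)%E.
Proof.
move=> l0; apply: (le_trans (maximal_inequality locf l0)).
rewrite [X in (_ <= X)%E]EFinM lee_wpmul2l ?lee_fin ?divr_ge0// ?(ltW l0)//.
rewrite -(intg_periods m cv pv) intgE// le_eqVlt; apply/orP; left; apply/eqP.
rewrite [RHS]integral_mkcond; apply: eq_integral => x _.
by rewrite /f !patchE; case: ifPn => _ /=; rewrite ?normr0// ger0_norm.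
Qed.

Lemma measurable_HL_set (l : R) : measurable [set x | (l%:E < HL_maximal f x)%E].
Proof.
rewrite -[X in measurable X]setTI; apply: emeasurable_fun_o_infty => //.
exact: measurable_HL_maximal.
Qed.

End Window.

End Maximal.

Section RadialLimits.
Variable R : realType.
Implicit Types (x s t B e l : R) (h D : cplx R -> cplx R).
Let mu := @lebesgue_measure R.

(** Shorter by [pi] at each end than the interval of the cut-off, so that averages of radius at most
    [pi] about its points do not see the cut. *)
Definition window (m : nat) : set R := `](pi - m%:R * (2 * pi)), (m%:R * (2 * pi) - pi)[%classic.

Definition bad_radial D m l : set R := window m `&`
  [set x | exists2 r : R, 0 <= r < 1 & l < cabs (D (rc r * expi x)) ^+ 2].

(** The same set for a dilate of [D], which is controlled by a Poisson integral of continuous data.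
    These sets are open and increase with [n] to [bad_radial D m l]. *)
Definition bad_radial_n D m l n : set R := window m `&`
  [set x | exists2 r : R, 0 <= r < 1 & l < cabs (D (rc (dilr R n) * (rc r * expi x))) ^+ 2].

Lemma open_level h r l : analytic_on_disk h -> 0 <= r < 1 ->
  open [set x : R | l < cabs (h (rc r * expi x)) ^+ 2].
Proof.
move=> ah r01; have c := continuous_cabs2 (continuous_circ ah r01).
exact: (@open_comp _ _ (fun x : R => cabs (circ h r x) ^+ 2) _ (fun x _ => c x) (@open_gt R l)).
Qed.

Lemma open_window m : open (window m).
Proof. exact: interval_open. Qed.

Lemma dilr_gt0 n : 0 < dilr R n.
Proof. by rewrite /dilr subr_gt0 invf_lt1 ?ltr0n// ltr1n. Qed.

Lemma dilr_le n : dilr R n <= dilr R n.+1.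
Proof. by rewrite /dilr lerD2l lerN2 lef_pV2 ?posrE ?ltr0n// ler_nat. Qed.

Lemma bad_radial_nS D m l n : bad_radial_n D m l n `<=` bad_radial_n D m l n.+1.
Proof.
move=> x [wx [r r01 lr]]; split=> //.
have q0 := dilr_gt0 n.+1; have q := dilr_le n.
exists (dilr R n / dilr R n.+1 * r); last first.
  by rewrite mulrA -rcM mulrA mulrCA divff ?gt_eqF// mulr1 rcM -mulrA.
have q1 : dilr R n / dilr R n.+1 <= 1 by rewrite ler_pdivrMr// mul1r.
have q2 : 0 <= dilr R n / dilr R n.+1 by rewrite divr_ge0// ltW// dilr_gt0.
case/andP: r01 => r0 r1; rewrite mulr_ge0//= (le_lt_trans _ r1)//.
by rewrite ler_piMl.
Qed.

Lemma bad_radialE D m l : bad_radial D m l = \bigcup_n bad_radial_n D m l n.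
Proof.
apply/seteqP; split => x /=.
  move=> [wx [r /andP[r0 r1] lr]].
  have [n hn] : exists n, r < dilr R n.
    have r10 : 0 < 1 - r by rewrite subr_gt0.
    have hc := @dilr_cvg R; move/cvgrPdist_lt: hc => /(_ _ r10)[N _ hN]; exists N.
    have := hN N (leqnn N) => /(le_lt_trans (ler_norm _)); lra.
  exists n => //; split => //; have q0 := dilr_gt0 n.
  exists (r / dilr R n); first by rewrite divr_ge0// ?(ltW q0)//= ltr_pdivrMr// mul1r.
  by rewrite mulrA -rcM mulrCA divff ?gt_eqF// mulr1.
move=> [n _ [wx [r r01 lr]]]; split=> //.
have := dilr_itv R n => /andP[q0 q1]; case/andP: r01 => r0 r1.
exists (dilr R n * r); last by rewrite rcM -mulrA.
by rewrite mulr_ge0//= -[X in _ < X]mulr1 ltr_pM.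
Qed.

Lemma measurable_bad_radial_n D m l n : analytic_on_disk D ->
  measurable (bad_radial_n D m l n).
Proof.
move=> aD; apply: open_measurable; apply: openI; first exact: open_window.
have -> : [set x : R | exists2 r : R, 0 <= r < 1 & l < cabs (D (rc (dilr R n) * (rc r * expi x))) ^+ 2] =
  \bigcup_(r in [set r : R | 0 <= r < 1])
    [set x | l < cabs (D (rc (dilr R n) * (rc r * expi x))) ^+ 2].
  by apply/seteqP; split => x /= [r r1 lr]; exists r.
apply: bigcup_open => r /= r01.
exact: (@open_level (fun z => D (rc (dilr R n) * z)) r l (analytic_dilate aD (dilr_itv R n)) r01).
Qed.

Lemma measurable_bad_radial D m l : analytic_on_disk D -> measurable (bad_radial D m l).
Proof.
by move=> aD; rewrite bad_radialE; apply: bigcup_measurable => n _; exact: measurable_bad_radial_n.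
Qed.

(** A weak-type bound: Jensen's inequality and [pint_maximal] bound [|D|^2] along a radius by
    averages about its end point, so the bad set lies in a level set of the Hardy-Littlewood maximal
    function. *)
Lemma bad_radial_measure : exists2 C : R, 0 < C & forall D B m l,
  analytic_on_disk D -> hardy_le D B -> 0 < l ->
  (mu (bad_radial D m (C * l)) <= (3 / l * ((2 * m)%:R * (2 * pi * B)))%:E)%E.
Proof.
have [C C0 hC] := pint_maximal R; exists C => // D B m l aD hB l0.
have mn n := @measurable_bad_radial_n D m (C * l) n aD.
have hcvg : (mu \o bad_radial_n D m (C * l)) n @[n --> \oo] --> mu (bad_radial D m (C * l)).
  rewrite bad_radialE; apply: nondecreasing_cvg_mu => //.
    by apply: bigcup_measurable => n _; exact: mn.
  by apply/nondecreasing_seqP => n; apply/subsetPset; exact: bad_radial_nS.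
rewrite -(cvg_lim (@ereal_hausdorff R) hcvg).
apply: lime_le; first by apply/cvg_ex; eexists; exact: hcvg.
apply: nearW => n /=; have rn := dilr_itv R n.
pose v := sqcirc D (dilr R n).
have cv : continuous v by exact: (continuous_cabs2 (continuous_circ aD rn)).
have v0 t : 0 <= v t by exact: sqr_ge0.
have pv t : v (t + 2 * pi) = v t by rewrite /v /sqcirc circ_period.
have tp := twopi_gt0 R.
apply: (@le_trans _ _ (mu [set x | (l%:E < HL_maximal (v \_ `[(- (m%:R * (2 * pi)))%R, (m%:R * (2 * pi))%R]) x)%E])).
  apply: le_measure; [by rewrite inE; exact: mn|by rewrite inE; exact: (measurable_HL_set m cv l)|].
  move=> x [wx [r r01 lr]] /=.
  apply: contraTT lr => nh; rewrite -leNgt.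
  have w1 : cabs (rc r * expi x) < 1 by rewrite cabs_circ//; case/andP: r01.
  apply: (le_trans (jensen aD rn w1)).
  apply: hC => //; first exact: ltW.
  move=> e e0 epi; apply: (not_HL_intg cv v0 nh e0).
    by move: wx; rewrite /window /= in_itv /= => /andP[w2 _]; lra.
  by move: wx; rewrite /window /= in_itv /= => /andP[_ w2]; lra.
apply: (le_trans (HL_measure m cv v0 pv l0)); rewrite lee_fin.
rewrite ler_wpM2l ?divr_ge0 ?(ltW l0)// ler_wpM2l// ler_wpM2l ?(ltW tp)//.
exact: hB.
Qed.

End RadialLimits.

Section RadialTheorem.
Variable R : realType.
Implicit Types (x r s t B e l : R) (h D : cplx R -> cplx R).
Let mu := @lebesgue_measure R.

Definition oscillating h m l : set R := window m `&`
  [set x | forall r0 : R, 0 <= r0 < 1 -> exists r, exists s, [/\ r0 < r < 1, r0 < s < 1 &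
     l < cabs (h (rc r * expi x) - h (rc s * expi x)) ^+ 2]].

Lemma cabs_sqrD (z w : cplx R) : cabs (z + w) ^+ 2 <= 2 * cabs z ^+ 2 + 2 * cabs w ^+ 2.
Proof.
have := cabsD z w; have := cabs_ge0 z; have := cabs_ge0 w; have := cabs_ge0 (z + w).
move: (cabs (z + w)) (cabs z) (cabs w) => a b c a0 c0 b0 h.
have h2 : a ^+ 2 <= (b + c) ^+ 2 by rewrite ler_sqr ?nnegrE// addr_ge0.
by apply: (le_trans h2); have := sqr_ge0 (b - c); rewrite !sqrrD sqrrN; nra.
Qed.

(** The dilate of [h] is continuous up to the circle, so near [1] only the difference can oscillate.
    Splitting into four terms with squares at most [l] costs the factor [16]. *)
Lemma oscillating_sub h m l k : analytic_on_disk h -> 0 < l ->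
  oscillating h m (16 * l) `<=` bad_radial (fun z => h z - h (rc (dilr R k) * z)) m l.
Proof.
move=> ah l0 x [wx osc]; split=> //; apply: contrapT => nb.
have small r : 0 <= r < 1 ->
    cabs (h (rc r * expi x) - h (rc (dilr R k) * (rc r * expi x))) ^+ 2 <= l.
  by move=> r01; rewrite leNgt; apply/negP => lr; apply: nb; exists r.
have [q0 q1] := andP (dilr_itv R k).
have w1 : cabs (rc (dilr R k) * expi x) < 1 by rewrite cabs_circ.
have /derivable_continuous hc := ah _ w1.
set w := rc (dilr R k) * expi x in w1 hc.
have hcm : h (rc r * w) @[r --> (1 : R)] --> h w.
  apply: (@cvg_comp _ _ _ (fun r : R => rc r * w) h _ (nbhs w)); last exact: hc.
  have e1 : rc 1 * w = w by exact: mul1r.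
  have : rc r * w @[r --> (1 : R)] --> rc 1 * w.
    apply: cvgM; last exact: cvg_cst.
    by apply: (@continuous_rc R (fun r : R => r)) => y; exact: cvg_id.
  by rewrite e1.
have hc2 : cabs (h (rc r * w) - h w) ^+ 2 @[r --> (1 : R)] --> (0 : R).
  have := @cvg_cabs2 R _ _ (nbhs_filter (1 : R)) _ _ (cvgB hcm (cvg_cst (h w))).
  have e0 : cabs (h w - h w) ^+ 2 = 0 by rewrite subrr cabs0 expr0n.
  by rewrite e0; exact.
move/cvgrPdist_lt : hc2 => /(_ _ l0)/nbhs_ballP[d /= d0 hd].
have near1 r : Num.max 0 (1 - d) < r < 1 -> 0 <= r < 1 /\ cabs (h (rc r * w) - h w) ^+ 2 < l.
  rewrite gt_max => /andP[/andP[r0 rd] r1]; split; first by rewrite ltW.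
  have := hd r; rewrite /ball /= sub0r normrN => hh.
  by apply: le_lt_trans (ler_norm _) (hh _); rewrite ltr_norml; apply/andP; split; lra.
have r0E : 0 <= Num.max 0 (1 - d) < 1.
  by rewrite le_max lexx /= gt_max ltr01 /= ltrBlDr ltrDl.
have [r [s [hr hs]]] := osc _ r0E.
have [r01 ar] := near1 _ hr; have [s01 as_] := near1 _ hs.
have br := small _ r01; have bs := small _ s01.
rewrite mulrCA -/w in br; rewrite mulrCA -/w in bs.
set A := h (rc r * expi x) in br *; set A' := h (rc s * expi x) in bs *.
set E := h (rc r * w) in br ar; set E' := h (rc s * w) in bs as_.
have -> : A - A' = ((A - E) + (- (A' - E'))) + ((E - h w) + (- (E' - h w))) by ring.
have i1 := cabs_sqrD ((A - E) + (- (A' - E'))) ((E - h w) + (- (E' - h w))).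
have i2 := cabs_sqrD (A - E) (- (A' - E')).
have i3 := cabs_sqrD (E - h w) (- (E' - h w)).
rewrite !cabsN in i2 i3 => i4.
have := lt_le_trans i4 i1; lra.
Qed.

(** By [dilate_small] the differences have arbitrarily small Hardy norm, and the weak-type bound
    then makes the covering bad sets arbitrarily small. *)
Lemma oscillating_null h B m l : analytic_on_disk h -> hardy_le h B -> 0 < l ->
  mu.-negligible (oscillating h m l).
Proof.
move=> ah hB l0; have [C C0 hC] := bad_radial_measure R.
pose l' := l / 16 / C; have l'0 : 0 < l' by rewrite !divr_gt0.
have lE : l = 16 * (C * l') by rewrite /l'; field; rewrite gt_eqF.
pose K := 3 / l' * ((2 * m)%:R * (2 * pi)) + 1.
have K0 : 0 < K by rewrite ltr_wpDl// !mulr_ge0 ?invr_ge0 ?(ltW l'0) ?pi_ge0.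
pose Dk k z := h z - h (rc (dilr R k) * z).
have ex i : exists k, (mu (bad_radial (Dk k) m (C * l')%R) <= (i.+1%:R^-1)%R%:E)%E.
  have e0 : 0 < i.+1%:R^-1 / K by rewrite divr_gt0// invr_gt0.
  have [k _ hk] := dilate_small ah hB e0; exists k.
  have aD := analytic_sub ah (analytic_dilate ah (dilr_itv R k)).
  apply: (le_trans (hC _ _ m _ aD (hk k (leqnn k)) l'0)); rewrite lee_fin.
  set y := i.+1%:R^-1 in e0 *; have y0 : 0 < y by rewrite /y invr_gt0.
  have -> : 3 / l' * ((2 * m)%:R * (2 * pi * (y / K))) = y * (3 / l' * ((2 * m)%:R * (2 * pi)) / K) by ring.
  by rewrite ger_pMr// ler_pdivrMr// mul1r /K lerDl.
have [kk hkk] := choice ex.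
pose G i := bad_radial (Dk (kk i)) m (C * l').
have mG i : measurable (G i).
  by apply: measurable_bad_radial; exact: (analytic_sub ah (analytic_dilate ah (dilr_itv R _))).
exists (\bigcap_i G i); split.
- by apply: bigcap_measurable => [|i _]; [exists 0%N|exact: mG].
- apply/eqP; rewrite -measure_le0; apply/lee_addgt0Pr => e e0; rewrite add0e.
  have [i hi] : exists i, i.+1%:R^-1 < e.
    have := @cvg_harmonic R; move=> /cvgrPdist_lt/(_ _ e0)[N _ hN]; exists N.
    by have := hN N (leqnn N); rewrite sub0r normrN => /(le_lt_trans (ler_norm _)).
  apply: (@le_trans _ _ (mu (G i))).
    apply: le_measure; rewrite ?inE.
    - by apply: bigcap_measurable => [|j _]; [exists 0%N|exact: mG].
    - exact: mG.
    - by move=> x; exact.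
  apply: (@le_trans _ _ (i.+1%:R^-1)%R%:E); first exact: (hkk i).
  by rewrite lee_fin ltW.
- move=> x ox i _; apply: (@oscillating_sub h m (C * l') (kk i) ah (mulr_gt0 C0 l'0)).
  by rewrite -lE.
Qed.

Lemma ex_window x : exists m, window m x.
Proof.
have [n hn] : exists n : nat, `|x| < n%:R.
  by exists (Num.bound `|x|); exact: archi_boundP.
exists n.+1; have := pi_ge2 R; move: hn; rewrite /window /= in_itv /= -natr1 ltr_norml.
move=> /andP[h1 h2] p2.
have n0 : 0 <= n%:R :> R by [].
by apply/andP; split; nra.
Qed.

(* Fatou's theorem *)
Lemma radial_limits h B : analytic_on_disk h -> hardy_le h B ->
  exists N : set R, [/\ measurable N, mu N = 0%E &
    forall x, ~ N x -> cvg (h (rc r * expi x) @[r --> (1 : R)^'-])].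
Proof.
move=> ah hB.
(* Countably many windows and thresholds suffice: off this union, [h] is Cauchy along the radius. *)
have : mu.-negligible (\bigcup_m \bigcup_i oscillating h m (i.+1%:R^-1)).
  apply: negligible_bigcup => m; apply: negligible_bigcup => i.
  by apply: oscillating_null hB _ => //; rewrite invr_gt0.
move=> [N [mN N0 sN]]; exists N; split=> // x nx.
have [m wm] := ex_window x.
have cauchyh e : 0 < e -> exists r0 : R, 0 <= r0 < 1 /\ forall r s, r0 < r < 1 -> r0 < s < 1 ->
    cabs (h (rc r * expi x) - h (rc s * expi x)) < e.
  move=> e0; have e20 : 0 < e ^+ 2 by rewrite exprn_gt0.
  have [i hi] : exists i, i.+1%:R^-1 < e ^+ 2.
    have := @cvg_harmonic R; move=> /cvgrPdist_lt/(_ _ e20)[M _ hM]; exists M.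
    by have := hM M (leqnn M); rewrite sub0r normrN => /(le_lt_trans (ler_norm _)).
  apply: contrapT => hne; apply: nx; apply: sN; exists m => //; exists i => //; split=> //.
  move=> r0 r01; apply: contrapT => hne2; apply: hne; exists r0; split=> // r s hr hs.
  rewrite -ltr_sqr ?nnegrE ?cabs_ge0 ?(ltW e0)//; apply: le_lt_trans hi.
  by rewrite leNgt; apply/negP => hlt; apply: hne2; exists r, s.
(* Completeness is used in [R], for the real and the imaginary part separately. *)
have cvgpart (p : cplx R -> R) : (forall z w, `|p z - p w| <= cabs (z - w)) ->
    cvg (p (h (rc r * expi x)) @[r --> (1 : R)^'-]).
  move=> hp; apply: cauchy_cvg; apply: cauchy_exP => e e0.
  have [r0 [/andP[r00 r01] hr]] := cauchyh e e0.
  pose s := (r0 + 1) / 2.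
  have hs : r0 < s < 1 by rewrite /s; apply/andP; split; lra.
  exists (p (h (rc s * expi x))).
  suff : \forall r \near (1 : R)^'-, ball (p (h (rc s * expi x))) e (p (h (rc r * expi x))) by exact.
  near=> r; rewrite -ball_normE /ball_ /=.
  apply: (le_lt_trans (hp _ _)); apply: (hr _ _ hs).
  apply/andP; split; first by near: r; exact: nbhs_left_gt.
  by near: r; exact: nbhs_left_lt.
have /cvg_ex[u hu] := cvgpart (@complex.Re R) (fun z w => le_trans (eq_ind _ (fun y => `|y| <= _) (cabs_Re (z - w)) _ (etrans (cReD _ _) (congr1 _ (cReN _)))) (lexx _)).
have /cvg_ex[v hv] := cvgpart (@complex.Im R) (fun z w => le_trans (eq_ind _ (fun y => `|y| <= _) (cabs_Im (z - w)) _ (etrans (cImD _ _) (congr1 _ (cImN _)))) (lexx _)).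
by apply/cvg_ex; exists (u +i* v); apply: cvg_ReIm.
Unshelve. all: by end_near. Qed.

End RadialTheorem.

(** * Integrals off a null set *)

Section NullSets.
Context d (T : measurableType d) (R : realType) (mu : {measure set T -> \bar R}).
Local Open Scope ereal_scope.
Import HBNNSimple.

(* No measurability of [f] is required: the boundary function of the statement
   takes an arbitrary value where the radial limit does not exist. *)
Lemma integral_setD_null (D N : set T) (f : T -> \bar R) : measurable N -> mu N = 0 ->
  \int[mu]_(x in D) f x = \int[mu]_(x in D `\` N) f x.
Proof.
move=> mN N0.
suff pos (g : T -> \bar R) : (forall x, 0 <= g x) ->
    \int[mu]_(x in D) g x = \int[mu]_(x in D `\` N) g x.
  by rewrite integralE [RHS]integralE; congr (_ - _); exact: pos.
move=> g0; rewrite [LHS]integral_mkcond [RHS]integral_mkcond.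
have p0 A x : 0 <= (g \_ A) x by rewrite patchE; case: ifPn.
rewrite !ge0_integralTE//; apply/eqP; rewrite eq_le; apply/andP; split.
  (* A simple function below [g] on [D] keeps its integral when set to zero on [N], and then
     competes for the integral over [D] minus [N]. *)
  apply: ge_ereal_sup => _ [h /= hg <-].
  have mNC : measurable (setT `\` N) by apply: measurableD.
  rewrite -integralT_nnsfun (@ge0_negligible_integral _ _ _ mu setT N)//; last 2 first.
  - by apply/measurable_EFinP.
  - by move=> x _; rewrite lee_fin.
  rewrite integral_nnsfun// mrestrict; apply: ereal_sup_ubound.
  exists (proj_nnsfun h mNC) => // x; rewrite -[X in X%:E]/(_ x) -mrestrict.
  rewrite !patchE; case: (boolP (x \in setT `\` N)) => xN; last exact: p0.
  move: xN; rewrite inE => -[_ nN]; have := hg x; rewrite patchE.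
  case: ifPn => xD; first by rewrite mem_set//; split => //; exact/set_mem.
  by move=> h0; case: ifPn => // _; exact: (le_trans h0 _).
apply: le_ereal_sup => _ [h /= hg <-]; exists h => //= x.
apply: le_trans (hg x) _; rewrite !patchE; case: ifPn => [xD|_]; last by case: ifPn.
by rewrite ifT//; apply/mem_set; move: xD => /set_mem[].
Qed.

End NullSets.

(** * Boundary values *)

Section Boundary.
Variable R : realType.
Implicit Types (a b t e B K : R) (c : cplx R) (h : cplx R -> cplx R).
Let mu := @lebesgue_measure R.

Definition sqint a b (F : R -> cplx R) : \bar R :=
  (\int[mu]_(t in `[a, b]%classic) ((cabs (F t) ^+ 2)%R)%:E)%E.

Lemma sqint_ge0 a b F : (0 <= sqint a b F)%E.
Proof. by apply: integral_ge0 => t _; rewrite lee_fin sqr_ge0. Qed.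

Lemma sqint_intg a b F : continuous F -> sqint a b F = (intg a b (fun t => cabs (F t) ^+ 2))%:E.
Proof. by move=> cF; rewrite intgE//; exact: continuous_cabs2. Qed.

Lemma dilr_at_left : dilr R n @[n --> \oo] --> (1 : R)^'-.
Proof.
move=> P hP; have [N _ hN] : nbhs \oo (fun n => dilr R n < 1 -> P (dilr R n)) by exact: (@dilr_cvg R _ hP).
exists N => // n nN.
by apply: (hN n nN); case/andP: (dilr_itv R n).
Qed.

Lemma boundary_cvg h B : analytic_on_disk h -> hardy_le h B ->
  exists N : set R, [/\ measurable N, mu N = 0%E &
    forall t, ~ N t -> circ h (dilr R n) t @[n --> \oo] --> boundary h (expi t)].
Proof.
move=> ah hB; have [N [mN N0 hN]] := radial_limits ah hB.
exists N; split=> // t nt.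
exact: (cvg_comp _ _ dilr_at_left (hN t nt)).
Qed.

(** The comparison functions may vary with [n]: constants serve for arc means, dilates of [h] for
    convergence in L2. *)
Lemma sqint_boundary_le h B a b K (u_ : nat -> R -> cplx R) (u : R -> cplx R) :
  analytic_on_disk h -> hardy_le h B -> (forall n, continuous (u_ n)) ->
  (forall t, u_ n t @[n --> \oo] --> u t) ->
  (\forall n \near \oo, intg a b (fun t => cabs (circ h (dilr R n) t - u_ n t) ^+ 2) <= K) ->
  (sqint a b (fun t => (boundary h (expi t) - u t)%R) <= K%:E)%E.
Proof.
move=> ah hB cu uu hK; have [N [mN N0 hN]] := boundary_cvg ah hB.
have cd n : continuous (fun t => circ h (dilr R n) t - u_ n t).
  exact: (continuousBc (continuous_circ ah (dilr_itv R n)) (cu n)).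
have cf n : continuous (fun t => cabs (circ h (dilr R n) t - u_ n t) ^+ 2).
  exact: (continuous_cabs2 (cd n)).
rewrite /sqint (@integral_setD_null _ _ _ mu `[a, b]%classic N)//.
apply: (@fatou_le _ _ _ (fun n t => cabs (circ h (dilr R n) t - u_ n t) ^+ 2)).
- exact: measurableD.
- by move=> n; apply: measurable_funTS; exact: continuous_measurable_fun.
- by move=> n t _; exact: sqr_ge0.
- by move=> t [_ nt]; exact: (cvg_cabs2 (cvgB (hN t nt) (uu t))).
apply: filterS hK => n hn.
by rewrite -(@integral_setD_null _ _ _ mu `[a, b]%classic N)// -intgE// lee_fin.
Qed.

Lemma sqint_boundary_le_cst h B a b c K : analytic_on_disk h -> hardy_le h B ->
  (\forall n \near \oo, intg a b (fun t => cabs (circ h (dilr R n) t - c) ^+ 2) <= K) ->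
  (sqint a b (fun t => (boundary h (expi t) - c)%R) <= K%:E)%E.
Proof.
move=> ah hB; apply: (@sqint_boundary_le h B a b K (fun=> fun=> c)) => //.
- by move=> n t; exact: cvg_cst.
- by move=> t; exact: cvg_cst.
Qed.

Lemma intg_le_rmean a b : exists2 M : R, 0 < M & forall v : R -> R, continuous v ->
  (forall t, 0 <= v t) -> (forall t, v (t + 2 * pi) = v t) -> intg a b v <= M * rmean v.
Proof.
have tp := twopi_gt0 R.
pose m := Num.bound ((`|a| + `|b|) / (2 * pi)).
have hm : `|a| + `|b| < m%:R * (2 * pi).
  by rewrite -ltr_pdivrMr//; apply: archi_boundP; rewrite divr_ge0 ?addr_ge0 ?(ltW tp).
exists ((2 * m)%:R * (2 * pi) + 1); first by rewrite ltr_wpDl// mulr_ge0// ltW.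
move=> v cv v0 pv.
have [ab|ba] := leP a b; last first.
  rewrite /Rintegral set_itv_ge -?leNgt ?bnd_simp -?ltNge// integral_set0 mulr_ge0 ?rmean_ge0//.
  by rewrite addr_ge0// mulr_ge0 // ltW.
apply: (@le_trans _ _ (intg (- (m%:R * (2 * pi))) (m%:R * (2 * pi)) v)); last first.
  by rewrite (intg_periods m cv pv) mulrA ler_wpM2r ?rmean_ge0// lerDl.
have [a1 a2] := andP (eq_ind _ is_true (lexx `|a|) _ (ler_norml a `|a|)).
have [b1 b2] := andP (eq_ind _ is_true (lexx `|b|) _ (ler_norml b `|b|)).
have na := normr_ge0 a; have nb := normr_ge0 b.
have l1 : - (m%:R * (2 * pi)) <= a by lra.
have l2 : b <= m%:R * (2 * pi) by lra.
rewrite (intg_cat cv l1 (le_trans ab l2)) (intg_cat cv ab l2).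
have := @intg_ge0 R (- (m%:R * (2 * pi))) a v (fun x _ => v0 x); have := @intg_ge0 R b (m%:R * (2 * pi)) v (fun x _ => v0 x).
lra.
Qed.

(** With [k] fixed, Fatou's lemma in [n] carries the smallness of [h z - h (rc (dilr R k) * z)] on
    circles over to the boundary. *)
Lemma sqint_boundary_circ h B a b e : analytic_on_disk h -> hardy_le h B -> 0 < e ->
  \forall k \near \oo, (sqint a b (fun t => (boundary h (expi t) - circ h (dilr R k) t)%R) <= e%:E)%E.
Proof.
move=> ah hB e0; have [M M0 hM] := intg_le_rmean a b.
have e10 : 0 < e / M by rewrite divr_gt0.
apply: filterS (dilate_small ah hB e10) => k hk.
have ak := analytic_dilate ah (dilr_itv R k).
apply: (@sqint_boundary_le h B a b e (fun n => circ (fun z => h (rc (dilr R k) * z)) (dilr R n))) => //.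
- by move=> n; exact: (continuous_circ ak (dilr_itv R n)).
- move=> t; have w1 : cabs (rc (dilr R k) * expi t) < 1.
    by rewrite cabs_circ; case/andP: (dilr_itv R k).
  have /derivable_continuous hc := ah _ w1.
  rewrite /circ.
  apply: (@cvg_comp _ _ _ (fun n => rc (dilr R k) * (rc (dilr R n) * expi t)) h _ (nbhs (rc (dilr R k) * expi t))); last exact: hc.
  apply: cvgM; first exact: cvg_cst.
  rewrite -[X in _ --> X]mul1r; apply: cvgM; last exact: cvg_cst.
  exact: (@rc_dilr_cvg R).
apply: nearW => n; apply: (le_trans (hM _ _ _ _)).
- exact: (continuous_cabs2 (continuousBc (continuous_circ ah (dilr_itv R n)) (continuous_circ ak (dilr_itv R n)))).
- by move=> t; exact: sqr_ge0.
- by move=> t; rewrite !circ_period.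
by rewrite mulrC -ler_pdivlMr//; exact: (hk _ (dilr_itv R n)).
Qed.

End Boundary.

Section MeanValue.
Context d (T : measurableType d) (R : realType) (mu : {measure set T -> \bar R}).

(** With [y] the mean minus [x], integrating [(f t - x - y) ^+ 2 >= 0] gives the claim. The mean
    makes sense because [|f|] is at most [(f - x) ^+ 2 + 1 + |x|]. *)
Lemma sqr_mean_le (D : set T) (f : T -> R) (x l K : R) : measurable D -> mu D = l%:E -> 0 < l ->
  measurable_fun D f -> (\int[mu]_(t in D) ((f t - x) ^+ 2)%:E <= K%:E)%E ->
  l * (x - l^-1 * Rintegral mu D f) ^+ 2 <= K.
Proof.
move=> mD Dl l0 mf hK.
have fin : (mu D < +oo)%E by rewrite Dl ltry.
have ms : measurable_fun D (fun t => (f t - x) ^+ 2).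
  by apply: measurable_funX; apply: measurable_funB => //; exact: measurable_cst.
have is_ : mu.-integrable D (fun t => ((f t - x) ^+ 2)%:E).
  apply/integrableP; split; first exact/measurable_EFinP.
  apply: (@le_lt_trans _ _ K%:E); last exact: ltry.
  apply: le_trans hK; rewrite le_eqVlt; apply/orP; left; apply/eqP.
  by apply: eq_integral => t _; rewrite gee0_abs// lee_fin sqr_ge0.
have ic y : mu.-integrable D (cst y%:E).
  apply/integrableP; split; first exact: measurable_cst.
  rewrite (_ : (fun _ => _) = cst `|y|%:E); last by apply/funext.
  by rewrite integral_cst//; apply: lte_mul_pinfty; rewrite ?lee_fin.
have if_ : mu.-integrable D (EFin \o f).
  apply: (@le_integrable _ _ _ mu D mD _ (fun t => ((f t - x) ^+ 2)%:E + (1 + `|x|)%R%:E)%E).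
  - exact/measurable_EFinP.
  - move=> t _; rewrite -[X in (_ <= `|X|)%E]/(((f t - x) ^+ 2 + (1 + `|x|))%R%:E) !abse_EFin lee_fin [leRHS]ger0_norm; last first.
      by rewrite addr_ge0 ?sqr_ge0// addr_ge0.
    have := ler_normD (f t - x) x; rewrite subrK => h1; apply: (le_trans h1).
    rewrite addrA lerD2r -(real_normK (num_real (f t - x))).
    by have := sqr_ge0 (`|f t - x| - 1); have := normr_ge0 (f t - x); rewrite sqrrB; nra.
  - by apply: integrableD => //; exact: ic.
set m := l^-1 * _; set y := m - x.
have hm : Rintegral mu D f = l * m by rewrite /m mulrA divff ?mul1r// gt_eqF.
have iz : mu.-integrable D (EFin \o (fun t => 2 * y * f t)).
  by have := integrableZl mD (2 * y) if_.
have iB : mu.-integrable D (EFin \o (fun t => 2 * y * f t - (2 * y * x + y ^+ 2))).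
  exact: (integrableB mD iz (ic (2 * y * x + y ^+ 2))).
have key : Rintegral mu D (fun t => 2 * y * f t - (2 * y * x + y ^+ 2)) <= Rintegral mu D (fun t => (f t - x) ^+ 2).
  apply: (le_Rintegral mD iB is_) => t _.
  by have := sqr_ge0 (f t - x - y); nra.
have e1 : Rintegral mu D (fun t => 2 * y * f t - (2 * y * x + y ^+ 2)) = l * y ^+ 2.
  rewrite (RintegralB mD iz (ic (2 * y * x + y ^+ 2))) (RintegralZl _ mD if_).
  by rewrite Rintegral_cst// hm Dl /= /y; ring.
have -> : (x - m) ^+ 2 = y ^+ 2 by rewrite /y -sqrrN opprB.
rewrite -e1; apply: (le_trans key); rewrite -lee_fin /Rintegral fineK//.
exact: integrable_fin_num.
Qed.

End MeanValue.

Section BoundaryMeans.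
Variable R : realType.
Implicit Types (a b t e B K l : R) (c : cplx R) (h : cplx R -> cplx R).
Let mu := @lebesgue_measure R.

Lemma sqint_le2 a b (N : set R) K K' (F G H : R -> cplx R) : measurable N -> mu N = 0%E ->
  measurable_fun (`[a, b]%classic `\` N) (fun t => cabs (F t) ^+ 2) ->
  measurable_fun (`[a, b]%classic `\` N) (fun t => cabs (G t) ^+ 2) ->
  measurable_fun (`[a, b]%classic `\` N) (fun t => cabs (H t) ^+ 2) ->
  (forall t, cabs (H t) ^+ 2 <= 2 * cabs (F t) ^+ 2 + 2 * cabs (G t) ^+ 2) ->
  (sqint a b F <= K%:E)%E -> (sqint a b G <= K'%:E)%E ->
  (sqint a b H <= (2 * K + 2 * K')%:E)%E.
Proof.
move=> mN N0 mF mG mH HFG.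
rewrite /sqint !(@integral_setD_null _ _ _ mu `[a, b]%classic N)// => hF hG.
have mD : measurable (`[a, b]%classic `\` N) by exact: measurableD.
set D := (_ `\` _) in mF mG mH hF hG mD *.
have m2 (f : R -> R) : measurable_fun D f -> measurable_fun D (fun t => (2 * f t)%:E).
  by move=> mf; apply/measurable_EFinP; apply: measurable_funM => //; exact: measurable_cst.
have p2 (F' : R -> cplx R) t : (0 <= ((2 * cabs (F' t) ^+ 2)%R)%:E)%E.
  by rewrite lee_fin mulr_ge0// sqr_ge0.
have i2 (F' : R -> cplx R) : measurable_fun D (fun t => cabs (F' t) ^+ 2) ->
    (\int[mu]_(t in D) ((2 * cabs (F' t) ^+ 2)%R)%:E = 2%:E * \int[mu]_(t in D) ((cabs (F' t) ^+ 2)%R)%:E)%E.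
  move=> mF'; under eq_integral do rewrite EFinM.
  by rewrite ge0_integralZl_EFin//; [move=> t _; rewrite lee_fin sqr_ge0|exact/measurable_EFinP].
apply: (@le_trans _ _ (\int[mu]_(t in D) (((2 * cabs (F t) ^+ 2)%R)%:E + ((2 * cabs (G t) ^+ 2)%R)%:E))%E).
  apply: ge0_le_integral => //.
  - by move=> t _; rewrite lee_fin sqr_ge0.
  - exact/measurable_EFinP.
  - by apply: emeasurable_funD; [exact: m2 _ mF|exact: m2 _ mG].
  - by move=> t _; rewrite -EFinD lee_fin.
rewrite ge0_integralD//; last 2 first.
- exact: m2 _ mF.
- exact: m2 _ mG.
rewrite !i2//. by apply: (@leeD _ _ (2 * K)%:E _ (2 * K')%:E); rewrite EFinM lee_pmul2l.
Qed.

(** Off a null set the boundary function is a pointwise limit of continuous functions. A single [N]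
    is provided, so that all the integrals in one estimate are restricted to the same set. *)
Lemma boundary_measurable h B : analytic_on_disk h -> hardy_le h B ->
  exists N : set R, [/\ measurable N, mu N = 0%E,
    forall D (u : R -> cplx R), measurable D -> continuous u ->
      measurable_fun (D `\` N) (fun t => cabs (boundary h (expi t) - u t) ^+ 2),
    forall D, measurable D -> measurable_fun (D `\` N) (fun t => complex.Re (boundary h (expi t)))
    & forall D, measurable D -> measurable_fun (D `\` N) (fun t => complex.Im (boundary h (expi t)))].
Proof.
move=> ah hB; have [N [mN N0 hN]] := boundary_cvg ah hB; exists N.
have cc n := continuous_circ ah (dilr_itv R n).
split=> // [D u mD cu|D mD|D mD].
- apply: (@measurable_fun_cvg _ _ _ _ (fun n t => cabs (circ h (dilr R n) t - u t) ^+ 2)).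
    move=> n; apply: measurable_funTS; apply: continuous_measurable_fun.
    exact: (continuous_cabs2 (continuousBc (cc n) cu)).
  by move=> t [_ nt]; exact: (cvg_cabs2 (cvgB (hN t nt) (cvg_cst (u t)))).
- apply: (@measurable_fun_cvg _ _ _ _ (fun n t => complex.Re (circ h (dilr R n) t))).
    by move=> n; apply: measurable_funTS; apply: continuous_measurable_fun; exact: (continuous_Re (cc n)).
  by move=> t [_ nt]; exact: (cvg_Re (hN t nt)).
- apply: (@measurable_fun_cvg _ _ _ _ (fun n t => complex.Im (circ h (dilr R n) t))).
    by move=> n; apply: measurable_funTS; apply: continuous_measurable_fun; exact: (continuous_Im (cc n)).
  by move=> t [_ nt]; exact: (cvg_Im (hN t nt)).
Qed.

(** The converse of [sqint_boundary_le_cst]: the inequality [|z + w|^2 <= 2 |z|^2 + 2 |w|^2] costs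
    the factor [2], and L2 convergence of the dilates the additive [e]. *)
Lemma intg_le_boundary h B a b c K e : analytic_on_disk h -> hardy_le h B -> 0 < e ->
  (sqint a b (fun t => (boundary h (expi t) - c)%R) <= K%:E)%E ->
  \forall k \near \oo, intg a b (fun t => cabs (circ h (dilr R k) t - c) ^+ 2) <= 2 * K + e.
Proof.
move=> ah hB e0 hK; have [N [mN N0 mh _ _]] := boundary_measurable ah hB.
have e20 : 0 < e / 2 by lra.
apply: filterS (sqint_boundary_circ a b ah hB e20) => k hk.
have ck := continuous_circ ah (dilr_itv R k).
have cc : continuous (fun _ : R => c) by move=> t; exact: cvg_cst.
have cH := continuousBc ck cc.
rewrite -lee_fin -sqint_intg//.
have -> : 2 * K + e = 2 * K + 2 * (e / 2) by lra.
apply: (@sqint_le2 a b N K (e / 2) _ _ _ mN N0 _ _ _ _ hK hk).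
- exact: mh.
- exact: mh.
- by apply: measurable_funTS; apply: continuous_measurable_fun; exact: continuous_cabs2.
move=> t; set z := boundary _ _.
have -> : circ h (dilr R k) t - c = (z - c) + - (z - circ h (dilr R k) t) by ring.
by apply: (le_trans (cabs_sqrD _ _)); rewrite cabsN.
Qed.

End BoundaryMeans.

(** * Reading the seminorm and [norm2] as square integrals *)

Section Seminorm.
Variable R : realType.
Implicit Types (a b t e B K l p S alpha : R) (c : cplx R) (h : cplx R -> cplx R).
Let mu := @lebesgue_measure R.

Lemma lebesgue_measure_arc alpha l : 0 < l -> mu `[alpha, alpha + l]%classic = l%:E.
Proof.
by move=> l0; rewrite /mu lebesgue_measure_itv /= lte_fin ltrDl l0 -EFinD addrC addKr.
Qed.

Lemma sqint_cst alpha l c : 0 < l -> sqint alpha (alpha + l) (fun=> c) = (l * cabs c ^+ 2)%:E.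
Proof.
move=> l0; rewrite /sqint integral_cst//.
by rewrite [X in (_ * X)%E]lebesgue_measure_arc// -EFinM mulrC.
Qed.

(** The distance from [c] to the arc mean contributes at most [K] in each of the real and imaginary
    parts, hence [6 = 2 + 2 * 2]. *)
Lemma sqint_arc_mean h B alpha l c K : analytic_on_disk h -> hardy_le h B -> 0 < l ->
  (sqint alpha (alpha + l) (fun t => (boundary h (expi t) - c)%R) <= K%:E)%E ->
  (sqint alpha (alpha + l) (fun t => (boundary h (expi t) - arc_mean h alpha l)%R) <= (6 * K)%:E)%E.
Proof.
move=> ah hB l0 hK.
have [N [mN N0 mh mRe mIm]] := boundary_measurable ah hB.
set m := arc_mean h alpha l.
pose D := `[alpha, alpha + l]%classic `\` N.
have mD : measurable D by exact: measurableD.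
have Dl : mu D = l%:E.
  have := @integral_setD_null _ _ _ mu `[alpha, alpha + l]%classic N (fun=> 1%:E) mN N0.
  rewrite !integral_cst//.
  by rewrite !mul1e => h1; exact: (etrans (esym h1) (lebesgue_measure_arc alpha l0)).
have part (f : cplx R -> R) : (forall z w, (f z - f w) ^+ 2 <= cabs (z - w) ^+ 2) ->
    (forall A, measurable A -> measurable_fun (A `\` N) (fun t => f (boundary h (expi t)))) ->
    l * (f c - l^-1 * Rintegral mu `[alpha, alpha + l]%classic (fun t => f (boundary h (expi t)))) ^+ 2 <= K.
  move=> hf mf.
  rewrite [Rintegral mu _ _](_ : _ = Rintegral mu D (fun t => f (boundary h (expi t)))); last first.
    by rewrite /Rintegral (@integral_setD_null _ _ _ mu `[alpha, alpha + l]%classic N).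
  apply: (@sqr_mean_le _ _ _ mu D _ (f c) l K mD Dl l0); first exact: mf.
  move: hK; rewrite /sqint (@integral_setD_null _ _ _ mu `[alpha, alpha + l]%classic N)// => hK.
  apply: le_trans hK; apply: ge0_le_integral => //.
  - by move=> t _; rewrite lee_fin sqr_ge0.
  - apply/measurable_EFinP; apply: measurable_funX; apply: measurable_funB; first exact: mf.
    exact: measurable_cst.
  - apply/measurable_EFinP; apply: mh => // t; exact: cvg_cst.
  - by move=> t _; rewrite lee_fin; exact: hf.
have hRe : l * (complex.Re c - complex.Re m) ^+ 2 <= K.
  rewrite [complex.Re m](_ : _ = l^-1 * Rintegral mu `[alpha, alpha + l]%classic (fun t => complex.Re (boundary h (expi t)))); last first.
    by rewrite /m /arc_mean cReM /= mul0r subr0.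
  apply: (part (@complex.Re R)) => // z w.
  by rewrite cabs2 cReD cReN lerDl sqr_ge0.
have hIm : l * (complex.Im c - complex.Im m) ^+ 2 <= K.
  rewrite [complex.Im m](_ : _ = l^-1 * Rintegral mu `[alpha, alpha + l]%classic (fun t => complex.Im (boundary h (expi t)))); last first.
    by rewrite /m /arc_mean cImM /= mul0r addr0.
  apply: (part (@complex.Im R)) => // z w.
  by rewrite cabs2 cImD cImN lerDr sqr_ge0.
have hcm : (sqint alpha (alpha + l) (fun=> (c - m)%R) <= (2 * K)%:E)%E.
  by rewrite sqint_cst// lee_fin cabs2 cReD cReN cImD cImN mulrDr; lra.
have -> : 6 * K = 2 * K + 2 * (2 * K) by ring.
have cc w : continuous (fun _ : R => w : cplx R) by move=> t; exact: cvg_cst.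
apply: (@sqint_le2 R _ _ N K (2 * K) _ _ _ mN N0 _ _ _ _ hK hcm).
- by apply: mh.
- exact: measurable_cst.
- by apply: mh.
move=> t; set z := boundary _ _.
have -> : z - m = (z - c) + (c - m) by ring.
exact: cabs_sqrD.
Qed.

Lemma poweR_half_le (x : \bar R) S : (0 <= x)%E -> 0 <= S ->
  (poweR x 2^-1 <= S%:E)%E = (x <= (S ^+ 2)%:E)%E.
Proof.
case: x => [x| |] //.
- rewrite lee_fin => x0 S0; rewrite poweR_EFin !lee_fin powR12_sqrt//.
  by rewrite -(ler_sqr (sqrtr_ge0 x) S0) sqr_sqrtr.
- by move=> _ S0; rewrite poweRyr ?invr_eq0// !leye_eq.
Qed.

Lemma norm2_sqr h : (norm2 h ^+ 2 = sqint 0 (2 * pi) (fun t => boundary h (expi t)))%E.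
Proof.
rewrite /norm2 /circle_arc add0r -/(sqint 0 (2 * pi) (fun t => boundary h (expi t))).
have := sqint_ge0 0 (2 * pi) (fun t => boundary h (expi t)).
case: sqint => [x| |] //.
- by rewrite lee_fin => x0; rewrite poweR_EFin -EFin_expe powR12_sqrt// sqr_sqrtr.
- by move=> _; rewrite poweRyr ?invr_eq0// expe2 mulyy.
Qed.

Lemma norm2_le h B : analytic_on_disk h -> hardy_le h B -> (norm2 h ^+ 2 <= (2 * pi * B)%:E)%E.
Proof.
move=> ah hB; have tp := twopi_gt0 R.
have e0 : (fun t => boundary h (expi t)) = (fun t => boundary h (expi t) - 0).
  by apply/funext => t; rewrite subr0.
rewrite norm2_sqr e0; apply: (sqint_boundary_le_cst ah hB).
apply: nearW => n; have := hB _ (dilr_itv R n).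
rewrite /rmean ler_pdivrMl// => h1.
by under eq_intg => t _ do rewrite subr0.
Qed.

(** Normalising divides by [2 * pi], and returning from the boundary to circles costs a factor [2].
    The bound [B] only ensures that radial limits exist. *)
Lemma hardy_le_norm2 h B K : analytic_on_disk h -> hardy_le h B -> 
  (norm2 h ^+ 2 <= K%:E)%E -> hardy_le h (K / pi).
Proof.
move=> ah hB; have p0 := pi_gt0 R; have tp := twopi_gt0 R.
have e0 : (fun t => boundary h (expi t)) = (fun t => boundary h (expi t) - 0).
  by apply/funext => t; rewrite subr0.
rewrite norm2_sqr e0 => hK r r01; apply/ler_addgt0Pr => e e_gt0.
suff : hardy_le h (K / pi + e) by exact.
apply: hardy_le_near => //.
have pe : 0 < 2 * pi * e by exact: mulr_gt0.
apply: filterS (intg_le_boundary ah hB pe hK) => n hn.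
rewrite /rmean ler_pdivrMl//; apply: le_trans (le_trans hn _); last first.
  rewrite (mulrDr (2 * pi)) lerD2r (_ : 2 * pi * (K / pi) = 2 * K)//.
  by rewrite -mulrA (mulrC pi) divfK ?gt_eqF//.
by rewrite le_eqVlt; apply/orP; left; apply/eqP; apply: eq_intg => t _; rewrite subr0.
Qed.

Lemma hardy2P h : hardy2 h <-> analytic_on_disk h /\ exists B, hardy_le h B.
Proof.
have tp := twopi_gt0 R.
have E (ah : analytic_on_disk h) r : 0 <= r < 1 ->
    (\int[mu]_(t in `[0, 2 * pi]%classic%R) ((cabs (h (rc r * expi t)) ^+ 2)%R)%:E
      = (2 * pi * rmean (fun t => cabs (circ h r t) ^+ 2))%:E)%E.
  move=> r01; rewrite /rmean mulrA divff ?gt_eqF// mul1r -sqint_intg//.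
  exact: continuous_circ.
split=> [[ah hs]|[ah [B hB]]]; split=> //.
  move: hs; set X := ereal_sup _ => hX.
  have X0 : (0 <= X)%E.
    apply: le_trans (ereal_sup_ubound _); last by exists 0 => //=; rewrite lexx ltr01.
    exact: (sqint_ge0 0 (2 * pi) (circ h 0)).
  have fX : X \is a fin_num by rewrite ge0_fin_numE.
  exists (fine X / (2 * pi)) => r r01; rewrite ler_pdivlMr// mulrC -lee_fin -E// fineK//.
  by apply: ereal_sup_ubound; exists r.
apply: (@le_lt_trans _ _ (2 * pi * B)%:E); last exact: ltry.
apply: ge_ereal_sup => _ [r /= r01 <-].
by rewrite E// lee_fin ler_pM2l//; exact: hB.
Qed.

Lemma seminorm_sqint p h S alpha l : 0 <= S -> (campanato_seminorm p h <= S%:E)%E -> 0 < l <= 2 * pi ->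
  (sqint alpha (alpha + l) (fun t => (boundary h (expi t) - arc_mean h alpha l)%R) <= (S ^+ 2 * l `^ p)%:E)%E.
Proof.
move=> S0 hS lI; have l0 : 0 < l by case/andP: lI.
have lp : 0 < l `^ p by exact: powR_gt0.
set I := sqint _ _ _; have I0 : (0 <= I)%E := sqint_ge0 _ _ _.
have : (poweR ((l `^ (- p))%:E * I) 2^-1 <= S%:E)%E.
  by apply: le_trans hS; apply: ereal_sup_ubound; exists (alpha, l).
rewrite poweR_half_le// ?mule_ge0 ?lee_fin ?powR_ge0// powRN.
by rewrite muleC lee_pdivrMr.
Qed.

Lemma seminorm_le p h S : 0 <= S -> (forall alpha l, 0 < l <= 2 * pi ->
  (sqint alpha (alpha + l) (fun t => (boundary h (expi t) - arc_mean h alpha l)%R) <= (S ^+ 2 * l `^ p)%:E)%E) ->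
  (campanato_seminorm p h <= S%:E)%E.
Proof.
move=> S0 hS; apply: ge_ereal_sup => _ [[alpha l] /= lI <-].
have l0 : 0 < l by case/andP: lI.
rewrite -/(sqint alpha (alpha + l) (fun t => boundary h (expi t) - arc_mean h alpha l)).
rewrite poweR_half_le// ?mule_ge0 ?lee_fin ?powR_ge0 ?sqint_ge0// powRN.
by rewrite muleC lee_pdivrMr ?powR_gt0//; exact: hS.
Qed.

End Seminorm.

(** * Campanato seminorms and Hardy norms *)

Section DyadicMeans.
Variable R : realType.
Implicit Types (a b t e A B l p S alpha lam x r : R) (h F : cplx R -> cplx R).

Lemma geometric_sum_le x n : 0 <= x < 1 -> \sum_(j < n) x ^+ j <= (1 - x)^-1.
Proof.
move=> /andP[x0 x1]; have d0 : 0 < 1 - x by rewrite subr_gt0.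
rewrite -[leRHS]mul1r ler_pdivlMr// mulrC -opprB mulNr -subrX1 opprB.
by rewrite gerBl exprn_ge0.
Qed.

Lemma intg_subset a b a' b' (f : R -> R) : continuous f -> (forall t, 0 <= f t) ->
  a' <= a -> a <= b -> b <= b' -> intg a b f <= intg a' b' f.
Proof.
move=> cf f0 a'a ab bb'.
rewrite (intg_cat cf a'a (le_trans ab bb')) (intg_cat cf ab bb').
have := @intg_ge0 R a' a f (fun t _ => f0 t); have := @intg_ge0 R b b' f (fun t _ => f0 t).
lra.
Qed.

Lemma chain_le lam (Q : R) (c : nat -> cplx R) n : 1 < lam -> 0 <= Q ->
  (forall j, (j < n)%N -> cabs (c j.+1 - c j) <= Q * lam ^+ j) ->
  forall j, (j <= n)%N -> cabs (c j - c 0%N) <= Q * lam ^+ j / (lam - 1).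
Proof.
move=> l1 Q0 hc; have d0 : 0 < lam - 1 by rewrite subr_gt0.
elim=> [_|j IH jn]; first by rewrite subrr cabs0 divr_ge0 ?(ltW d0)// mulr_ge0// exprn_ge0// ltW// (lt_trans ltr01).
have -> : c j.+1 - c 0%N = (c j.+1 - c j) + (c j - c 0%N) by rewrite addrA subrK.
apply: (le_trans (cabsD _ _)).
apply: (le_trans (lerD (hc j jn) (IH (ltnW jn)))).
rewrite le_eqVlt; apply/orP; left; apply/eqP; rewrite exprS; field.
by rewrite gt_eqF.
Qed.

Lemma intg_cabs_sqrD a b (F G H : R -> cplx R) : continuous F -> continuous G -> continuous H ->
  (forall t, H t = F t + G t) ->
  intg a b (fun t => cabs (H t) ^+ 2) <=
  2 * intg a b (fun t => cabs (F t) ^+ 2) + 2 * intg a b (fun t => cabs (G t) ^+ 2).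
Proof.
move=> cF cG cH HE.
have cF2 := continuous_cabs2 cF; have cG2 := continuous_cabs2 cG; have cH2 := continuous_cabs2 cH.
rewrite -(@intgZ R a b 2 _ cF2) -(@intgZ R a b 2 _ cG2).
have c2 (v : R -> R) : continuous v -> continuous (fun t => 2 * v t).
  exact: continuousZ_real.
rewrite -(intgD _ _ (c2 _ cF2) (c2 _ cG2)).
apply: le_intg => //; last by move=> t _; rewrite HE; exact: cabs_sqrD.
exact: (continuousD_real (c2 _ cF2) (c2 _ cG2)).
Qed.

(** Consecutive centers [c j] differ by at most a multiple of [lam ^+ j], so replacing [c j] by
    [c 0] keeps the growth [(2 * lam ^+ 2) ^+ j]. Against the ring weights [4 ^ - j] this leaves the
    convergent series of [(lam ^+ 2 / 2) ^+ j]. *)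
Lemma dyadic_poisson_bound lam : 1 < lam -> lam ^+ 2 < 2 -> exists2 C : R, 0 < C &
  forall (F : R -> cplx R) (c : nat -> cplx R) A r x K, continuous F ->
  (forall t, F (t + 2 * pi) = F t) -> 0 <= A -> 0 <= r < 1 ->
  dyadic R K <= 1 - r <= 2 * dyadic R K ->
  (forall j, (j <= K)%N ->
     intg (x - 2 ^+ j * dyadic R K) (x + 2 ^+ j * dyadic R K) (fun t => cabs (F t - c j) ^+ 2)
     <= A * (2 * lam ^+ 2) ^+ j * dyadic R K) ->
  rmean (fun t => cabs (F t - c 0%N) ^+ 2 * poisson (rc r * expi x) t) <= C * A.
Proof.
move=> l1 l2; have [C0 C00 hC0] := intg_poisson_dyadic R.
have d0 : 0 < lam - 1 by rewrite subr_gt0.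
have l0 : 0 < lam by rewrite (lt_trans ltr01).
(* [2] from the oscillation about [c j], and [2 * 2 * 5] from the drift: the arc has length twice
   its half-length, and [Q ^+ 2 = 5 * A]. *)
pose G := 2 + 20 / (lam - 1) ^+ 2.
have G0 : 0 < G by rewrite addr_gt0// divr_gt0// exprn_gt0.
have th : 0 <= lam ^+ 2 / 2 < 1 by rewrite divr_ge0 ?sqr_ge0//= ltr_pdivrMr// mul1r.
have th0 : 0 < 1 - lam ^+ 2 / 2 by rewrite subr_gt0; case/andP: th.
exists (C0 * G / (1 - lam ^+ 2 / 2)); first by rewrite divr_gt0// mulr_gt0.
move=> F c A r x K cF pF A0 r01 dK hF.
have D0 := dyadic_gt0 R K; set D := dyadic R K in D0 dK hF *.
have cst_c w : continuous (fun _ : R => w : cplx R) by move=> t; exact: cvg_cst.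
have cFc w : continuous (fun t => F t - w) by exact: (continuousBc cF (cst_c w)).
have cFcN w : continuous (fun t => - (F t - w)) by move=> t; apply: cvgN; exact: cFc.
have p2 j : 0 < 2 ^+ j :> R by rewrite exprn_gt0.
have Ij j : x - 2 ^+ j * D <= x + 2 ^+ j * D.
  by have := mulr_gt0 (p2 j) D0; lra.
have cst_int j w : intg (x - 2 ^+ j * D) (x + 2 ^+ j * D) (fun=> cabs w ^+ 2) = 2 * (2 ^+ j * D) * cabs w ^+ 2.
  by rewrite intg_cst//; ring.
(* Two neighbouring oscillations contribute [2 + 2 * 2 * lam ^+ 2 <= 10] units; dividing by the [2]
   in the arc length leaves [5]. *)
pose Q := Num.sqrt (5 * A).
have Q2 : Q ^+ 2 = 5 * A by rewrite sqr_sqrtr// mulr_ge0.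
have l20 j : 0 < (2 * lam ^+ 2) ^+ j by rewrite exprn_gt0// mulr_gt0// exprn_gt0.
have lE j : (2 * lam ^+ 2) ^+ j = 2 ^+ j * (lam ^+ j) ^+ 2 by rewrite exprMn exprAC.
have step j : (j < K)%N -> cabs (c j.+1 - c j) <= Q * lam ^+ j.
  move=> jK; rewrite -ler_sqr ?nnegrE ?cabs_ge0 ?mulr_ge0 ?sqrtr_ge0 ?exprn_ge0 ?(ltW l0)//.
  rewrite exprMn Q2.
  have h1 := @intg_cabs_sqrD (x - 2 ^+ j * D) (x + 2 ^+ j * D) (fun t => F t - c j)
    (fun t => - (F t - c j.+1)) (fun=> c j.+1 - c j) (cFc _)
    (cFcN _) (cst_c _) (fun t => ltac:(cbv beta; ring)).
  rewrite cst_int in h1.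
  rewrite (_ : (fun t => cabs (- (F t - c j.+1)) ^+ 2) = (fun t => cabs (F t - c j.+1) ^+ 2)) in h1; last first.
    by apply/funext => t; rewrite cabsN.
  have h2 := hF j (ltnW jK); have h3 := hF j.+1 jK.
  have h4 : intg (x - 2 ^+ j * D) (x + 2 ^+ j * D) (fun t => cabs (F t - c j.+1) ^+ 2) <=
     intg (x - 2 ^+ j.+1 * D) (x + 2 ^+ j.+1 * D) (fun t => cabs (F t - c j.+1) ^+ 2).
    have := mulr_gt0 (p2 j) D0; rewrite exprS => y0.
    apply: (@intg_subset _ _ _ _ _ (continuous_cabs2 (cFc (c j.+1))) (fun t => sqr_ge0 _) _ (Ij j) _).
    - by lra.
    - by lra.
  have h5 : 2 * (2 ^+ j * D) * cabs (c j.+1 - c j) ^+ 2 <= 10 * (A * (2 * lam ^+ 2) ^+ j * D).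
    apply: (le_trans h1); have h6 := le_trans h4 h3; rewrite exprS in h6.
    have := mulr_ge0 (mulr_ge0 A0 (ltW (l20 j))) (ltW D0).
    move: h2 h6; rewrite (_ : A * (2 * lam ^+ 2 * (2 * lam ^+ 2) ^+ j) * D =
      2 * (lam ^+ 2 * (A * (2 * lam ^+ 2) ^+ j * D))); last by ring.
    set y := A * _ * D => h2 h6 y0; have h7 := ler_wpM2r y0 (ltW l2).
    lra.
  have y0 : 0 < 2 * (2 ^+ j * D) by rewrite mulr_gt0// mulr_gt0.
  rewrite lE in h5; rewrite -(ler_pM2l y0).
  by apply: (le_trans h5); rewrite le_eqVlt; apply/orP; left; apply/eqP; ring.
have bound j : (j <= K)%N ->
    intg (x - 2 ^+ j * D) (x + 2 ^+ j * D) (fun t => cabs (F t - c 0%N) ^+ 2)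
    <= A * D * G * (2 * lam ^+ 2) ^+ j.
  move=> jK.
  have h1 := @intg_cabs_sqrD (x - 2 ^+ j * D) (x + 2 ^+ j * D) (fun t => F t - c j)
    (fun=> c j - c 0%N) (fun t => F t - c 0%N) (cFc _) (cst_c _) (cFc _) (fun t => ltac:(cbv beta; ring)).
  rewrite cst_int in h1; apply: (le_trans h1).
  have h2 := hF j jK; have h3 := chain_le l1 (sqrtr_ge0 _) step jK.
  have h4 : cabs (c j - c 0%N) ^+ 2 <= 5 * A * (lam ^+ j) ^+ 2 / (lam - 1) ^+ 2.
    rewrite -Q2 -exprMn -exprVn -exprMn ler_sqr ?nnegrE ?cabs_ge0//.
    exact: (le_trans (cabs_ge0 _) h3).
  apply: (le_trans (lerD (ler_wpM2l _ h2) (ler_wpM2l _ (ler_wpM2l _ h4)))) => //.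
    by rewrite mulr_ge0// (ltW (mulr_gt0 (p2 j) D0)).
  by rewrite le_eqVlt; apply/orP; left; apply/eqP; rewrite /G lE; ring.
have r1 : cabs (rc r * expi x) < 1 by rewrite cabs_circ; case/andP: r01.
have cv := continuous_cabs2 (cFc (c 0%N)).
have cvP := continuousM_real cv (continuous_poisson r1).
rewrite (@rmean_interval R _ x cvP); last by move=> t; rewrite pF poisson_period.
have piE : pi = 2 ^+ K * D by rewrite /D /dyadic mulrC divfK// gt_eqF.
have [e1 e2] : x - pi = x - 2 ^+ K * D /\ x + pi = x + 2 ^+ K * D by rewrite -piE.
rewrite e1 e2.
have h1 := hC0 _ r x K K cv (fun t => sqr_ge0 _) r01 dK (leqnn K).
set I := intg _ _ _ in h1 *.
have h2 : I <= C0 * G / (1 - lam ^+ 2 / 2) * A.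
  apply: (le_trans h1).
  apply: (@le_trans _ _ (\sum_(j < K.+1) C0 * G * A * (lam ^+ 2 / 2) ^+ j)).
    apply: ler_sum => j _; have jK : (j <= K)%N by rewrite -ltnS.
    apply: (le_trans (ler_wpM2l _ (bound j jK))).
      exact: (divr_ge0 (divr_ge0 (ltW C00) (exprn_ge0 j (ler0n R 4))) (ltW D0)).
    rewrite le_eqVlt; apply/orP; left; apply/eqP.
    have four : 4 ^+ j = 2 ^+ j * 2 ^+ j :> R by rewrite -exprMn -natrM.
    rewrite expr_div_n lE (exprAC lam 2 j) four -/D.
    have : 2 ^+ j != 0 :> R by rewrite gt_eqF.
    have : D != 0 by rewrite gt_eqF.
    by move: (2 ^+ j) (lam ^+ j) => u w; move=> D00 u0; field; rewrite u0 D00.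
  rewrite -mulr_sumr [leRHS](_ : _ = C0 * G * A * (1 - lam ^+ 2 / 2)^-1); last by ring.
  by rewrite ler_wpM2l ?geometric_sum_le// !mulr_ge0// ltW.
apply: le_trans h2; rewrite ler_pdivrMl ?twopi_gt0//.
have I0 : 0 <= I.
  by apply: intg_ge0 => t _; rewrite mulr_ge0 ?sqr_ge0// ltW// poisson_gt0.
by have := pi_ge2 R; nra.
Qed.

End DyadicMeans.

Section Characterisation.
Variable R : realType.
Implicit Types (t e B G l p S alpha x r : R) (a : cplx R) (h : cplx R -> cplx R).

(** For exponents in [[0, 1]], the power of [M >= 1] is at most [M]; negative exponents follow by
    inversion, exchanging [x] and [y]. It is used with the exponent [p - 1]. *)
Lemma powR_comparable (M x y e : R) : 1 <= M -> 0 < x -> 0 < y -> x <= M * y -> y <= M * x ->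
  -1 <= e <= 1 -> x `^ e <= M * y `^ e.
Proof.
move=> M1 x0 y0 xy yx /andP[e0 e1].
have M0 : 0 < M by rewrite (lt_le_trans ltr01).
have main u v f : 0 < u -> 0 < v -> u <= M * v -> 0 <= f <= 1 -> u `^ f <= M * v `^ f.
  move=> u0 v0 uv /andP[f0 f1].
  apply: (@le_trans _ _ ((M * v) `^ f)).
    by rewrite ge0_ler_powR// nnegrE ltW// mulr_gt0.
  rewrite powRM ?(ltW M0) ?(ltW v0)// ler_wpM2r ?powR_ge0//.
  exact: ler1_powR.
have [f0|f0] := leP 0 e; first by apply: main; rewrite ?f0.
rewrite -(opprK e) (powRN x) (powRN y) -(@ler_pM2l _ (x `^ (- e))) ?powR_gt0//.
rewrite divff ?gt_eqF ?powR_gt0// mulrA ler_pdivlMr ?powR_gt0// mul1r mulrC.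
by apply: main => //; apply/andP; split; lra.
Qed.

(* Since [p < 2], the oscillation on the arc dilated by [2 ^ j] grows slower than
   [4 ^ j], the decay of the Poisson kernel; [lam ^ j] bounds the drift of the
   arc means. *)
Lemma ex_geometric_ratio p : p < 2 -> exists lam : R, [/\ 1 < lam, lam ^+ 2 < 2 & 2 `^ p <= 2 * lam ^+ 2].
Proof.
move=> p2; have w4 : 2 `^ p < 4 :> R.
  have -> : 4 = 2 `^ 2%:R :> R by rewrite powR_mulrn// expr2 -natrM.
  by rewrite /powR gt_eqF// ltr_expR ltr_pM2r// ln_gt0 ?ltr1n.
(* The second entry keeps [lam] above [1] when [p] is small. *)
pose m := Num.max (2 `^ p / 2) (3 / 2) : R.
have m1 : 3 / 2 <= m by rewrite le_max lexx orbT.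
have m2 : m < 2 by rewrite gt_max; apply/andP; split; lra.
have m3 : 2 `^ p / 2 <= m by rewrite le_max lexx.
have m0 : 0 <= m by lra.
exists (Num.sqrt m); rewrite sqr_sqrtr//; split=> //; last by lra.
by rewrite -(ltr_sqr (x := 1)) ?nnegrE ?sqrtr_ge0// expr1n sqr_sqrtr//; lra.
Qed.

Lemma campanato_mobius p : 0 <= p < 2 -> exists2 C : R, 0 < C & forall h B S a,
  analytic_on_disk h -> hardy_le h B -> 0 < S -> cabs a < 1 ->
  (forall alpha l, 0 < l <= 2 * pi ->
    (sqint alpha (alpha + l) (fun t => (boundary h (expi t) - arc_mean h alpha l)%R)
     <= (S ^+ 2 * l `^ p)%:E)%E) ->
  hardy_le (fun z => h (sigma a z) - h a) (C * S ^+ 2 * (1 - cabs a ^+ 2) `^ (p - 1)).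
Proof.
move=> /andP[p0 p2]; have [lam [l1 l2 lp]] := ex_geometric_ratio p2.
have [C C0 hC] := dyadic_poisson_bound l1 l2.
exists (12 * C); first exact: mulr_gt0.
move=> h B S a ah hB S0 a1 hS.
have [x ax] := polar a; set r := cabs a in a1 ax *.
have r01 : 0 <= r < 1 by rewrite cabs_ge0.
have d01 : 0 < 1 - r <= 1 by case/andP: r01 => q0 q1; apply/andP; split; lra.
have [K dK] := ex_dyadic d01.
have D0 := dyadic_gt0 R K; set D := dyadic R K in D0 dK.
have p2' j : 0 < 2 ^+ j :> R by rewrite exprn_gt0.
pose l j := 2 ^+ j * (2 * D).
have l0 j : 0 < l j by rewrite /l mulr_gt0// mulr_gt0.
have piE : pi = 2 ^+ K * D by rewrite /D /dyadic mulrC divfK// gt_eqF.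
have lpi j : (j <= K)%N -> l j <= 2 * pi.
  move=> jK; rewrite piE /l mulrCA ler_pM2l// ler_wpM2r ?(ltW D0)//.
  by rewrite ler_weXn2l// ler1n.
have ljp j : l j `^ p = (2 `^ p) ^+ j * (2 * D) `^ p.
  rewrite /l powRM ?(ltW (p2' j)) ?(ltW (mulr_gt0 _ D0))//; congr (_ * _).
  by rewrite -(powR_mulrn j (powR_ge0 2 p)) -(powR_mulrn j (ler0n R 2)) powRAC.
pose c j := arc_mean h (x - 2 ^+ j * D) (l j).
(* The [3] is the factor [2] of [intg_le_boundary] plus its slack [e], taken equal to the bound
   itself. *)
pose A := 3 * S ^+ 2 * (2 * D) `^ p / D.
have A0 : 0 <= A by rewrite divr_ge0 ?(ltW D0)// mulr_ge0 ?powR_ge0// mulr_ge0// sqr_ge0.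
have near_j (j : 'I_K.+1) : \forall k \near \oo,
    intg (x - 2 ^+ j * D) (x + 2 ^+ j * D) (fun t => cabs (circ h (dilr R k) t - c j) ^+ 2)
     <= A * (2 * lam ^+ 2) ^+ j * D.
  have jK : (j <= K)%N by rewrite -ltnS.
  have e0 : 0 < S ^+ 2 * l j `^ p by rewrite mulr_gt0 ?exprn_gt0// powR_gt0.
  have lI : 0 < l j <= 2 * pi by rewrite l0 lpi.
  have := intg_le_boundary ah hB e0 (hS (x - 2 ^+ j * D) (l j) lI).
  have -> : x - 2 ^+ j * D + l j = x + 2 ^+ j * D by rewrite /l; ring.
  apply: filterS => k hk; apply: (le_trans hk).
  have -> : 2 * (S ^+ 2 * l j `^ p) + S ^+ 2 * l j `^ p = 3 * S ^+ 2 * (2 * D) `^ p * (2 `^ p) ^+ j.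
    by rewrite ljp; ring.
  have -> : A * (2 * lam ^+ 2) ^+ j * D = 3 * S ^+ 2 * (2 * D) `^ p * (2 * lam ^+ 2) ^+ j.
    by rewrite /A mulrAC divfK// gt_eqF.
  rewrite ler_wpM2l//; first by rewrite mulr_ge0 ?powR_ge0// mulr_ge0// sqr_ge0.
  by apply: lerXn2r; rewrite ?nnegrE ?powR_ge0// mulr_ge0// sqr_ge0.
(* [A] is [6 * S ^+ 2] times a power of [2 * D], and [2 * D] is comparable to [1 - r ^+ 2] with
   factor [2]. *)
have bound : C * A <= 12 * C * S ^+ 2 * (1 - r ^+ 2) `^ (p - 1).
  have r2 : 0 < 1 - r ^+ 2 by exact: cabs_sqr_lt1.
  have r2E : 1 - r ^+ 2 = (1 - r) * (1 + r) by ring.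
  case/andP: r01 => q0 q1; case/andP: dK => dK1 dK2.
  have e1 : 2 * D <= 2 * (1 - r ^+ 2) by rewrite r2E; nra.
  have e2 : 1 - r ^+ 2 <= 2 * (2 * D) by rewrite r2E; nra.
  have pI : -1 <= p - 1 <= 1 by apply/andP; split; lra.
  have D20 : 0 < 2 * D by rewrite mulr_gt0.
  have := powR_comparable _ D20 r2 e1 e2 pI; rewrite ler1n => /(_ isT) h1.
  have -> : A = 6 * S ^+ 2 * (2 * D) `^ (p - 1).
    rewrite /A powRB; last by rewrite (gt_eqF D20) implybT.
    by rewrite powRr1 ?(ltW D20)//; field; rewrite gt_eqF.
  have -> : 12 * C * S ^+ 2 * (1 - r ^+ 2) `^ (p - 1) = C * (6 * S ^+ 2 * (2 * (1 - r ^+ 2) `^ (p - 1))).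
    by ring.
  by rewrite ler_pM2l// ler_wpM2l// mulr_ge0// sqr_ge0.
apply: (mobius_hardy_le ah a1).
(* Only [K + 1] arcs occur, so the estimates on circles hold for all of them at once as soon as [k]
   is large. Minimality then replaces the center by the arc mean [c 0]. *)
apply: filterS (filter_forall _ near_j) => k hk.
apply: le_trans bound; rewrite ax.
have rk := dilr_itv R k.
apply: le_trans (@rmean_cabs_min R h (dilr R k) _ (c 0%N) ah rk _) _.
  by rewrite -ax.
apply: (hC _ c A r x K (continuous_circ ah rk) _ A0 r01 dK).
  by move=> t; exact: circ_period.
by move=> j jK; have jK' : (j < K.+1)%N by []; exact: (hk (Ordinal jK')).
Qed.

Lemma mobius_campanato p : 0 <= p < 2 -> forall h B G,
  analytic_on_disk h -> hardy_le h B -> 0 <= G ->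
  (forall a, cabs a < 1 ->
    hardy_le (fun z => h (sigma a z) - h a) (G ^+ 2 * (1 - cabs a ^+ 2) `^ (p - 1))) ->
  (campanato_seminorm p h <= (41 * G)%:E)%E.
Proof.
move=> /andP[p0 p2] h B G ah hB G0 hG; apply: seminorm_le; first exact: mulr_ge0.
move=> alpha l /andP[l0 lpi]; have pi0 := pi_gt0 R; have pi4 := pi_lt4 R; have pi2 := pi_ge2 R.
have tp := twopi_gt0 R.
(* The test point lies over the midpoint of the arc at depth [d] proportional to [l]; the full
   circle corresponds to [a = 0]. *)
pose d := l / (2 * pi); have d0 : 0 < d by exact: divr_gt0.
have d1 : d <= 1 by rewrite ler_pdivrMr// mul1r.
have ldE : l = 2 * pi * d by rewrite /d mulrC divfK// gt_eqF.
pose r := 1 - d; have r01 : 0 <= r < 1 by rewrite /r; apply/andP; split; lra.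
pose x := alpha + l / 2; pose a := rc r * expi x.
have ra : cabs a = r by rewrite cabs_circ//; case/andP: r01.
have a1 : cabs a < 1 by rewrite ra; case/andP: r01.
have l0p : 0 < l `^ p by exact: powR_gt0.
set m := h a.
(* The threshold makes the modulus less than [1 / 3], for which the Harnack factor
   [(1 + w) / (1 - w)] is at most [2]. *)
have hw : \forall k \near \oo, cabs (sigma a (rc (dilr R k) * a)) ^+ 2 < 9^-1.
  have /derivable_continuous sc := sigma_analytic a1 a1.
  have cw : sigma a (rc (dilr R k) * a) @[k --> \oo] --> sigma a a.
    apply: (@cvg_comp _ _ _ (fun k => rc (dilr R k) * a) (sigma a) _ (nbhs a)); last exact: sc.
    have : rc (dilr R k) * a @[k --> \oo] --> 1 * a by apply: cvgM; [exact: rc_dilr_cvg|exact: cvg_cst].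
    by rewrite mul1r.
  have hc : cabs (sigma a (rc (dilr R k) * a)) ^+ 2 @[k --> \oo] --> (0 : R).
    have := cvg_cabs2 cw; rewrite sigma_self.
    have -> : cabs (0 : cplx R) ^+ 2 = 0 by rewrite cabs0 expr0n.
    exact.
  have e0 : (0 : R) < 9^-1 by rewrite invr_gt0.
  move/cvgrPdist_lt : hc => /(_ _ e0); apply: filterS => k.
  by rewrite sub0r normrN => /(le_lt_trans (ler_norm _)).
(* [272 = 17 * 2 * 8]: the kernel bound on the arc, the Harnack factor, and the comparison of [l]
   with [1 - cabs a ^+ 2]. *)
have bound : \forall k \near \oo, intg alpha (alpha + l) (fun t => cabs (circ h (dilr R k) t - m) ^+ 2)
    <= 272 * (G ^+ 2 * l `^ p).
  apply: filterS hw => k hk; have rk := dilr_itv R k.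
  have hm := hardy_le_mobius ah a1 rk (hG a a1).
  set w := cabs (sigma a _) in hk hm; have w0 : 0 <= w := cabs_ge0 _.
  have w3 : w < 3^-1.
    rewrite -(ltr_sqr (y := 3^-1)) ?nnegrE// ?invr_ge0//; apply: (lt_le_trans hk).
    by rewrite exprVn expr2 -natrM.
  have hw2 : (1 + w) / (1 - w) <= 2 by rewrite ler_pdivrMr; lra.
  have cc : continuous (fun _ : R => m) by move=> t; exact: cvg_cst.
  have cv := continuous_cabs2 (continuousBc (continuous_circ ah rk) cc).
  have cvP := continuousM_real cv (continuous_poisson a1).
  have vP0 t : 0 <= cabs (circ h (dilr R k) t - m) ^+ 2 * poisson a t.
    by rewrite mulr_ge0 ?sqr_ge0// ltW// poisson_gt0.
  have P1 : 0 <= G ^+ 2 * (1 - cabs a ^+ 2) `^ (p - 1) by rewrite mulr_ge0 ?sqr_ge0 ?powR_ge0.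
  (* On the arc [|t - x| <= pi * d <= 4 * d], so the kernel is at least
     [d / (d ^+ 2 + 16 * d ^+ 2)], that is, [1 / (17 * d)]. *)
  have step1 : intg alpha (alpha + l) (fun t => cabs (circ h (dilr R k) t - m) ^+ 2) <=
      intg alpha (alpha + l) (fun t => 17 * d * (cabs (circ h (dilr R k) t - m) ^+ 2 * poisson a t)).
    apply: le_intg => //; first exact: continuousZ_real.
    move=> t /andP[t1 t2].
    rewrite mulrCA -[leLHS]mulr1 ler_wpM2l ?sqr_ge0//.
    apply: (@le_trans _ _ (17 * d * ((1 - r) / ((1 - r) ^+ 2 + (t - x) ^+ 2)))); last first.
      have y0 : 0 <= 17 * d by rewrite mulr_ge0// ltW.
      exact: (ler_wpM2l y0 (poisson_ge_center x t r01)).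
    have -> : 1 - r = d by rewrite /r; ring.
    have dd : 0 < d ^+ 2 + (t - x) ^+ 2 by rewrite ltr_wpDr ?sqr_ge0// exprn_gt0.
    rewrite mulrA ler_pdivlMr// mul1r.
    have tx : `|t - x| <= pi * d by rewrite ler_norml /x; apply/andP; split; lra.
    have tx2 : (t - x) ^+ 2 <= (4 * d) ^+ 2.
      have d4 : 0 <= 4 * d by rewrite mulr_ge0// ltW.
      rewrite -real_normK ?num_real// ler_sqr ?nnegrE//.
      by apply: (le_trans tx); rewrite ler_wpM2r ?(ltW d0)// ltW.
    by apply: (le_trans (lerD (lexx _) tx2)); rewrite le_eqVlt; apply/orP; left; apply/eqP; ring.
  apply: (le_trans step1); rewrite intgZ//.
  have step2 : intg alpha (alpha + l) (fun t => cabs (circ h (dilr R k) t - m) ^+ 2 * poisson a t) <=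
     2 * pi * rmean (fun t => cabs (circ h (dilr R k) t - m) ^+ 2 * poisson a t).
    rewrite (@rmean_interval R _ (alpha + pi) cvP); last by move=> t; rewrite circ_period poisson_period.
    rewrite mulrA divff ?gt_eqF// mul1r addrK.
    by apply: intg_subset => //; lra.
  apply: (le_trans (ler_wpM2l _ step2)); first by rewrite mulr_ge0// ltW.
  have -> : 17 * d * (2 * pi * rmean (fun t => cabs (circ h (dilr R k) t - m) ^+ 2 * poisson a t)) =
     17 * l * rmean (fun t => cabs (circ h (dilr R k) t - m) ^+ 2 * poisson a t) by rewrite ldE; ring.
  apply: (le_trans (ler_wpM2l _ (le_trans hm (ler_wpM2r P1 hw2)))); first by rewrite mulr_ge0// ltW.
  have r2 : 0 < 1 - cabs a ^+ 2 by exact: cabs_sqr_lt1.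
  have r2E : 1 - cabs a ^+ 2 = d * (1 + r) by rewrite ra /r; ring.
  case/andP: r01 => q0 q1.
  have e1 : 1 - cabs a ^+ 2 <= 8 * l by rewrite r2E ldE; nra.
  have e2 : l <= 8 * (1 - cabs a ^+ 2) by rewrite r2E ldE; nra.
  have pI : -1 <= p - 1 <= 1 by apply/andP; split; lra.
  have := powR_comparable _ r2 l0 e1 e2 pI; rewrite ler1n => /(_ isT) h1.
  have -> : l `^ p = l * l `^ (p - 1).
    rewrite powRB; last by rewrite (gt_eqF l0) implybT.
    by rewrite powRr1 ?(ltW l0)// mulrCA divff ?mulr1// gt_eqF.
  have y0 : 0 <= 34 * l * G ^+ 2 by rewrite mulr_ge0 ?sqr_ge0// mulr_ge0// ltW.
  have := ler_wpM2l y0 h1.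
  set P := (1 - cabs a ^+ 2) `^ (p - 1); set Q := l `^ (p - 1) => h2.
  have -> : 17 * l * (2 * (G ^+ 2 * P)) = 34 * l * G ^+ 2 * P by ring.
  by apply: (le_trans h2); rewrite le_eqVlt; apply/orP; left; apply/eqP; ring.
apply: (le_trans (sqint_arc_mean ah hB l0 (sqint_boundary_le_cst ah hB bound))).
rewrite lee_fin exprMn.
(* The constant [41] satisfies [6 * 272 <= 41 ^+ 2]. *)
have y0 : 0 <= G ^+ 2 * l `^ p by rewrite mulr_ge0 ?sqr_ge0// ltW.
by lra.
Qed.

End Characterisation.

(** * Composition operators *)

Section TestFunctions.
Variable R : realType.
Implicit Types (B p q S r : R) (a b c z w : cplx R) (f g h phi : cplx R -> cplx R).

Lemma hardy_le_scale h c B : analytic_on_disk h -> hardy_le h B ->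
  hardy_le (fun z => c * h z) (cabs c ^+ 2 * B).
Proof.
move=> ah hB r r01.
have -> : rmean (fun t => cabs (circ (fun z => c * h z) r t) ^+ 2) =
    rmean (fun t => cabs c ^+ 2 * cabs (circ h r t) ^+ 2).
  by apply: eq_rmean => t; rewrite -exprMn -cabsM.
rewrite rmeanZ; last exact: (continuous_cabs2 (continuous_circ ah r01)).
by rewrite ler_wpM2l ?sqr_ge0//; exact: hB.
Qed.

Lemma selfmap_hardy_le g : selfmap g -> hardy_le g 1.
Proof.
move=> [ag sg] r r01; rewrite -[leRHS](@rmean_cst R).
apply: ler_rmean; [exact: (continuous_cabs2 (continuous_circ ag r01))|by move=> t; exact: cvg_cst|].
move=> t; rewrite expr_le1 ?cabs_ge0//; apply: ltW; apply: sg.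
by rewrite cabs_circ; case/andP: r01.
Qed.

(** A variance is the mean square, here at most [1], minus the square of the mean [g 0]. *)
Lemma selfmap_sub_hardy_le g : selfmap g -> hardy_le (fun z => g z - g 0) (1 - cabs (g 0) ^+ 2).
Proof.
move=> sg r r01; have ag := sg.1; have cg := continuous_circ ag r01.
have c1 : continuous (fun _ : R => 1 : R) by move=> t; exact: cvg_cst.
have h1 := rmean_cabs_sub (g 0) cg c1 (rmean_cst 1).
have e1 : cmean (fun t => circ g r t * rc 1) = g 0.
  by rewrite -(mean_value ag r01); apply: cmean_eq => t; exact: mulr1.
rewrite e1 in h1; set m := g 0 in h1 *.
have e2 : complex.Re (m * conjz m) = cabs m ^+ 2 by rewrite mul_conjz.
have e3 : rmean (fun t => cabs (circ g r t) ^+ 2 * 1) = rmean (fun t => cabs (circ g r t) ^+ 2).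
  by apply: eq_rmean => t; rewrite mulr1.
have e4 : rmean (fun t => cabs (circ (fun z => g z - m) r t) ^+ 2) = rmean (fun t => cabs (circ g r t - m) ^+ 2 * 1).
  by apply: eq_rmean => t; rewrite mulr1.
rewrite e4 h1 e2 e3; have := selfmap_hardy_le sg r01; lra.
Qed.

Lemma hardy_le_of_sub0 h B : analytic_on_disk h -> hardy_le (fun z => h (sigma 0 z) - h 0) B ->
  hardy_le h (2 * B + 2 * cabs (h 0) ^+ 2).
Proof.
move=> ah hB r r01; have z1 : cabs (0 : cplx R) < 1 by rewrite cabs0.
have h1 := hardy_le_mobius ah z1 r01 hB.
rewrite mulr0 sigma_self cabs0 addr0 subr0 divr1 mul1r in h1.
have ch := continuous_circ ah r01.
have cc : continuous (fun _ : R => h 0) by move=> t; exact: cvg_cst.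
have cv := continuous_cabs2 (continuousBc ch cc).
have h2 : rmean (fun t => cabs (circ h r t - h 0) ^+ 2) <= B.
  apply: le_trans h1; rewrite le_eqVlt; apply/orP; left; apply/eqP; apply: eq_rmean => t.
  by rewrite /poisson mul0r subr0 cabs1 cabs0 expr0n expr1n subr0 divr1 mulr1.
have c1 : continuous (fun _ : R => 2 * cabs (h 0) ^+ 2) by move=> t; exact: cvg_cst.
apply: (@le_trans _ _ (rmean (fun t => 2 * cabs (circ h r t - h 0) ^+ 2 + 2 * cabs (h 0) ^+ 2))).
  apply: ler_rmean; first exact: (continuous_cabs2 ch).
    exact: (continuousD_real (continuousZ_real cv) c1).
  by move=> t; apply: le_trans (cabs_sqrD _ _); rewrite subrK.
rewrite (rmeanD (continuousZ_real cv) c1) (rmeanZ _ cv) rmean_cst.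
by rewrite lerD2r ler_pM2l.
Qed.

Lemma hardy_le_growth h B w : analytic_on_disk h -> hardy_le h B -> cabs w < 1 ->
  cabs (h w) ^+ 2 <= (1 + cabs w) / (1 - cabs w) * B.
Proof.
move=> ah hB w1.
have hc : cabs (h (rc (dilr R n) * w)) ^+ 2 @[n --> \oo] --> cabs (h w) ^+ 2.
  exact: (cvg_cabs2 (dilate_cvg ah w1)).
rewrite -(cvg_lim (@Rhausdorff R) hc); apply: limr_le; first by apply/cvg_ex; eexists; exact: hc.
apply: nearW => n; have rn := dilr_itv R n; apply: (le_trans (jensen ah rn w1)).
have cv := continuous_cabs2 (continuous_circ ah rn).
have k0 : 0 <= (1 + cabs w) / (1 - cabs w).
  by rewrite divr_ge0 ?subr_ge0 ?(ltW w1)// addr_ge0// cabs_ge0.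
apply: (le_trans (ler_rmean (continuousM_real cv (continuous_poisson w1)) (continuousZ_real cv) _)).
  by move=> t; rewrite mulrC; apply: ler_wpM2r; [exact: sqr_ge0|exact: (poisson_le t w1)].
by rewrite (rmeanZ _ cv) ler_wpM2l//; exact: hB.
Qed.

(** Both exponents in [x ^ p * y ^ (2 - p)] are nonnegative and they add up to [2], so the product
    is at most [(2 * m) ^+ 2]. It is meant for [x = 1 - |b|^2], [y = 1 - |c|^2] and
    [m = |1 - conjz b * c|]. *)
Lemma powR_product_le p (x y m : R) : 0 <= p <= 2 -> 0 < x -> 0 < y -> x <= 2 * m -> y <= 2 * m ->
  x `^ (p - 1) * (x * y / m ^+ 2) <= 4 * y `^ (p - 1).
Proof.
move=> /andP[p0 p2] x0 y0 xm ym; have m0 : 0 < 2 * m by exact: (lt_le_trans x0).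
have m0' : 0 < m by move: m0; rewrite pmulr_rgt0.
have h1 : x `^ p <= (2 * m) `^ p by rewrite ge0_ler_powR// nnegrE ltW.
have h2 : y `^ (2 - p) <= (2 * m) `^ (2 - p) by rewrite ge0_ler_powR ?subr_ge0// nnegrE ltW.
have e1 : x `^ (p - 1) * x = x `^ p.
  rewrite powRB; last by rewrite (gt_eqF x0) implybT.
  by rewrite powRr1 ?(ltW x0)// divfK// gt_eqF.
have e2 : y = y `^ (2 - p) * y `^ (p - 1).
  rewrite -powRD; last by rewrite (gt_eqF y0) implybT.
  by rewrite (_ : 2 - p + (p - 1) = 1) ?powRr1 ?(ltW y0)//; ring.
have e3 : (2 * m) `^ p * (2 * m) `^ (2 - p) = 4 * m ^+ 2.
  rewrite -powRD; last by rewrite (gt_eqF m0) implybT.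
  rewrite (_ : p + (2 - p) = 2%:R); last by ring.
  by rewrite powR_mulrn ?(ltW m0)// exprMn [2 ^+ 2]expr2 -natrM.
have h3 : x `^ p * y `^ (2 - p) <= 4 * m ^+ 2.
  by rewrite -e3; apply: ler_pM; rewrite ?powR_ge0.
have -> : x `^ (p - 1) * (x * y / m ^+ 2) = x `^ (p - 1) * x * y / m ^+ 2 by ring.
rewrite e1 [X in _ * X / _]e2 ler_pdivrMr ?exprn_gt0// mulrA.
have := ler_wpM2r (powR_ge0 y (p - 1)) h3; move=> h4; apply: (le_trans h4).
by rewrite le_eqVlt; apply/orP; left; apply/eqP; ring.
Qed.

Definition test_function p b z : cplx R :=
  rc (Num.sqrt ((1 - cabs b ^+ 2) `^ (p - 1))) * (sigma b z - b).

Lemma test_function_analytic p b : cabs b < 1 -> analytic_on_disk (test_function p b).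
Proof.
move=> b1 z z1; have sb := sigma_analytic b1.
exact: (derivableMc (derivable_cstc z (rc (Num.sqrt ((1 - cabs b ^+ 2) `^ (p - 1)))))
  (derivableBc (sb z z1) (derivable_cstc z b))).
Qed.

Lemma cabs_test_scale p b : cabs b < 1 ->
  cabs (rc (Num.sqrt ((1 - cabs b ^+ 2) `^ (p - 1)))) ^+ 2 = (1 - cabs b ^+ 2) `^ (p - 1).
Proof. by move=> b1; rewrite cabs_rc ger0_norm ?sqrtr_ge0// sqr_sqrtr// powR_ge0. Qed.

(** The function is a multiple of the self-map [sigma b \o sigma c] minus its value at [0], so its
    squared norm is governed by [1 - |sigma b c|^2], which factors by [sigma_cabs2]. *)
Lemma test_function_mobius p b c : 0 <= p < 2 -> cabs b < 1 -> cabs c < 1 ->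
  hardy_le (fun z => test_function p b (sigma c z) - test_function p b c)
    (2 ^+ 2 * (1 - cabs c ^+ 2) `^ (p - 1)).
Proof.
move=> /andP[p0 p2] b1 c1.
have sg := selfmap_comp (sigma_selfmap b1) (sigma_selfmap c1).
have h0 := selfmap_sub_hardy_le sg; rewrite sigma_zero sigma_cabs2 in h0; last exact: sigma_den_neq0.
have ag := analytic_subc (sigma b c) sg.1.
have h1 := hardy_le_scale (rc (Num.sqrt ((1 - cabs b ^+ 2) `^ (p - 1)))) ag h0.
rewrite cabs_test_scale// in h1.
have h2 : hardy_le (fun z => test_function p b (sigma c z) - test_function p b c)
    ((1 - cabs b ^+ 2) `^ (p - 1) * ((1 - cabs b ^+ 2) * (1 - cabs c ^+ 2) / cabs (1 - conjz b * c) ^+ 2)).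
  by apply: eq_hardy_le h1 => z _; rewrite /test_function; ring.
move=> r r01; apply: (le_trans (h2 r r01)).
have -> : 2 ^+ 2 = 4 :> R by rewrite expr2 -natrM.
have d1 : 1 - cabs b * cabs c <= cabs (1 - conjz b * c).
  have := cabsB_ge (1 : cplx R) (conjz b * c); by rewrite cabs1 cabsM cabs_conj.
have b0 := cabs_ge0 b; have c0 := cabs_ge0 c.
apply: powR_product_le; rewrite ?cabs_sqr_lt1 ?p0 ?(ltW p2)//; nra.
Qed.

Lemma test_function_campanato p b : 0 <= p < 2 -> cabs b < 1 ->
  [/\ campanato p (test_function p b), test_function p b 0 = 0 &
    (campanato_seminorm p (test_function p b) <= 82%:E)%E].
Proof.
move=> pI b1; have at_ := @test_function_analytic p b b1.
have z1 : cabs (0 : cplx R) < 1 by rewrite cabs0.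
have hB := hardy_le_of_sub0 at_ (test_function_mobius pI b1 z1).
have hs : (campanato_seminorm p (test_function p b) <= 82%:E)%E.
  rewrite (_ : 82 = 41 * 2 :> R); last by rewrite -natrM.
  by apply: (mobius_campanato pI at_ hB (ler0n R 2)) => c; exact: test_function_mobius.
split=> //; last by rewrite /test_function sigma_zero subrr mulr0.
by split; [apply/hardy2P; split=> //; eexists; exact: hB|exact: (le_lt_trans hs (ltry _))].
Qed.

End TestFunctions.

Section Boundedness.
Variable R : realType.
Implicit Types (B p q S r : R) (a b c z w : cplx R) (f g h : cplx R -> cplx R).

Lemma campanato_seminorm_ge0 p h : (0 <= campanato_seminorm p h)%E.
Proof.
apply: le_trans (ereal_sup_ubound _); last first.
  by exists (0, 1) => //=; rewrite ltr01 /=; have := pi_ge2 R; lra.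
exact: poweR_ge0.
Qed.

Lemma campanato_norm_ge0 p h : (0 <= campanato_norm p h)%E.
Proof. by rewrite adde_ge0 ?campanato_seminorm_ge0// lee_fin cabs_ge0. Qed.

Lemma campanato_seminorm_fine p h : campanato p h ->
  campanato_seminorm p h = (fine (campanato_seminorm p h))%:E.
Proof. by move=> [_ hs]; rewrite fineK// ge0_fin_numE// campanato_seminorm_ge0. Qed.

Definition weight p q (phi : cplx R -> cplx R) a : R :=
  (1 - cabs a ^+ 2) `^ (1 - q) / (1 - cabs (phi a) ^+ 2) `^ (1 - p).

Variable phi : cplx R -> cplx R.
Hypothesis phi_self : selfmap phi.

Lemma weight_gt0 p q a : cabs a < 1 -> 0 < weight p q phi a.
Proof.
move=> a1; have b1 := phi_self.2 a a1.
by rewrite divr_gt0// powR_gt0// cabs_sqr_lt1.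
Qed.

Lemma weightE p q a : cabs a < 1 ->
  (1 - cabs (phi a) ^+ 2) `^ (p - 1) / weight p q phi a = (1 - cabs a ^+ 2) `^ (q - 1).
Proof.
move=> a1; have b1 := phi_self.2 a a1.
have pa := powR_gt0 (1 - q) (cabs_sqr_lt1 a1); have pb := powR_gt0 (1 - p) (cabs_sqr_lt1 b1).
rewrite -(opprB 1 p) powRN -(opprB 1 q) powRN /weight invf_div mulrC.
by rewrite mulrAC divff ?mul1r// gt_eqF.
Qed.

Lemma conj_selfmap a : cabs a < 1 -> selfmap (fun z => sigma (phi a) (phi (sigma a z))).
Proof.
move=> a1; have b1 := phi_self.2 a a1.
exact: (selfmap_comp (sigma_selfmap b1) (selfmap_comp phi_self (sigma_selfmap a1))).
Qed.

Lemma comp_mobius_hardy_le f a B B' : cabs a < 1 -> analytic_on_disk f ->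
  hardy_le (fun z => f (sigma (phi a) z) - f (phi a)) B ->
  hardy_le (fun z => sigma (phi a) (phi (sigma a z))) B' ->
  hardy_le (fun z => f (phi (sigma a z)) - f (phi a)) (20 * B * B').
Proof.
move=> a1 af hB hB'; have b1 := phi_self.2 a a1.
have ag := analytic_subc (f (phi a)) (analytic_comp af (sigma_selfmap b1)).
apply: eq_hardy_le (hardy_le_comp ag _ (conj_selfmap a1) _ hB hB').
- move=> z z1; rewrite sigmaK//; apply: phi_self.2; exact: sigma_disk.
- by rewrite sigma_zero subrr.
- by rewrite sigma_zero sigma_self.
Qed.

(** Stated for any [S > 0] above the seminorm, which may itself vanish. In [M], the part [41 * G]
    serves the seminorm, and [H] serves the value at [phi 0], needed because the norm contains the
    value at the origin. *)
Lemma composition_estimate p q X : 0 <= p < 2 -> 0 <= q < 2 -> 0 <= X ->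
  (forall a, cabs a < 1 ->
    ((weight p q phi a)%:E * norm2 (sigma (phi a) \o phi \o sigma a) ^+ 2 <= X%:E)%E) ->
  exists2 M : R, 0 <= M & forall f S, campanato p f -> 0 < S ->
    (campanato_seminorm p f <= S%:E)%E ->
    [/\ hardy2 (f \o phi), (campanato_seminorm q (f \o phi) <= (M * S)%:E)%E &
        cabs (f (phi 0)) <= cabs (f 0) + M * S].
Proof.
move=> pI qI X0 hX; have [C C0 hC] := campanato_mobius pI.
have z1 : cabs (0 : cplx R) < 1 by rewrite cabs0.
have b1 := phi_self.2 0 z1; set b := phi 0 in b1.
have [G G0 G2] : exists2 G : R, 0 <= G & G ^+ 2 = 20 * C * (X / pi).
  exists (Num.sqrt (20 * C * (X / pi))); rewrite ?sqrtr_ge0// sqr_sqrtr//.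
  by rewrite mulr_ge0 ?divr_ge0 ?pi_ge0// mulr_ge0// ltW.
have [H H0 H2] : exists2 H : R, 0 <= H & H ^+ 2 = (1 + cabs b) / (1 - cabs b) * C.
  exists (Num.sqrt ((1 + cabs b) / (1 - cabs b) * C)); rewrite ?sqrtr_ge0// sqr_sqrtr//.
  by rewrite mulr_ge0 ?(ltW C0)// divr_ge0 ?subr_ge0 ?(ltW b1)// addr_ge0// cabs_ge0.
exists (41 * G + H); first by rewrite addr_ge0// mulr_ge0.
move=> f S [hf sf] S0 fS.
have [af [B hB]] := (hardy2P f).1 hf.
have S0' := ltW S0.
have arcs alpha l (lI : 0 < l <= 2 * pi) := seminorm_sqint alpha S0' fS lI.
have mob a : cabs a < 1 ->
    hardy_le (fun z => f (phi (sigma a z)) - f (phi a)) ((G * S) ^+ 2 * (1 - cabs a ^+ 2) `^ (q - 1)).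
  move=> a1; have ba := phi_self.2 a a1.
  have h1 := hC f B S (phi a) af hB S0 ba arcs.
  have ss := conj_selfmap a1; have k0 := weight_gt0 p q a1.
  have := hX a a1; rewrite -lee_pdivlMl// -EFinM => h2.
  have h3 := hardy_le_norm2 ss.1 (selfmap_hardy_le ss) h2.
  have := comp_mobius_hardy_le a1 af h1 h3.
  rewrite -(weightE p q a1) exprMn G2.
  rewrite (_ : 20 * _ * _ = 20 * C * (X / pi) * S ^+ 2 *
    ((1 - cabs (phi a) ^+ 2) `^ (p - 1) / weight p q phi a))//.
  by set w := weight _ _ _ _; set P := _ `^ _; ring.
have afp : analytic_on_disk (f \o phi) := analytic_comp af phi_self.
have hfp := hardy_le_of_sub0 afp (mob 0 z1).
have GS0 : 0 <= G * S by rewrite mulr_ge0.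
split.
- by apply/hardy2P; split=> //; eexists; exact: hfp.
- apply: (le_trans (mobius_campanato qI afp hfp GS0 mob)).
  rewrite lee_fin (_ : (41 * G + H) * S = 41 * (G * S) + H * S); last by ring.
  by rewrite lerDl mulr_ge0.
have h0 := hC f B S 0 af hB S0 z1 arcs.
rewrite cabs0 expr0n subr0 powR1 mulr1 in h0.
have ag := analytic_subc (f 0) (analytic_comp af (sigma_selfmap z1)).
have nb1 : cabs (- b) < 1 by rewrite cabsN.
have := hardy_le_growth ag h0 nb1.
(* [sigma 0] is [z |-> - z], so the growth estimate for [f \o sigma 0 - f 0] has to be taken at
   [- b]. *)
have -> : sigma 0 (- b) = b.
  have -> : sigma 0 (- b) = (0 - - b) / (1 - conjz 0 * - b) by [].
  have -> : conjz (0 : cplx R) = 0 by apply/eqP; rewrite eq_complex /= oppr0 !eqxx.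
  by rewrite mul0r subr0 divr1 sub0r opprK.
rewrite cabsN mulrA -H2 -exprMn ler_sqr ?nnegrE ?cabs_ge0 ?mulr_ge0// => h5.
have := cabsD (f b - f 0) (f 0); rewrite subrK => h6; apply: (le_trans h6).
rewrite addrC lerD2l; apply: (le_trans h5).
rewrite (_ : (41 * G + H) * S = 41 * (G * S) + H * S); last by ring.
by rewrite lerDr mulr_ge0.
Qed.

Lemma composition_bounded p q X : 0 <= p < 2 -> 0 <= q < 2 -> 0 <= X ->
  (forall a, cabs a < 1 ->
    ((weight p q phi a)%:E * norm2 (sigma (phi a) \o phi \o sigma a) ^+ 2 <= X%:E)%E) ->
  bounded_campanato_operator p q (composition_operator phi).
Proof.
move=> pI qI X0 hX; have [M M0 hM] := composition_estimate pI qI X0 hX.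
have bound f : campanato p f -> forall S, fine (campanato_seminorm p f) < S ->
    [/\ hardy2 (f \o phi), (campanato_seminorm q (f \o phi) <= (M * S)%:E)%E &
        cabs (f (phi 0)) <= cabs (f 0) + M * S].
  move=> cf S sS; have sE := campanato_seminorm_fine cf.
  have s0 : 0 <= fine (campanato_seminorm p f) by rewrite fine_ge0// campanato_seminorm_ge0.
  by apply: hM => //; [exact: (le_lt_trans s0)|rewrite sE lee_fin ltW].
split; [|by move=> c f g _ _ z _|].
- move=> f cf; have [h1 h2 _] := bound f cf _ (ltr_pwDr ltr01 (lexx _)).
  by split=> //; exact: (le_lt_trans h2 (ltry _)).
exists (1 + 2 * M) => f cf; set s := fine (campanato_seminorm p f).
have sE : campanato_seminorm p f = s%:E := campanato_seminorm_fine cf.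
have s0 : 0 <= s by rewrite fine_ge0// campanato_seminorm_ge0.
(* The strict bound on the seminorm is obtained by adding [e / (2 * M + 1)], which the constant
   [2 * M] in front of it turns into at most [e]. *)
rewrite /campanato_norm sE -EFinD -EFinM; apply/lee_addgt0Pr => e e0.
have m0 : 0 < 2 * M + 1 by rewrite ltr_wpDl// mulr_ge0.
have d0 : 0 < e / (2 * M + 1) by exact: divr_gt0.
have sS : s < s + e / (2 * M + 1) by rewrite ltrDl.
have [_ h1 h2] := bound f cf _ sS.
have h3 : ((cabs ((f \o phi) 0))%:E <= (cabs (f 0) + M * (s + e / (2 * M + 1)))%:E)%E.
  by rewrite lee_fin; exact: h2.
apply: (le_trans (leeD h3 h1)).
rewrite -!EFinD lee_fin.
have hd : 2 * M * (e / (2 * M + 1)) <= e.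
  by rewrite mulrCA ger_pMr// ler_pdivrMr// mul1r lerDl.
have c0 := cabs_ge0 (f 0); set y := e / _ in hd *.
have y1 : 0 <= M * cabs (f 0) by rewrite mulr_ge0.
by rewrite mulrDr mulrDl; lra.
Qed.

Lemma bounded_weight p q : 0 <= p < 2 -> 0 <= q < 2 ->
  bounded_campanato_operator p q (composition_operator phi) ->
  exists X : R, forall a, cabs a < 1 ->
    ((weight p q phi a)%:E * norm2 (sigma (phi a) \o phi \o sigma a) ^+ 2 <= X%:E)%E.
Proof.
move=> pI qI [Tp _ [M hM]]; have [C C0 hC] := campanato_mobius qI.
(* [82] bounds the norm of every test function, which vanishes at [0]; the added [1] makes [N]
   positive. *)
pose N := `|M| * 82 + 1; have N0 : 0 < N by rewrite ltr_wpDl// mulr_ge0.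
exists (2 * pi * (C * N ^+ 2)) => a a1.
have b1 := phi_self.2 a a1; set b := phi a in b1 *.
have [cf f0 hf] := test_function_campanato pI b1; set f := test_function p b in cf f0 hf.
have [h2 _] := Tp f cf; have [af [B hB]] := (hardy2P _).1 h2.
have sN : (campanato_seminorm q (f \o phi) <= N%:E)%E.
  apply: (@le_trans _ _ (campanato_norm q (f \o phi))).
    by rewrite /campanato_norm leeDr// lee_fin cabs_ge0.
  apply: (le_trans (hM f cf)).
  apply: (@le_trans _ _ (`|M|%:E * campanato_norm p f)%E).
    by rewrite lee_wpmul2r ?campanato_norm_ge0// lee_fin ler_norm.
  apply: (@le_trans _ _ (`|M|%:E * 82%:E)%E).
    by rewrite lee_wpmul2l ?lee_fin// /campanato_norm f0 cabs0 add0e.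
  by rewrite -EFinM lee_fin lerDl.
have arcs alpha l (lI : 0 < l <= 2 * pi) := seminorm_sqint alpha (ltW N0) sN lI.
have h1 := hC (f \o phi) B N a af hB N0 a1 arcs.
have k0 : 0 < (1 - cabs b ^+ 2) `^ (p - 1) by rewrite powR_gt0// cabs_sqr_lt1.
pose k := rc (Num.sqrt ((1 - cabs b ^+ 2) `^ (p - 1))).
have kk : cabs k ^+ 2 = (1 - cabs b ^+ 2) `^ (p - 1) := cabs_test_scale p b1.
have k_neq0 : k != 0.
  by apply/eqP => k00; move: k0; rewrite -kk k00 cabs0 expr0n ltxx.
have ss := conj_selfmap a1.
have ag : analytic_on_disk (fun z => (f \o phi) (sigma a z) - (f \o phi) a).
  exact: (analytic_subc ((f \o phi) a) (analytic_comp af (sigma_selfmap a1))).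
have h3 : hardy_le (fun z => sigma b (phi (sigma a z)))
    (cabs k^-1 ^+ 2 * (C * N ^+ 2 * (1 - cabs a ^+ 2) `^ (q - 1))).
  (* As [sigma b b = 0], the constants cancel and [f \o phi \o sigma a - f b] is exactly [k] times
     [sigma b \o phi \o sigma a]. *)
  apply: eq_hardy_le (hardy_le_scale k^-1 ag h1) => z z1.
  rewrite /= /f /test_function -/k -/b sigma_self sub0r.
  by rewrite -mulrBr opprK subrK mulrA mulVf// mul1r.
have w0 := weight_gt0 p q a1.
apply: (@le_trans _ _ ((weight p q phi a)%:E * (2 * pi * (cabs k^-1 ^+ 2 * (C * N ^+ 2 * (1 - cabs a ^+ 2) `^ (q - 1))))%R%:E)%E).
  by rewrite lee_pmul2l//; exact: norm2_le ss.1 h3.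
rewrite -EFinM lee_fin -(weightE p q a1) -/b cabsV exprVn kk.
rewrite le_eqVlt; apply/orP; left; apply/eqP.
set w := weight _ _ _ _ in w0 *; set P := _ `^ _ in k0 *; move: w0 k0; clear => w0 k0.
by field; rewrite !gt_eqF.
Qed.

End Boundedness.

Theorem theorem1 (R : realType) (phi : cplx R -> cplx R) (p q : R)
    (phi_analytic : analytic_on_disk phi)
    (phi_disk : forall z, unit_disk z -> unit_disk (phi z))
    (p_range : 0 <= p < 2) (q_range : 0 <= q < 2) :
  bounded_campanato_operator p q (composition_operator phi) <->
  (ereal_sup
     [set (((1 - cabs a ^+ 2) `^ (1 - q) /
            (1 - cabs (phi a) ^+ 2) `^ (1 - p))%R)%:E *
          norm2 (sigma (phi a) \o phi \o sigma a) ^+ 2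
     | a in @unit_disk R] < +oo)%E.
Proof.
have sphi : selfmap phi by split.
split=> [hb|]; first have [X hX] := bounded_weight sphi p_range q_range hb.
  apply: (@le_lt_trans _ _ X%:E); last exact: ltry.
  by apply: ge_ereal_sup => _ [a a1 <-]; exact: hX.
set Y := ereal_sup _ => hY.
have hle a : cabs a < 1 ->
    ((weight p q phi a)%:E * norm2 (sigma (phi a) \o phi \o sigma a) ^+ 2 <= Y)%E.
  by move=> a1; apply: ereal_sup_ubound; exists a.
have Y0 : (0 <= Y)%E.
  have z1 : cabs (0 : cplx R) < 1 by rewrite cabs0.
  apply: le_trans (hle 0 z1); rewrite mule_ge0//.
    by rewrite lee_fin ltW// weight_gt0.
  by rewrite norm2_sqr sqint_ge0.
have fY : Y = (fine Y)%:E by rewrite fineK// ge0_fin_numE.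
apply: (composition_bounded sphi p_range q_range (fine_ge0 Y0)) => a a1.
by rewrite -fY; exact: hle.
Qed.
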